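(* For every $n \in \mathbb{N}$, \[\text{mon-ocr}_{\pm}(K_n) = \text{mon-ocr}_+(K_n) = \text{mon-cr}(K_n) = Z(n), \qquad\text{where } Z(n) = \frac{1}{4} \left\lfloor\frac{n}{2}\right\rfloor \left\lfloor\frac{n-1}{2}\right\rfloor \left\lfloor\frac{n-2}{2}\right\rfloor\left\lfloor\frac{n-3}{2}\right\rfloor.\]
   Context: A drawing of a graph in the plane represents vertices by distinct points and edges by simple arcs joining their endpoints, passing through no other vertex; any two edges share finitely many points, no two edges touch at an interior point, and no three edges share an interior point. A crossing is a common interior point of two edges where they properly cross. A drawing is $x$-monotone (monotone) if every edge is an $x$-monotone curve (each vertical line meets it in at most one point) and no two vertices share an $x$-coordinate. A drawing is semisimple if adjacent edges (edges sharing an endpoint) do not cross; it is weakly semisimple if every pair of adjacent edges crosses an even number of times (independent edges may cross arbitrarily). $\text{mon-cr}(G)$ is the minimum number of crossings over all monotone drawings of $G$. $\text{mon-ocr}_+(G)$ is the minimum, over all monotone semisimple drawings of $G$, of the number of pairs of edges crossing an odd number of times. $\text{mon-ocr}_{\pm}(G)$ is the same minimum taken over all monotone weakly semisimple drawings of $G$. *)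

(* Defs.v *)
From mathcomp Require Import all_boot all_order all_algebra.
From mathcomp Require Import finmap.
From mathcomp Require Import all_classical all_reals all_analysis.
From mathcomp Require Import zify.

Set Implicit Arguments.
Unset Strict Implicit.
Unset Printing Implicit Defensive.

Import Order.TTheory GRing.Theory Num.Theory.
Import numFieldNormedType.Exports.

Local Open Scope classical_set_scope.
Local Open Scope ring_scope.

Record graph := Graph {
  vertex :> finType;
  edges : {set {set vertex}};
  edges_card2 : [forall e in edges, #|e| == 2%N] }.

Lemma complete_graph_subproof n :
  [forall e in [set e : {set 'I_n} | #|e| == 2%N]%SET, #|e| == 2%N].
Proof. by apply/forall_inP => e; rewrite inE. Qed.

Definition complete_graph (n : nat) : graph := Graph (complete_graph_subproof n).

Section ProperCrossing.
Context {R : realType}.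

(* [h] is a homeomorphism from the neighbourhood [U] of [p] onto a
   neighbourhood of the origin, with inverse [g], straightening [A] to the
   horizontal axis and [B] to the vertical one. For arcs meeting at an isolated
   point interior to both, the alternative is that they touch there. *)
Definition properly_cross (A B : set (R * R)) (p : R * R) : Prop :=
  exists (U : set (R * R)) (h g : R * R -> R * R),
    [/\ open U, U p & h p = (0, 0)] /\
    [/\ forall q, U q -> {for q, continuous h},
        open (h @` U),
        forall q, U q -> g (h q) = q &
        forall q, (h @` U) q -> {for q, continuous g}] /\
    (forall q, U q -> (A q <-> (h q).2 = 0) /\ (B q <-> (h q).1 = 0)).

End ProperCrossing.

Section Drawing.
Context {R : realType} {G : graph}.

(* The edge [e] is parametrized by the restriction of [edge_arc e] to [0, 1];
   values outside [0, 1], or at sets that are not edges, are irrelevant. *)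
Record predrawing := Predrawing {
  vertex_pos : G -> R * R;
  edge_arc : {set G} -> R -> R * R }.

Implicit Types (D : predrawing) (e f : {set G}).

Definition curve D e : set (R * R) := edge_arc D e @` `[0, 1].

Definition curve_interior D e : set (R * R) := edge_arc D e @` `]0, 1[.

Definition crossings D e f : set (R * R) :=
  [set p | [/\ curve_interior D e p, curve_interior D f p &
               properly_cross (curve D e) (curve D f) p]].

Record is_drawing D : Prop := IsDrawing {
  pos_inj : injective (vertex_pos D);
  arc_continuous : forall e, e \in edges G ->
    {within `[0, 1], continuous (edge_arc D e)};
  arc_simple : forall e, e \in edges G ->
    {in `[0, 1] &, injective (edge_arc D e)};
  arc_ends : forall e, e \in edges G ->
    [set edge_arc D e 0; edge_arc D e 1] = vertex_pos D @` [set` e];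
  curve_vertex : forall e (v : G), e \in edges G ->
    curve D e (vertex_pos D v) -> v \in e;
  curve_finite : forall e f, e \in edges G -> f \in edges G -> e != f ->
    finite_set (curve D e `&` curve D f);
  no_touching : forall e f, e \in edges G -> f \in edges G -> e != f ->
    curve_interior D e `&` curve_interior D f `<=` crossings D e f;
  no_triple_point : forall e1 e2 e3,
    e1 \in edges G -> e2 \in edges G -> e3 \in edges G ->
    e1 != e2 -> e1 != e3 -> e2 != e3 ->
    curve_interior D e1 `&` curve_interior D e2 `&` curve_interior D e3
      = set0 }.

Definition x_monotone (A : set (R * R)) : Prop :=
  forall p q, A p -> A q -> p.1 = q.1 -> p = q.

Record is_monotone_drawing D : Prop := IsMonotoneDrawing {
  monotone_is_drawing : is_drawing D;
  monotone_curve : forall e, e \in edges G -> x_monotone (curve D e);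
  monotone_pos : injective (fun v => (vertex_pos D v).1) }.

(* [fset_set] is only meaningful on finite sets; in a drawing, the sets it is
   applied to below are finite by [curve_finite]. *)
Definition pair_crossing_count D e f : nat := #|` fset_set (crossings D e f)|.

(* Counting points is counting crossings of pairs, by [no_triple_point]. *)
Definition crossing_count D : nat :=
  #|` fset_set [set p | exists e f, [/\ e \in edges G, f \in edges G, e != f &
                                        crossings D e f p]]|.

(* Unordered pairs of edges are counted, as sets [P] of edges. *)
Definition odd_pair_count D : nat :=
  #|[set P : {set {set G}} |
      [exists e in edges G, exists f in edges G,
        [&& e != f, P == [set e; f]%SET & odd (pair_crossing_count D e f)]]]%SET|.

Definition adjacent_edges e f : bool := (e != f) && ~~ [disjoint e & f].

Definition semisimple D : Prop :=
  forall e f, e \in edges G -> f \in edges G -> adjacent_edges e f ->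
    crossings D e f = set0.

Definition weakly_semisimple D : Prop :=
  forall e f, e \in edges G -> f \in edges G -> adjacent_edges e f ->
    ~~ odd (pair_crossing_count D e f).

End Drawing.

Arguments predrawing : clear implicits.

(* [None] when the set is empty. *)
Definition minimum (A : set nat) : option nat :=
  if pselect (exists k, `[< A k >]) is left exA then Some (ex_minn exA)
  else None.

Definition mon_cr (R : realType) (G : graph) : option nat :=
  minimum [set k | exists2 D : predrawing R G,
                     is_monotone_drawing D & crossing_count D = k].

Definition mon_ocr_plus (R : realType) (G : graph) : option nat :=
  minimum [set k | exists2 D : predrawing R G,
                     is_monotone_drawing D /\ semisimple D &
                     odd_pair_count D = k].

Definition mon_ocr_pm (R : realType) (G : graph) : option nat :=
  minimum [set k | exists2 D : predrawing R G,
                     is_monotone_drawing D /\ weakly_semisimple D &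
                     odd_pair_count D = k].

(* Truncated subtraction is harmless: when n < 3 another factor vanishes. The
   division by 4 is exact, see [hill_numberE]. *)
Definition hill_number (n : nat) : nat :=
  ((n %/ 2) * ((n - 1) %/ 2) * ((n - 2) %/ 2) * ((n - 3) %/ 2) %/ 4)%N.

Lemma hill_numberE n :
  (4 * hill_number n =
   (n %/ 2) * ((n - 1) %/ 2) * ((n - 2) %/ 2) * ((n - 3) %/ 2))%N.
Proof.
have even_mul a : (2 %| a * (a - 1))%N.
  by case: a => // a; rewrite subn1 dvdn2 oddM /= andNb.
have E1 : ((n - 2) %/ 2 = n %/ 2 - 1)%N by lia.
have E2 : ((n - 3) %/ 2 = (n - 1) %/ 2 - 1)%N by lia.
rewrite /hill_number mulnC divnK // E1 E2 -mulnA mulnACA -[4%N]/(2 * 2)%N.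
exact: dvdn_mul.
Qed.

(* Main.v *)
Require Import Defs.
From mathcomp Require Import all_boot all_order all_algebra.
From mathcomp Require Import finmap.
From mathcomp Require Import all_classical all_reals all_analysis.
From mathcomp Require Import zify ring lra.

Set Implicit Arguments.
Unset Strict Implicit.
Unset Printing Implicit Defensive.

Import Order.TTheory GRing.Theory Num.Theory.
Import numFieldNormedType.Exports.

(* Number the vertices from left to right and let [s i j k] say that vertex [j]
   lies below edge [ik]. In a weakly semisimple drawing the edges at a vertex
   are linearly ordered on each side of it, which constrains [s]; and the
   number of pairs of edges crossing oddly among four vertices is determined by
   [s] on their triples. Counting the edges that separate the two other
   vertices turns the total into [3 * 'C(n, 4) - \sum_e l_e * r_e], where [l_e]
   and [r_e] vertices lie to the left and to the right of [e], and the removal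
   of the last vertex gives by induction the bound on the numbers of edges with
   few vertices on one side from which the lower bound [hill_number n] follows.

   For the crossing number of an arbitrary monotone drawing, where adjacent
   edges may cross, only the vertical orders of the edges just to the right of
   each vertex are kept. The inversions between consecutive orders bound the
   number of crossings below; if two adjacent edges are inverted, exchanging
   them on the side of their common vertex lowers the number of inversions, so
   a minimal system of orders comes from a constrained [s] as above.

   The bound is attained by a two-page drawing whose edges are arcs of the
   parabolas [y = (x - a) * (b - x)] and [y = - (x - a) * (b - x)], where edge
   [ij] is on the upper page when [(i + j) %% n < n./2]. *)

(** * Sums over quadruples *)

(** Since l + r = n - 2 is the same for all edges, the product l * r is a constant minus a
    combination of truncated differences K - l and K - r with nonnegative coefficients. So only the
    doubly accumulated edge counts [weight] enter the lower bound, and it is these that an induction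
    on n can control: the edges at the last vertex contribute an amount fixed by the linear order
    there, and when K drops by one together with n, every other edge loses 0 or 1, with enough
    losses forced by the linear orders at the leftmost vertices.

    The orders on the two sides of a vertex are never compared with each other. This is why two
    pages may be used independently, and why an exchange of adjacent edges on one side is harmless.

    Crossings are defined by local homeomorphisms, whereas the counting uses vertical orders. The
    link is that a proper crossing of two graphs of functions cannot be a one-sided touching, so
    that an odd number of crossings means a change of order. *)

Section Sum4.
Local Open Scope nat_scope.

Definition sum4 (n : nat) (F : nat -> nat -> nat -> nat -> nat) :=
  \sum_(a < n) \sum_(b < n) \sum_(c < n) \sum_(d < n) F a b c d.

Lemma eq_sum4 n F F' :
  (forall a b c d, a < n -> b < n -> c < n -> d < n -> F a b c d = F' a b c d) ->
  sum4 n F = sum4 n F'.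
Proof. by move=> E; do 4 (apply: eq_bigr => ? _); apply: E. Qed.

Lemma leq_sum4 n F F' :
  (forall a b c d, a < n -> b < n -> c < n -> d < n -> F a b c d <= F' a b c d) ->
  sum4 n F <= sum4 n F'.
Proof. by move=> E; do 4 (apply: leq_sum => ? _); apply: E. Qed.

Lemma sum4D n F F' :
  sum4 n (fun a b c d => F a b c d + F' a b c d) = sum4 n F + sum4 n F'.
Proof.
rewrite /sum4; do 3 (rewrite -big_split; apply: eq_bigr => ? _).
by rewrite big_split.
Qed.

Lemma sum4_swap12 n F : sum4 n F = sum4 n (fun a b => F b a).
Proof. exact: exchange_big. Qed.

Lemma sum4_swap23 n F : sum4 n F = sum4 n (fun a b c => F a c b).
Proof. by apply: eq_bigr => a _; exact: exchange_big. Qed.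

Lemma sum4_swap34 n F : sum4 n F = sum4 n (fun a b c d => F a b d c).
Proof. by do 2 (apply: eq_bigr => ? _); exact: exchange_big. Qed.

Lemma big_ord_lt n b (F : nat -> nat) :
  b <= n -> \sum_(a < n) (a < b) * F a = \sum_(a < b) F a.
Proof.
move=> bn; rewrite (big_ord_widen n F bn) [RHS]big_mkcond /=.
by apply: eq_bigr => a _; case: ifP => _; rewrite (mul1n, mul0n).
Qed.

Lemma sum4_ordered n :
  sum4 n (fun a b c d => (a < b) && (b < c) && (c < d)) * 24 =
  n * (n - 1) * (n - 2) * (n - 3).
Proof.
have E1 b : b <= n -> \sum_(a < n) (a < b) * 1 = b.
  by move=> bn; rewrite (big_ord_lt (fun=> 1)) // sum1_card card_ord.
have E2 c : (\sum_(b < c) b) * 2 = c * (c - 1).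
  elim: c => [|c IH]; first by rewrite big_ord0.
  by rewrite big_ord_recr /= mulnDl IH; nia.
have E3 d : (\sum_(c < d) \sum_(b < c) b) * 6 = d * (d - 1) * (d - 2).
  elim: d => [|d IH]; first by rewrite big_ord0.
  rewrite big_ord_recr /= mulnDl IH -[6]/(2 * 3) mulnA E2.
  by case: d {IH} => [|[|d]] //; rewrite !subSS !subn0; lia.
have E4 m : (\sum_(d < m) \sum_(c < d) \sum_(b < c) b) * 24 =
    m * (m - 1) * (m - 2) * (m - 3).
  elim: m => [|m IH]; first by rewrite big_ord0.
  rewrite big_ord_recr /= mulnDl IH -[24]/(6 * 4) mulnA E3.
  by case: m {IH} => [|[|[|m]]] //; rewrite !subSS !subn0; lia.
rewrite -E4; congr (_ * _).
transitivity (sum4 n (fun d c b a => (c < d) * ((b < c) * ((a < b) * 1)))).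
  rewrite sum4_swap12 sum4_swap23 sum4_swap34 sum4_swap12 sum4_swap23 sum4_swap12.
  by apply: eq_sum4 => a b c d _ _ _ _; do 3 case: (_ < _).
apply: eq_bigr => d _.
rewrite -(big_ord_lt (fun c => \sum_(b < c) b) (ltnW (ltn_ord d))).
apply: eq_bigr => c _.
under eq_bigr do rewrite -big_distrr /=.
rewrite -big_distrr /=; congr (_ * _).
rewrite -(big_ord_lt id (ltnW (ltn_ord c))); apply: eq_bigr => b _.
by rewrite -big_distrr /= E1 // ltnW.
Qed.

(** This turns a sum over an edge and two further vertices into a sum over increasing quadruples, in
    which each of the six edges of a quadruple occurs once. *)
Lemma interleavings (i j v w : nat) :
  (i < j) * (v < w) * [&& v != i, v != j, w != i & w != j] =
  ((i < j) && (j < v) && (v < w)) + ((i < v) && (v < j) && (j < w)) +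
  ((i < v) && (v < w) && (w < j)) + ((v < i) && (i < j) && (j < w)) +
  ((v < i) && (i < w) && (w < j)) + ((v < w) && (w < i) && (i < j)).
Proof.
have [ij|/= ji] := ltnP i j; last first.
  by rewrite !mul0n; do ! (case: ltnP => ? //=); lia.
have [vw|/= vw] := ltnP v w; last first.
  by rewrite !muln0 !mul0n; do ! (case: ltnP => ? //=); lia.
by case: (ltngtP v i) => [?|?|?]; case: (ltngtP v j) => [?|?|?];
  try (exfalso; lia); case: (ltngtP w i) => [?|?|?]; try (exfalso; lia);
  case: (ltngtP w j) => [?|?|?]; try (exfalso; lia).
Qed.

End Sum4.

(** * Signatures of monotone drawings *)

Section Signatures.
Local Open Scope nat_scope.
Variable s : nat -> nat -> nat -> bool.

(** The first two clauses concern the edges from a to the right, the last two the edges from d to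
    the left. Each pair of clauses makes a relation and its complement transitive, which is how a
    linear order looks when it is given on increasing pairs only. *)
Definition signature n := forall a b c d, a < b -> b < c -> c < d -> d < n ->
  [&& s a b c && s a c d ==> s a b d, s a b d ==> s a b c || s a c d,
      s a b d && s b c d ==> s a c d & s a c d ==> s a b d || s b c d].

(* [s i j k] means that vertex [j] lies below edge [ik], for [i < j < k]. The two
   terms are the crossing parities of [ac], [bd] and of [ad], [bc]. *)
Definition cr a b c d : nat := (s a b c == s b c d) + (s a b d != s a c d).

(** For straight edges this says that the triple i, j, w turns counterclockwise, so that w is on the
    left of the line directed from i to j. When w is outside the range of the edge, the middle
    vertex of the triple is i or j, whence the unnegated cases. *)
Definition left_of i j w :=
  if w < i then s w i j else if w < j then ~~ s i w j else s i j w.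

Definition nleft n i j := \sum_(w < n) [&& w != i :> nat, w != j :> nat & left_of i j w].
Definition nright n i j := \sum_(w < n) [&& w != i :> nat, w != j :> nat & ~~ left_of i j w].

Lemma nleftS n i j : i < j -> j < n -> nleft n.+1 i j = nleft n i j + s i j n.
Proof.
move=> ij jn; rewrite /nleft big_ord_recr /= /left_of; congr (_ + _).
have -> : (n < i) = false by lia.
have -> : (n < j) = false by lia.
have -> : n != i by lia.
by have -> : n != j by lia.
Qed.

Lemma nrightS n i j : i < j -> j < n -> nright n.+1 i j = nright n i j + ~~ s i j n.
Proof.
move=> ij jn; rewrite /nright big_ord_recr /= /left_of; congr (_ + _).
have -> : (n < i) = false by lia.
have -> : (n < j) = false by lia.
have -> : n != i by lia.
by have -> : n != j by lia.
Qed.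

Lemma nleft_nright n i j : i < j -> j < n -> nleft n i j + nright n i j = n - 2.
Proof.
move=> ij; elim: n => // n IH jn.
have [jn'|nj] := ltnP j n.
  by rewrite nleftS // nrightS // addnACA IH //; case: s => /=; lia.
have {}nj : n = j by lia.
subst n; rewrite /nleft /nright -big_split /=.
rewrite (bigD1 (Ordinal (ltnW (ij : i.+1 < j.+1)))) //= eqxx /= add0n.
rewrite (bigD1 (Ordinal (ltnSn j))) /=; last by rewrite -val_eqE /=; lia.
rewrite eqxx andbF /= add0n.
transitivity (\sum_(k < j.+1 | (k != Ordinal (ltnW (ij : i.+1 < j.+1))) && (k != Ordinal (ltnSn j))) 1).
  apply: eq_bigr => k /andP[]; rewrite -!val_eqE /= => -> ->.
  by case: left_of.
rewrite sum1_card; set x := Ordinal _; set y := Ordinal _.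
have := cardC [set x; y]; rewrite card_ord cards2 -val_eqE /= (ltn_eqF ij) /=.
have -> : #|[predC [set x; y]]| = #|[pred k | (k != x) && (k != y)]|.
  by apply: eq_card => k; rewrite !inE negb_or.
by move=> h; rewrite -[in RHS]h addKn.
Qed.

(** On each quadruple, [cr] plus the number of those of its six edges that separate the other two
    vertices is 3; this is checked on all values of s that a signature allows. The product of
    [nleft] and [nright] counts the pairs that an edge separates. *)
Lemma sum_cr_nleft_nright n : signature n ->
  sum4 n (fun a b c d => ((a < b) && (b < c) && (c < d)) * cr a b c d) +
  \sum_(j < n) \sum_(i < j) nleft n i j * nright n i j =
  3 * sum4 n (fun a b c d => (a < b) && (b < c) && (c < d)).
Proof.
move=> sg.
pose sep i j v w : nat := left_of i j v != left_of i j w.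
pose o a b c d : nat := (a < b) && (b < c) && (c < d).
have -> : \sum_(j < n) \sum_(i < j) nleft n i j * nright n i j =
    sum4 n (fun j i v w => (i < j) * [&& v != i, v != j, w != i, w != j,
         left_of i j v & ~~ left_of i j w]).
  apply: eq_bigr => j _.
  rewrite -(big_ord_lt (fun i => nleft n i j * nright n i j) (ltnW (ltn_ord j))).
  apply: eq_bigr => i _; rewrite /nleft /nright big_distrlr /= big_distrr /=.
  apply: eq_bigr => v _; rewrite big_distrr /=; apply: eq_bigr => w _.
  rewrite mulnb; congr (_ * nat_of_bool _).
  case: (v == i :> nat); case: (v == j :> nat) => //=.
  by case: (w == i :> nat); case: (w == j :> nat); rewrite ?andbF.
(* A separated pair has exactly one vertex on the left; listing the pair as v < w merges the two
   possibilities into [sep]. *)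
have -> : sum4 n (fun j i v w => (i < j) * [&& v != i, v != j, w != i, w != j,
         left_of i j v & ~~ left_of i j w]) =
   sum4 n (fun j i v w => (i < j) * (v < w) * [&& v != i, v != j, w != i & w != j] * sep i j v w).
  transitivity (sum4 n (fun j i v w => (i < j) * (v < w) * [&& v != i, v != j, w != i, w != j,
         left_of i j v & ~~ left_of i j w]) +
    sum4 n (fun j i v w => (i < j) * (w < v) * [&& v != i, v != j, w != i, w != j,
         left_of i j v & ~~ left_of i j w])).
    rewrite -sum4D; apply: eq_sum4 => j i v w _ _ _ _.
    by case: (ltngtP v w) => [||<-]; rewrite ?muln0 ?muln1 ?mul0n ?addn0 ?andbN ?andbF ?muln0.
  rewrite [X in _ + X]sum4_swap34 -sum4D; apply: eq_sum4 => j i v w _ _ _ _.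
  rewrite -mulnDr -!mulnA; congr (_ * (_ * _)); rewrite /sep.
  case: (v == i); case: (v == j); case: (w == i); case: (w == j) => //=.
  by case: (left_of i j v); case: (left_of i j w).
have -> : sum4 n (fun j i v w => (i < j) * (v < w) * [&& v != i, v != j, w != i & w != j] * sep i j v w) =
   sum4 n (fun j i v w => o i j v w * sep i j v w) +
   sum4 n (fun j i v w => o i v j w * sep i j v w) +
   sum4 n (fun j i v w => o i v w j * sep i j v w) +
   sum4 n (fun j i v w => o v i j w * sep i j v w) +
   sum4 n (fun j i v w => o v i w j * sep i j v w) +
   sum4 n (fun j i v w => o v w i j * sep i j v w).
  rewrite -!sum4D; apply: eq_sum4 => j i v w _ _ _ _.
  by rewrite -!mulnDl interleavings.
(* Variables are permuted so that all six sums run over the same increasing quadruple a, b, c, d. *)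
have E1 : sum4 n (fun j i v w => o i j v w * sep i j v w) =
          sum4 n (fun a b c d => o a b c d * sep a b c d).
  by rewrite sum4_swap12.
have E2 : sum4 n (fun j i v w => o i v j w * sep i j v w) =
          sum4 n (fun a b c d => o a b c d * sep a c b d).
  by rewrite sum4_swap12 sum4_swap23.
have E3 : sum4 n (fun j i v w => o i v w j * sep i j v w) =
          sum4 n (fun a b c d => o a b c d * sep a d b c).
  by rewrite sum4_swap12 sum4_swap23 sum4_swap34.
have E4 : sum4 n (fun j i v w => o v i j w * sep i j v w) =
          sum4 n (fun a b c d => o a b c d * sep b c a d).
  by rewrite sum4_swap12 sum4_swap23 sum4_swap12.
have E5 : sum4 n (fun j i v w => o v i w j * sep i j v w) =
          sum4 n (fun a b c d => o a b c d * sep b d a c).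
  by rewrite sum4_swap12 sum4_swap23 sum4_swap34 sum4_swap12.
have E6 : sum4 n (fun j i v w => o v w i j * sep i j v w) =
          sum4 n (fun a b c d => o a b c d * sep c d a b).
  by rewrite sum4_swap12 sum4_swap23 sum4_swap34 sum4_swap12 sum4_swap23.
rewrite {}E1 {}E2 {}E3 {}E4 {}E5 {}E6 !mulSn mul0n addn0 -!sum4D.
apply: eq_sum4 => a b c d _ _ _ dn; rewrite /o.
case abcd : [&& a < b, b < c & c < d]; last by move: abcd; do 3 case: (_ < _).
have [ab bc cd] := and3P abcd.
have := sg a b c d ab bc cd dn; rewrite /cr /sep /left_of ab bc cd /=.
have lt x y : x < y -> (x < y) * (~~ (y < x)) by move=> xy; rewrite xy -leqNgt ltnW.
have [ac bd] := (ltn_trans ab bc, ltn_trans bc cd).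
rewrite !((lt _ _ ab).1, (lt _ _ bc).1, (lt _ _ cd).1, (lt _ _ ac).1, (lt _ _ bd).1).
rewrite !(negbTE (lt _ _ ab).2, negbTE (lt _ _ bc).2, negbTE (lt _ _ cd).2,
  negbTE (lt _ _ ac).2, negbTE (lt _ _ bd).2, negbTE (lt _ _ (ltn_trans ac cd)).2).
by case: (s a b c); case: (s a b d); case: (s a c d); case: (s b c d).
Qed.

End Signatures.

(** * Linear orders given by their values on increasing pairs *)

Section Ranks.
Local Open Scope nat_scope.
Variables (t : nat -> nat -> bool) (N : nat).
Hypothesis tP : forall a b c, a < b -> b < c -> c < N ->
  (t a b && t b c ==> t a c) && (t a c ==> t a b || t b c).

Definition precedes x y :=
  if x < y then t x y else if y < x then ~~ t y x else false.

Definition rank x := \sum_(y < N) precedes y x.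

Lemma precedesC x y : x != y -> precedes y x = ~~ precedes x y.
Proof. by rewrite /precedes; case: (ltngtP x y) => //=; case: t. Qed.

Lemma precedes_trans x y z : x < N -> y < N -> z < N ->
  precedes x y -> precedes y z -> precedes x z.
Proof.
move=> xN yN zN; rewrite /precedes.
case: (ltngtP x y) => [xy|yx|//]; case: (ltngtP y z) => [yz|zy|//].
- by rewrite (ltn_trans xy yz); have := tP xy yz zN; do 3 case: t.
- case: (ltngtP x z) => [xz|zx|<-].
  + by have := tP xz zy yN; do 3 case: t.
  + by have := tP zx xy yN; do 3 case: t.
  + by case: t.
- case: (ltngtP x z) => [xz|zx|<-].
  + by have := tP yx xz zN; do 3 case: t.
  + by have := tP yz zx xN; do 3 case: t.
  + by case: t.
- rewrite (ltn_trans zy yx) ltnNge (ltnW (ltn_trans zy yx)) /=.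
  by have := tP zy yx xN; do 3 case: t.
Qed.

Lemma rank_lt x y : x < N -> y < N -> precedes x y -> rank x < rank y.
Proof.
move=> xN yN xy; rewrite /rank (bigD1 (Ordinal xN)) //= [X in _ < X](bigD1 (Ordinal xN)) //=.
rewrite xy /precedes ltnn ltnS; apply: leq_sum => z _.
case E : (if z < x then _ else _) => //; rewrite -/(precedes z y).
by rewrite (precedes_trans _ xN yN) //; exact: ltn_ord.
Qed.

Lemma rank_ltN x : x < N -> rank x < N.
Proof.
move=> xN; rewrite /rank (bigD1 (Ordinal xN)) //= {1}/precedes ltnn add0n.
apply: (@leq_ltn_trans (\sum_(i < N | i != Ordinal xN) 1)).
  by apply: leq_sum => i _; case: precedes.
by rewrite sum1_card cardC1 card_ord; lia.
Qed.

(** The rank strictly increases along a total order, so it is injective and permutes the N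
    places. *)
Lemma sum_rank (f : nat -> nat) : \sum_(x < N) f (rank x) = \sum_(k < N) f k.
Proof.
pose g (x : 'I_N) := Ordinal (rank_ltN (ltn_ord x)).
have gi : injective g.
  move=> x y [] E; apply: val_inj => /=; apply/eqP/negPn/negP => xy.
  have := precedesC xy; case xy' : (precedes x y) => /= yx.
    by have := rank_lt (ltn_ord x) (ltn_ord y) xy'; rewrite E ltnn.
  by have := rank_lt (ltn_ord y) (ltn_ord x) yx; rewrite E ltnn.
by rewrite [RHS](reindex_inj gi).
Qed.

End Ranks.

Lemma sum_truncated_rank m K : (K <= m)%N ->
  ((\sum_(k < m) (K - k)) * 2 = K * K.+1)%N.
Proof.
move=> Km; have -> : (\sum_(k < m) (K - k) = \sum_(k < K) (K - k))%N.
  rewrite (big_ord_widen m (fun k => (K - k)%N) Km) [RHS]big_mkcond /=.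
  by apply: eq_bigr => k _; case: ltnP => // ?; lia.
elim: K {Km} => [|K IH]; first by rewrite big_ord0.
rewrite big_ord_recl /= subn0 mulnDl.
by under eq_bigr do rewrite subSS; rewrite IH; lia.
Qed.

(** The place m is excluded. For r < L, the place r serves if it is below m; otherwise r + N.+1 - L,
    one of the last L places, is above m because L <= N. The L places so chosen are distinct. *)
Lemma sum_two_ended N m L : (L <= N)%N -> (m <= N)%N ->
  (L <= \sum_(k < N.+1) (((k < m) && (k < L)) || ((m < k) && (N - k < L))))%N.
Proof.
move=> LN mN.
pose g0 r := (if r < m then r else r + N.+1 - L)%N.
have gP (r : 'I_L) : (g0 r < N.+1)%N.
  rewrite /g0; by have := ltn_ord r; case: ifP; lia.
pose g r := Ordinal (gP r).
have gi : injective g.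
  move=> x y []; rewrite /g0 => E; apply: val_inj; move: E => /=.
  by have := ltn_ord x; have := ltn_ord y; do 2 case: ifP; lia.
rewrite -[X in (X <= _)%N]card_ord -(card_codom gi) -sum1_card.
rewrite big_mkcond /=; apply: leq_sum => k _; case: ifP => // /codomP[r ->] /=; rewrite /g0.
by have := ltn_ord r; case: ifP; lia.
Qed.

Lemma sum_split_ord n m N (F : nat -> nat) : n = (m + N)%N ->
  (\sum_(j < n) F j = \sum_(j < m) F j + \sum_(x < N) F (m + x))%N.
Proof. by move->; rewrite big_split_ord. Qed.

(** * Lower bound for signatures by accumulated edge counts *)

Section LowerBound.
Local Open Scope nat_scope.
Variable s : nat -> nat -> nat -> bool.

(* In terms of the numbers [E_k] of edges with [k] vertices on their smaller side,
   [weight n K = \sum_(k < K) (K - k) * E_k] when [K] is at most half of [n - 1]. *)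
Definition weight n K :=
  \sum_(j < n) \sum_(i < j) ((K - nleft s n i j) + (K - nright s n i j)).

Lemma signature_last n : signature s n.+1 -> forall a b c, a < b -> b < c -> c < n ->
  (s a b n && s b c n ==> s a c n) && (s a c n ==> s a b n || s b c n).
Proof.
by move=> sg a b c ab bc cn; have /and4P[_ _ -> ->] := sg a b c n ab bc cn (ltnSn n).
Qed.

Lemma signature_first n i : signature s n -> forall a b c, a < b -> b < c -> c < n - i.+1 ->
  (s i (i.+1 + a) (i.+1 + b) && s i (i.+1 + b) (i.+1 + c) ==> s i (i.+1 + a) (i.+1 + c)) &&
  (s i (i.+1 + a) (i.+1 + c) ==> s i (i.+1 + a) (i.+1 + b) || s i (i.+1 + b) (i.+1 + c)).
Proof.
move=> sg a b c ab bc cn.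
have lts : (i < i.+1 + a) * (i.+1 + a < i.+1 + b) * (i.+1 + b < i.+1 + c) * (i.+1 + c < n).
  by do !split; lia.
by have /and4P[-> ->] := sg i _ _ _ lts.1.1.1 lts.1.1.2 lts.1.2 lts.2.
Qed.

(** For an edge at the last vertex, [nleft] is its rank in the linear order there, hence takes each
    value below n once. Each end of the order contributes 1 + ... + K.+1. *)
Lemma weight_last n K : signature s n.+1 -> K.+1 <= n ->
  K.+1 * K.+2 <=
  \sum_(i < n) ((K.+1 - nleft s n.+1 i n) + (K.+1 - nright s n.+1 i n)).
Proof.
move=> sg Kn.
have E (i : 'I_n) : nleft s n.+1 i n = rank (fun a b => s a b n) n i.
  rewrite /nleft big_ord_recr /= eqxx andbF addn0; apply: eq_bigr => w _.
  have wn := ltn_ord w; rewrite /left_of /precedes wn (ltn_eqF wn) /=.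
  by case: (ltngtP w i).
under eq_bigr => i _.
  have -> : nright s n.+1 i n = n.-1 - rank (fun a b => s a b n) n i.
    by have := nleft_nright s (ltn_ord i) (ltnSn n); rewrite E; lia.
  rewrite E; over.
rewrite (sum_rank (signature_last sg) (fun k => (K.+1 - k) + (K.+1 - (n.-1 - k)))) /=.
rewrite big_split /=.
have -> : \sum_(i < n) (K.+1 - (n.-1 - i)) = \sum_(i < n) (K.+1 - i).
  rewrite [RHS](reindex_inj rev_ord_inj) /=; apply: eq_bigr => i _.
  by congr (_ - _); lia.
by rewrite addnn -muln2 (sum_truncated_rank Kn).
Qed.

(** When vertex n is added and K becomes K.+1, the contribution of an edge to [weight] grows by one
    exactly if the side that does not receive n has at most K vertices. In the order of the edges
    from i to the right, this holds for an edge among the K.+1 - i nearest to one end and lying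
    between that end and the edge to n: on that side it has at most K - i vertices after i, and at
    most i before i. *)
Lemma weight_invariant_at n K i : signature s n.+1 -> K.+2 <= n -> i <= K ->
  K.+1 - i <= \sum_(j < n) (i < j) *
     (if s i j n then nright s n i j <= K else nleft s n i j <= K).
Proof.
move=> sg Kn iK; pose N := n - i.+1.
have N1 : n.+1 - i.+1 = N.+1 by rewrite /N; lia.
pose t a b := s i (i.+1 + a) (i.+1 + b).
have tP a b c : a < b -> b < c -> c < N.+1 ->
    (t a b && t b c ==> t a c) && (t a c ==> t a b || t b c).
  by rewrite -N1; exact: signature_first.
have nE : n = i.+1 + N by rewrite /N; lia.
have LN : K.+1 - i <= N by rewrite /N; lia.
have mN : rank t N.+1 N <= N by rewrite -ltnS rank_ltN.
apply: leq_trans (sum_two_ended LN mN) _.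
rewrite -(sum_rank tP (fun k => ((k < rank t N.+1 N) && (k < K.+1 - i)) || ((rank t N.+1 N < k) && (N - k < K.+1 - i)))).
rewrite big_ord_recr /= !ltnn /= addn0.
rewrite (sum_split_ord (fun j => (i < j) * (if s i j n then nright s n i j <= K else nleft s n i j <= K)) nE).
apply: leq_trans (leq_addl _ _).
apply: leq_sum => x _; rewrite ltn_addr ?mul1n; last by lia.
have xN := ltn_ord x.
have ij : i < i.+1 + x by lia.
have jn : i.+1 + x < n by lia.
(* Only the i vertices to the left of i escape the order t. *)
have rb : \sum_(y < N) precedes t y x <= nright s n i (i.+1 + x) <=
          i + \sum_(y < N) precedes t y x.
  rewrite /nright (sum_split_ord (fun w => nat_of_bool [&& w != i, w != i.+1 + x &
      ~~ left_of s i (i.+1 + x) w]) nE).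
  have -> : \sum_(y < N) [&& i.+1 + y != i, i.+1 + y != i.+1 + x &
      ~~ left_of s i (i.+1 + x) (i.+1 + y)] = \sum_(y < N) precedes t y x.
    apply: eq_bigr => y _; rewrite /left_of /precedes /t.
    have -> : (i.+1 + y < i) = false by lia.
    have -> : (i.+1 + y != i) by lia.
    rewrite eqn_add2l ltn_add2l.
    by case: (ltngtP y x) => //=; rewrite negbK.
  rewrite leq_addl leq_add2r /= big_ord_recr /= eqxx /= addn0.
  by rewrite -[X in _ <= X]card_ord -sum1_card; apply: leq_sum => y _; case: andP.
have rE : rank t N.+1 x = \sum_(y < N) precedes t y x + precedes t N x.
  by rewrite /rank big_ord_recr.
have NxE : precedes t N x = ~~ s i (i.+1 + x) n.
  by rewrite /precedes ltnNge (ltnW xN) xN /= /t -nE.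
have lr := nleft_nright s ij jn.
case sE : (s i (i.+1 + x) n) in NxE *.
  have : rank t N.+1 x < rank t N.+1 N.
    by apply: (rank_lt tP) => //; [exact: ltnW | rewrite precedesC ?NxE //; lia].
  by move: rE; rewrite NxE; case: (_ || _) / orP => // -[] /andP[]; lia.
have : rank t N.+1 N < rank t N.+1 x by apply: (rank_lt tP) => //; exact: ltnW.
by move: rE; rewrite NxE; case: (_ || _) / orP => // -[] /andP[]; lia.
Qed.

(** From K to K.+1 the left side grows by 3 * K.+1 * K.+2: two thirds of it come from the edges at
    the last vertex, one third from the other edges whose contribution grows. *)
Lemma weight_ge n K : signature s n -> K.+2 <= n ->
  K * K.+1 * K.+2 <= 2 * weight n K.
Proof.
elim: n K => // n IH [|K] // sg Kn.
have sgn : signature s n by move=> a b c d ab bc cd dn; apply: sg => //; exact: ltnW.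
have {IH} := IH K sgn (ltnSE Kn).
rewrite /weight big_ord_recr /=.
have wl := weight_last sg (ltnW (ltnSE Kn)).
have -> : \sum_(j < n) \sum_(i < j) ((K.+1 - nleft s n.+1 i j) + (K.+1 - nright s n.+1 i j)) =
  \sum_(j < n) \sum_(i < j) ((K - nleft s n i j) + (K - nright s n i j)) +
  \sum_(j < n) \sum_(i < j) (if s i j n then nright s n i j <= K else nleft s n i j <= K).
  rewrite -big_split; apply: eq_bigr => j _; rewrite -big_split; apply: eq_bigr => i _ /=.
  by rewrite nleftS // nrightS //; case: (s i j n) => /=; lia.
have : \sum_(i < K.+1) (K.+1 - i) <= \sum_(j < n) \sum_(i < j)
    (if s i j n then nright s n i j <= K else nleft s n i j <= K).
  under [X in _ <= X]eq_bigr => j _.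
    rewrite -(big_ord_lt (fun i => nat_of_bool (if s i j n then nright s n i j <= K else nleft s n i j <= K)) (ltnW (ltn_ord j))).
    over.
  rewrite exchange_big /= (big_ord_widen n (fun i => K.+1 - i)) ?big_mkcond /=; last by lia.
  apply: leq_sum => i _; case: ltnP => // iK.
  by apply: weight_invariant_at => //; lia.
have := sum_truncated_rank (leqnn K.+1).
have -> : K.+1 * K.+2 * K.+3 = K * K.+1 * K.+2 + K.+1 * K.+2 * 3 by ring.
move: wl; move: (K.+1 * K.+2) (K * K.+1 * K.+2) => T T'.
move: (\sum_(j < n) _) (\sum_(j < n) _) (\sum_(i < n) _) (\sum_(i < K.+1) _).
by move=> x y z w wl h1 h2 h3; lia.
Qed.

Lemma sum_cubic M :
  4 * (\sum_(K < M.+1) K * K.+1 * K.+2) = M * M.+1 * M.+2 * M.+3.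
Proof.
elim: M => [|M IH]; first by rewrite big_ord_recr big_ord0.
by rewrite big_ord_recr /= mulnDr IH; ring.
Qed.

Lemma sum_pairs n : 2 * (\sum_(j < n) \sum_(i < j) 1) = n * n.-1.
Proof.
elim: n => [|n IH]; first by rewrite big_ord0.
by rewrite big_ord_recr /= mulnDr IH sum1_card card_ord; case: n {IH}; lia.
Qed.

Lemma sum_truncated m M : m <= M -> 2 * (\sum_(K < M.+1) (K - m)) = (M - m) * (M - m).+1.
Proof.
elim: M => [|M IH]; first by case: m => // _; rewrite big_ord_recr big_ord0.
rewrite leq_eqVlt ltnS => /orP[/eqP->|mM].
  rewrite big1 ?subnn // => K _; have := ltn_ord K; lia.
by rewrite big_ord_recr /= mulnDr IH // subSn //; ring.
Qed.

(* Summation by parts: with [m = minn a b], the sums of [K - m] are triangular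
   numbers, and [a * b = M ^ 2 - (M - m) ^ 2]. *)
Lemma mul_truncated a b M : a + b = M.*2 ->
  a * b + (\sum_(K < M.+1) ((K - a) + (K - b)) + \sum_(K < M) ((K - a) + (K - b))) = M * M.
Proof.
wlog ab : a b / a <= b.
  move=> H; case/orP: (leq_total a b) => [|ba E]; first exact: H.
  rewrite addnC in E; rewrite mulnC -[RHS](H b a ba E).
  by congr (_ + (_ + _)); apply: eq_bigr => K _; rewrite addnC.
move=> E; have aM : a <= M by lia.
have S m : m <= M.+1 -> \sum_(K < m) ((K - a) + (K - b)) = \sum_(K < m) (K - a).
  by move=> mM; apply: eq_bigr => K _; have := ltn_ord K; lia.
have := sum_truncated aM; rewrite !S // big_ord_recr /=.
have [d dE] : exists d, M = a + d by exists (M - a); lia.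
have bE : b = a + d + d by lia.
by rewrite bE dE addKn; nia.
Qed.

(** Here a * b = M * M.+1 - (M - m) * (M - m).+1 with m = minn a b, and the subtracted product is
    twice a triangular number. *)
Lemma mul_truncated_odd a b M : a + b = M.*2.+1 ->
  a * b + 2 * \sum_(K < M.+1) ((K - a) + (K - b)) = M * M.+1.
Proof.
wlog ab : a b / a <= b.
  move=> H; case/orP: (leq_total a b) => [|ba E]; first exact: H.
  rewrite addnC in E; rewrite mulnC -[RHS](H b a ba E).
  by congr (_ + (_ * _)); apply: eq_bigr => K _; rewrite addnC.
move=> E; have aM : a <= M by lia.
have S : \sum_(K < M.+1) ((K - a) + (K - b)) = \sum_(K < M.+1) (K - a).
  by apply: eq_bigr => K _; have := ltn_ord K; lia.
rewrite S sum_truncated //.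
have [d dE] : exists d, M = a + d by exists (M - a); lia.
have bE : b = a + d + d.+1 by lia.
by rewrite bE dE addKn; ring.
Qed.

Lemma sum_weight n m :
  \sum_(K < m) weight n K =
  \sum_(j < n) \sum_(i < j) \sum_(K < m) ((K - nleft s n i j) + (K - nright s n i j)).
Proof. by rewrite exchange_big; apply: eq_bigr => j _; rewrite exchange_big. Qed.

Lemma sum_weight_ge n m : signature s n -> m.+2 <= n ->
  m * m.+1 * m.+2 * m.+3 <= 8 * \sum_(K < m.+1) weight n K.
Proof.
move=> sg mn; rewrite -sum_cubic -[8]/(4 * 2) -mulnA leq_mul2l /= big_distrr /=.
by apply: leq_sum => K _; apply: weight_ge => //; have := ltn_ord K; lia.
Qed.

Lemma sum_cr_ge n : signature s n ->
  hill_number n <= sum4 n (fun a b c d => ((a < b) && (b < c) && (c < d)) * cr s a b c d).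
Proof.
move=> sg; have := sum_cr_nleft_nright sg; have := sum4_ordered n.
have := hill_numberE n.
set X := sum4 _ _; set S := sum4 _ _; set Y := \sum_(j < n) _ => H HS HX.
have [n4|n4] := ltnP n 4.
  by suff -> : hill_number n = 0 by []; case: n n4 {sg HS HX X S Y H} => [|[|[|[|]]]].
have P := sum_pairs n.
(* With this M, the sum n - 2 of [nleft] and [nright] is twice M.+1, or one more, so the product
   formulas apply with M.+1. *)
have [M E] : exists M, n = M.+2.*2 \/ n = M.+2.*2.+1.
  by exists (n./2 - 2); lia.
have AB j (i : 'I_j) : j < n -> nleft s n i j + nright s n i j = n - 2.
  by move=> jn; exact: nleft_nright.
have W1 : M.+1 * M.+2 * M.+3 * M.+4 <= 8 * \sum_(K < M.+2) weight n K.
  by apply: sum_weight_ge => //; lia.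
have W2 : M * M.+1 * M.+2 * M.+3 <= 8 * \sum_(K < M.+1) weight n K.
  by apply: sum_weight_ge => //; lia.
pose w1 := \sum_(K < M.+2) weight n K; pose w2 := \sum_(K < M.+1) weight n K.
rewrite -/w1 in W1; rewrite -/w2 in W2.
case: E => E.
- have : Y + (w1 + w2) =
      (\sum_(j < n) \sum_(i < j) 1) * (M.+1 * M.+1).
    rewrite /w1 /w2 !sum_weight -!big_split big_distrl; apply: eq_bigr => j _ /=.
    rewrite -!big_split big_distrl; apply: eq_bigr => i _ /=.
    by rewrite mul1n mul_truncated // AB //; lia.
  move: H HS P {AB}; rewrite {}E.
  have -> : M.+2.*2 %/ 2 = M.+2 by lia.
  have -> : (M.+2.*2 - 1) %/ 2 = M.+1 by lia.
  have -> : (M.+2.*2 - 2) %/ 2 = M.+1 by lia.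
  have -> : (M.+2.*2 - 3) %/ 2 = M by lia.
  have -> : M.+2.*2 = M + M + 4 by lia.
  have -> : M + M + 4 - 1 = M + M + 3 by lia.
  have -> : M + M + 4 - 2 = M + M + 2 by lia.
  have -> : M + M + 4 - 3 = M + M + 1 by lia.
  have -> : (M + M + 4).-1 = M + M + 3 by lia.
  move=> H HS P /(congr1 (muln 2)); rewrite [RHS]mulnA P.
  move: H HS HX W1 W2; move: X S Y (hill_number _) w1 w2.
  by move=> *; lia.
- have : Y + 2 * w1 =
      (\sum_(j < n) \sum_(i < j) 1) * (M.+1 * M.+2).
    rewrite /w1 sum_weight big_distrr -!big_split big_distrl; apply: eq_bigr => j _ /=.
    rewrite big_distrr -!big_split big_distrl; apply: eq_bigr => i _ /=.
    by rewrite mul1n mul_truncated_odd // AB //; lia.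
  move: H HS P {AB}; rewrite {}E.
  have -> : M.+2.*2.+1 %/ 2 = M.+2 by lia.
  have -> : (M.+2.*2.+1 - 1) %/ 2 = M.+2 by lia.
  have -> : (M.+2.*2.+1 - 2) %/ 2 = M.+1 by lia.
  have -> : (M.+2.*2.+1 - 3) %/ 2 = M.+1 by lia.
  have -> : M.+2.*2.+1 = M + M + 5 by lia.
  have -> : M + M + 5 - 1 = M + M + 4 by lia.
  have -> : M + M + 5 - 2 = M + M + 3 by lia.
  have -> : M + M + 5 - 3 = M + M + 2 by lia.
  have -> : (M + M + 5).-1 = M + M + 4 by lia.
  move=> H HS P /(congr1 (muln 2)); rewrite [RHS]mulnA P.
  move: H HS HX W1 W2; move: X S Y (hill_number _) w1 w2.
  by move=> *; lia.
Qed.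

End LowerBound.

(** * The signature of a two-page drawing *)

Section TwoPage.
Local Open Scope nat_scope.

(** If the vertices are placed in order on a regular n-gon, (i + j) %% n is the direction of the
    chord ij: the upper page takes n./2 consecutive classes of parallel chords. *)
Definition top_page n i j := (i + j) %% n < n./2.

(* In a two-page drawing, vertex [b] lies below edge [ac] iff [ac] is on the
   upper page. *)
Definition page_signature n (a b c : nat) := top_page n a c.

Lemma modn_below_double n x : x < n + n -> x %% n = if x < n then x else x - n.
Proof.
case: (ltnP x n) => [xn _|nx xnn]; first exact: modn_small.
by rewrite -{1}(subnK nx) modnDr modn_small //; lia.
Qed.

(** For x <= n + n, exactly minn x n./2 + minn (x - n) n./2 numbers below x have a residue below
    n./2; the sum is a difference of two such counts. *)
Lemma count_top_page n i m : i + m <= n + n ->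
  \sum_(w < m) top_page n i w + (minn i n./2 + minn (i - n) n./2) =
  minn (i + m) n./2 + minn (i + m - n) n./2.
Proof.
elim: m => [|m IH] im; first by rewrite big_ord0 addn0.
rewrite big_ord_recr /=; have := IH ltac:(lia).
move: (\sum_(w < m) _) => S; rewrite /top_page modn_below_double; last by lia.
by case: (ltnP (i + m) n) => ?; case: ltnP => ? /=; lia.
Qed.

(** The vertices between i and j are all on the same side. The others contribute through the sums j,
    ..., i + n - 1 with i + j omitted, which the term [top_page n i j] restores. *)
Lemma nleft_two_page n i j : i < j -> j < n ->
  nleft (page_signature n) n i j + top_page n i j + minn j n./2 =
  ~~ top_page n i j * (j - i.+1) + n./2 + minn i n./2.
Proof.
move=> ij jn.
have ji : j + i <= n + n by lia.
have := count_top_page ji.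
have ijn : (i + j).+1 + (n - j.+1) <= n + n by lia.
have := count_top_page ijn.
have -> : (i + j).+1 + (n - j.+1) = i + n by lia.
rewrite (addnC j i).
have -> : nleft (page_signature n) n i j =
   \sum_(w < i) top_page n j w + ~~ top_page n i j * (j - i.+1) + \sum_(w < n - j.+1) top_page n (i + j).+1 w.
  rewrite /nleft (sum_split_ord (n := n) (m := j.+1) (N := n - j.+1) (fun w => nat_of_bool [&& w != i, w != j &
      left_of (page_signature n) i j w])); last by lia.
  congr (_ + _).
    rewrite (sum_split_ord (n := j.+1) (m := i.+1) (N := (j - i.+1).+1) (fun w => nat_of_bool [&& w != i, w != j &
      left_of (page_signature n) i j w])); last by lia.
    rewrite !big_ord_recr /= eqxx /= addn0.
    have -> : i.+1 + (j - i.+1) = j by lia.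
    rewrite eqxx andbF addn0; congr (_ + _).
      apply: eq_bigr => w _; have := ltn_ord w => wi.
      rewrite /left_of wi /page_signature /top_page (addnC j).
      by rewrite (ltn_eqF wi) (ltn_eqF (ltn_trans wi ij)).
    rewrite mulnC -[X in X * _]card_ord -sum_nat_const; apply: eq_bigr => w _.
    have wi := ltn_ord w; rewrite /left_of /page_signature.
    have -> : (i.+1 + w < i) = false by lia.
    have -> : i.+1 + w < j by lia.
    have -> : i.+1 + w != i by lia.
    by have -> : i.+1 + w != j by lia.
  apply: eq_bigr => w _; have wi := ltn_ord w; rewrite /left_of /page_signature.
  have -> : (j.+1 + w < i) = false by lia.
  have -> : (j.+1 + w < j) = false by lia.
  have -> : j.+1 + w != i by lia.
  have -> : j.+1 + w != j by lia.
  by rewrite /top_page /=; congr (nat_of_bool (_ %% _ < _)); lia.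
move: (\sum_(w < i) _) (\sum_(w < n - j.+1) _) (nat_of_bool _ * _) => x y z.
have -> : minn (i + n) n./2 = n./2 by lia.
have -> : minn (j - n) n./2 = 0 by lia.
have -> : i + n - n = i by lia.
have -> : minn (i + j).+1 n./2 = minn (i + j) n./2 + (i + j < n./2) by lia.
have -> : minn ((i + j).+1 - n) n./2 = minn (i + j - n) n./2 + (n <= i + j < n + n./2) by lia.
have -> : nat_of_bool (top_page n i j) = (i + j < n./2) + (n <= i + j < n + n./2).
  rewrite /top_page modn_below_double; last by lia.
  by case: (ltnP (i + j) n) => ?; lia.
by move: (minn _ _) (minn _ _) (minn _ _) (minn _ _) => *; lia.
Qed.

Lemma page_signatureP n : signature (page_signature n) n.
Proof.
move=> a b c d _ _ _ _; rewrite /page_signature.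
by case: (top_page n a d); case: (top_page n a c); case: (top_page n b d).
Qed.

Lemma sum_pairs_split (G : nat -> nat -> nat) h m :
  \sum_(j < h + m) \sum_(i < j) G i j =
  \sum_(j < h) \sum_(i < j) G i j +
  (\sum_(j < m) \sum_(i < h) G i (h + j) + \sum_(j < m) \sum_(i < j) G (h + i) (h + j)).
Proof.
rewrite (sum_split_ord (fun j => \sum_(i < j) G i j) (erefl (h + m))).
by rewrite -big_split; congr (_ + _); apply: eq_bigr => j _; rewrite big_split_ord.
Qed.

Lemma nleft_even h i j : i < j -> j < h + h ->
  nleft (page_signature (h + h)) (h + h) i j =
  if j < h then if i + j < h then h - 1 - (j - i) else h - 1 else
  if i < h then if i + j < h + h then j - 1 else i - 1 else
  if i + j < h + h + h then h - 1 else h + (j - i) - 1.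
Proof.
move=> ij jn; have := nleft_two_page ij jn.
rewrite /top_page modn_below_double; last by lia.
have -> : (h + h)./2 = h by lia.
move: (nleft _ _ _ _) => A.
case: (ltnP j h) => jk; [|case: (ltnP i h) => ik].
- by do ? (case: ifP => ? /=); lia.
- by case: (ltnP (i + j) (h + h)) => ? //=; do ? (case: ifP => ? /=); lia.
- by case: (ltnP (i + j) (h + h + h)) => ? //=; do ? (case: ifP => ? /=); lia.
Qed.

Lemma nleft_odd h i j : i < j -> j < (h + h).+1 ->
  nleft (page_signature (h + h).+1) (h + h).+1 i j =
  if j < h then if i + j < h then h - 1 - (j - i) else h - 1 else
  if i < h then if i + j <= h + h then j - 1 else i - 1 else
  if i + j <= h + h + h then h - 1 else h + (j - i) - 1.
Proof.
move=> ij jn; have := nleft_two_page ij jn.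
rewrite /top_page modn_below_double; last by lia.
have -> : (h + h).+1./2 = h by lia.
move: (nleft _ _ _ _) => A.
case: (ltnP j h) => jk; [|case: (ltnP i h) => ik].
- by do ? (case: ifP => ? /=); lia.
- by case: (leqP (i + j) (h + h)) => ? //=; do ? (case: ifP => ? /=); lia.
- by case: (leqP (i + j) (h + h + h)) => ? //=; do ? (case: ifP => ? /=); lia.
Qed.

(** The factors add up to 2 * (h - 1), so the product falls short of (h - 1) ^ 2 by the square of
    the distance from [nleft] to h - 1. *)
Lemma product_even h i j : i < j -> j < h + h ->
  nleft (page_signature (h + h)) (h + h) i j * nright (page_signature (h + h)) (h + h) i j +
  (if j < h then (i + j < h) * (j - i) ^ 2 else
   if i < h then if i + j < h + h then (j - h) ^ 2 else (h - i) ^ 2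
   else (h + h + h <= i + j) * (j - i) ^ 2) = (h - 1) ^ 2.
Proof.
move=> ij jn; have := nleft_nright (page_signature (h + h)) ij jn.
rewrite nleft_even //; move: (nright _ _ _ _) => B.
rewrite -!mulnn; case: (ltnP j h) => jk; [|case: (ltnP i h) => ik].
- case: ifP => ijh /= E; last by rewrite mul0n addn0; congr (_ * _); lia.
  have [d dE] : exists d, j = i + d by exists (j - i); lia.
  have [r rE] : exists r, h = d + r.+1 by exists (h - d.+1); lia.
  have -> : B = h - 1 + d by lia.
  have -> : j - i = d by lia.
  by rewrite rE addnS subn1 /= addKn; ring.
- case: ifP => ijh /= E.
  + have [d dE] : exists d, j = h + d by exists (j - h); lia.
    have [r rE] : exists r, h = d + r.+1 by exists (h - d.+1); lia.
    have -> : B = r by lia.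
    have -> : j - h = d by lia. have -> : j - 1 = d + d + r by lia.
    have -> : h - 1 = d + r by lia.
    by ring.
  + have [d dE] : exists d, h = i + d by exists (h - i); lia.
    have [r rE] : exists r, i = r.+1 by exists (i.-1); lia.
    have -> : B = r + d + d by lia.
    have -> : h - i = d by lia. have -> : i - 1 = r by lia.
    have -> : h - 1 = d + r by lia.
    by ring.
- case: ifP => ijh /= E; first by rewrite leqNgt ijh mul0n addn0; congr (_ * _); lia.
  rewrite leqNgt ijh mul1n.
  have [d dE] : exists d, j = i + d by exists (j - i); lia.
  have [r rE] : exists r, h = d + r.+1 by exists (h - d.+1); lia.
  have -> : B = r by lia.
  have -> : j - i = d by lia. have -> : h + d - 1 = d + r + d by lia.
  have -> : h - 1 = d + r by lia.
  by ring.
Qed.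

(** Here the factors add up to 2 * h - 1, and products of consecutive numbers replace the
    squares. *)
Lemma product_odd h i j : i < j -> j < (h + h).+1 ->
  nleft (page_signature (h + h).+1) (h + h).+1 i j * nright (page_signature (h + h).+1) (h + h).+1 i j +
  (if j < h then (i + j < h) * ((j - i) * (j - i).+1) else
   if i < h then if i + j <= h + h then (j - h) * (j - h).-1 else (h - i) * (h - i).+1
   else (h + h + h < i + j) * ((j - i) * (j - i).-1)) = h * (h - 1).
Proof.
move=> ij jn; have := nleft_nright (page_signature (h + h).+1) ij jn.
rewrite nleft_odd //; move: (nright _ _ _ _) => B.
case: (ltnP j h) => jk; [|case: (ltnP i h) => ik].
- case: ifP => ijh /= E; last by rewrite mul0n addn0 mulnC; congr (_ * _); lia.
  have [d dE] : exists d, j = i + d by exists (j - i); lia.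
  have [r rE] : exists r, h = d + r.+1 by exists (h - d.+1); lia.
  have -> : B = h + d by lia.
  have -> : j - i = d by lia.
  by rewrite rE addnS subn1 /= addKn; ring.
- case: ifP => ijh /= E.
  + have [d dE] : exists d, j = h + d by exists (j - h); lia.
    have -> : j - h = d by lia.
    have [r rE] : exists r, h = d + r by exists (h - d); lia.
    have -> : B = r by lia.
    have -> : j - 1 = h + d - 1 by lia.
    by rewrite rE; case: d {dE rE} => [|d]; rewrite ?addn0 ?add0n ?muln0 ?addSn ?addnS ?subn1 /=; ring.
  + have [d dE] : exists d, h = i + d by exists (h - i); lia.
    have [r rE] : exists r, i = r.+1 by exists (i.-1); lia.
    have -> : B = r + d + d + 1 by lia.
    have -> : h - i = d by lia. have -> : i - 1 = r by lia.
    have -> : h - 1 = d + r by lia.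
    have -> : h = d + r.+1 by lia.
    by ring.
- case: ifP => ijh /= E.
    by rewrite ltnNge ijh mul0n addn0 mulnC; congr (_ * _); lia.
  rewrite ltnNge ijh mul1n.
  have [d dE] : exists d, j = i + d.+1 by exists (j - i).-1; lia.
  have [r rE] : exists r, h = d + r.+1 by exists (h - d.+1); lia.
  have -> : B = r by lia.
  have -> : j - i = d.+1 by lia. have -> : h + d.+1 - 1 = d + d + r.+1 by lia.
  have -> : h - 1 = d + r by lia.
  by rewrite rE /=; ring.
Qed.

(** The factor h - d is the number of pairs i < j < h with difference d. *)
Definition convolution (f : nat -> nat) h := \sum_(d < h) (h - d) * f d.

Lemma convolutionS f h : convolution f h.+1 = convolution f h + \sum_(d < h.+1) f d.
Proof.
rewrite /convolution !big_ord_recr /= subSnn mul1n addnA; congr (_ + _).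
rewrite -big_split; apply: eq_bigr => d _ /=.
by rewrite subSn ?(ltnW (ltn_ord d)) // mulSn addnC.
Qed.

Lemma sum_differences f h : f 0 = 0 ->
  \sum_(j < h) \sum_(i < j) f (j - i) = convolution f h.
Proof.
move=> f0; elim: h => [|h IH]; first by rewrite /convolution !big_ord0.
rewrite big_ord_recr /= IH convolutionS; congr (_ + _).
rewrite big_ord_recl f0 add0n (reindex_inj rev_ord_inj) /=.
by apply: eq_bigr => i _; congr (f _); rewrite /bump /=; have := ltn_ord i; lia.
Qed.

(** Each branch takes the value f d at h - d places: those with j = d and i < h - d, and those with
    h - i = d and d <= j. *)
Lemma sum_square f h : f 0 = 0 ->
  \sum_(j < h) \sum_(i < h) (if i + j < h then f j else f (h - i)) =
  2 * convolution f h.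
Proof.
move=> f0.
transitivity (\sum_(j < h) \sum_(i < h) (i < h - j) * f j + \sum_(j < h) \sum_(i < h) (h <= i + j) * f (h - i)).
  rewrite -big_split; apply: eq_bigr => j _; rewrite -big_split; apply: eq_bigr => i _ /=.
  by case: ltnP => ? /=; case: ltnP => ? /=; lia.
rewrite mulSn mul1n; congr (_ + _).
  apply: eq_bigr => j _; rewrite (big_ord_lt (fun=> f j)) ?leq_subr //.
  by rewrite sum_nat_const card_ord.
rewrite exchange_big /=.
transitivity (\sum_(i < h.+1) i * f (h - i)).
  rewrite big_ord_recr /= subnn f0 muln0 addn0; apply: eq_bigr => i _.
  rewrite (reindex_inj rev_ord_inj) /=.
  transitivity (\sum_(j < h) (j < i) * f (h - i)).
    by apply: eq_bigr => j _; congr (nat_of_bool _ * _); have := ltn_ord j; lia.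
  by rewrite (big_ord_lt (fun=> f (h - i))) ?sum_nat_const ?card_ord // ltnW.
rewrite (reindex_inj rev_ord_inj) /= big_ord_recr /= subnn mul0n addn0.
by apply: eq_bigr => i _; have := ltn_ord i => ih; congr (_ * f _); lia.
Qed.

Lemma convolution_square h : 12 * convolution (fun d => d ^ 2) h + h * h = h * h * (h * h).
Proof.
have S m : 6 * \sum_(d < m.+1) d ^ 2 = m * m.+1 * (m + m.+1).
  by elim: m => [|m IH]; rewrite big_ord_recr ?big_ord0 //= mulnDr IH -mulnn; ring.
elim: h => [|h IH]; first by rewrite /convolution big_ord0.
by rewrite convolutionS; have := S h; move: IH; move: (convolution _ _) (\sum_(d < h.+1) _); lia.
Qed.

Lemma convolution_pronic h :
  12 * convolution (fun d => d * d.+1) h.+1 = h * h.+1 * h.+2 * h.+3.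
Proof.
have S m : 3 * \sum_(d < m.+1) d * d.+1 = m * m.+1 * m.+2.
  by elim: m => [|m IH]; rewrite big_ord_recr ?big_ord0 //= mulnDr IH; ring.
elim: h => [|h IH]; first by rewrite /convolution big_ord_recr big_ord0.
by rewrite convolutionS; have := S h.+1; move: IH; move: (convolution _ _) (\sum_(d < h.+2) _); lia.
Qed.

(** After a shift by h, the deficits inside the second half sit at i + j >= h, those inside the
    first half at i + j < h: together they fill one triangle, worth one convolution. The edges
    between the halves are worth two. *)
Lemma sum_product_even h :
  let n := h + h in let s := page_signature n in
  \sum_(j < n) \sum_(i < j) nleft s n i j * nright s n i j +
  3 * convolution (fun d => d ^ 2) h = (\sum_(j < n) \sum_(i < j) 1) * (h - 1) ^ 2.
Proof.
move=> n s.
pose G i j := if j < h then (i + j < h) * (j - i) ^ 2 else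
   if i < h then if i + j < h + h then (j - h) ^ 2 else (h - i) ^ 2
   else (h + h + h <= i + j) * (j - i) ^ 2.
transitivity (\sum_(j < n) \sum_(i < j) nleft s n i j * nright s n i j + \sum_(j < n) \sum_(i < j) G i j).
  congr (_ + _); rewrite sum_pairs_split addnCA -[3]/(2 + 1) mulnDl mul1n.
  rewrite -(sum_square (f := fun d => d ^ 2)) // -(sum_differences (f := fun d => d ^ 2)) //.
  congr (_ + _).
    apply: eq_bigr => j _; apply: eq_bigr => i _.
    rewrite /G ltn_ord (ltnNge (h + j)) leq_addr /=.
    by rewrite addnCA ltn_add2l addKn.
  rewrite -big_split; apply: eq_bigr => j _; rewrite -big_split; apply: eq_bigr => i _ /=.
  rewrite /G ltn_ord (ltnNge (h + j)) leq_addr (ltnNge (h + i)) leq_addr /=.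
  rewrite subnDl addnACA leq_add2l.
  by case: (ltnP (i + j) h); rewrite ?mul0n ?mul1n ?addn0.
rewrite -big_split big_distrl; apply: eq_bigr => j _; rewrite -big_split big_distrl.
by apply: eq_bigr => i _ /=; rewrite mul1n product_even.
Qed.

Lemma sum_product_odd h :
  let n := (h + h).+1 in let s := page_signature n in
  \sum_(j < n) \sum_(i < j) nleft s n i j * nright s n i j +
  3 * convolution (fun d => d * d.+1) h = (\sum_(j < n) \sum_(i < j) 1) * (h * (h - 1)).
Proof.
move=> n s.
pose G i j := if j < h then (i + j < h) * ((j - i) * (j - i).+1) else
   if i < h then if i + j <= h + h then (j - h) * (j - h).-1 else (h - i) * (h - i).+1
   else (h + h + h < i + j) * ((j - i) * (j - i).-1).
transitivity (\sum_(j < n) \sum_(i < j) nleft s n i j * nright s n i j + \sum_(j < n) \sum_(i < j) G i j).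
  congr (_ + _); rewrite /n -addnS sum_pairs_split addnCA -[3]/(2 + 1) mulnDl mul1n.
  rewrite -(sum_square (f := fun d => d * d.+1)) // -(sum_differences (f := fun d => d * d.+1)) //.
  congr (_ + _).
    (* The second half has h.+1 vertices. Vertex h has deficit zero towards the first half, and
       shifting the others by one turns d * d.-1 into d * d.+1. *)
    rewrite [RHS]big_ord_recl [X in _ = X + _]big1 ?add0n => [|i _]; last first.
      by rewrite /G ltn_ord addn0 ltnn subnn /= leq_add2r ltnW.
    apply: eq_bigr => j _; apply: eq_bigr => i _.
    rewrite /G ltn_ord (ltnNge (h + _)) leq_addr /= /bump /= add1n.
    by rewrite addnCA leq_add2l addKn addnS mulnC.
  rewrite [X in _ = _ + X]big_ord_recl big_ord0 add0n.
  rewrite -big_split; apply: eq_bigr => j _; rewrite /= /bump /= add1n big_ord_recr /=.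
  rewrite [X in _ = _ + (_ + X)](_ : _ = 0) ?addn0; last first.
    rewrite /G (ltnNge (h + _)) leq_addr /= (ltnNge (h + _)) leq_addr /=.
    by rewrite subnDl subSnn muln0.
  rewrite -big_split; apply: eq_bigr => i _ /=.
  rewrite /G ltn_ord (ltnNge (h + _)) leq_addr (ltnNge (h + i)) leq_addr /=.
  rewrite subnDl addnACA ltn_add2l addnS ltnS subSn ?(ltnW (ltn_ord i)) //= (mulnC (_ - _).+1).
  by case: (ltnP (i + j) h); rewrite ?mul0n ?mul1n ?addn0.
rewrite -big_split big_distrl; apply: eq_bigr => j _; rewrite -big_split big_distrl.
by apply: eq_bigr => i _ /=; rewrite mul1n product_odd.
Qed.

Lemma sum_cr_two_page n :
  sum4 n (fun a b c d => ((a < b) && (b < c) && (c < d)) *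
     cr (page_signature n) a b c d) = hill_number n.
Proof.
have := sum_cr_nleft_nright (page_signatureP (n := n)); have := sum4_ordered n.
have := hill_numberE n.
set X := sum4 _ _; set S := sum4 _ _; set Y := \sum_(j < n) _ => H HS HX.
have P := sum_pairs n.
have [h [E|E]] : exists h, n = h + h \/ n = (h + h).+1.
  by exists n./2; lia.
- move: HX H HS P (sum_product_even h); rewrite /= /Y -E.
  move: (\sum_(j < n) \sum_(i < j) _ * _) => y HX H HS P /(congr1 (muln 2)).
  rewrite [RHS]mulnA P {P}; have := convolution_square h.
  move: X S y (hill_number n) (convolution _ _) HX H HS => X S y z c.
  case: h E => [|k] E; first by rewrite E; lia.
  rewrite E -mulnn; have -> : (k.+1 + k.+1) %/ 2 = k.+1 by lia.
  have -> : (k.+1 + k.+1 - 1) %/ 2 = k by lia.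
  have -> : (k.+1 + k.+1 - 2) %/ 2 = k by lia.
  have -> : (k.+1 + k.+1 - 3) %/ 2 = k - 1 by lia.
  have -> : k.+1 + k.+1 - 1 = k + k + 1 by lia.
  have -> : k.+1 + k.+1 - 2 = k + k by lia.
  have -> : k.+1 + k.+1 - 3 = k + k - 1 by lia.
  have -> : (k.+1 + k.+1).-1 = k + k + 1 by lia.
  have -> : k.+1 - 1 = k by lia.
  case: k {E} => [|k]; first by lia.
  have -> : k.+1 - 1 = k by lia.
  have -> : k.+1 + k.+1 - 1 = k + k + 1 by lia.
  by move=> *; lia.
- move: HX H HS P (sum_product_odd h); rewrite /= /Y -E.
  move: (\sum_(j < n) \sum_(i < j) _ * _) => y HX H HS P /(congr1 (muln 2)).
  rewrite [RHS]mulnA P {P}.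
  case: h E => [|k] E; first by move: HX H HS; rewrite E /convolution big_ord0; lia.
  have := convolution_pronic k.
  move: X S y (hill_number n) (convolution _ _) HX H HS => X S y z c.
  rewrite E; have -> : (k.+1 + k.+1).+1 %/ 2 = k.+1 by lia.
  have -> : ((k.+1 + k.+1).+1 - 1) %/ 2 = k.+1 by lia.
  have -> : ((k.+1 + k.+1).+1 - 2) %/ 2 = k by lia.
  have -> : ((k.+1 + k.+1).+1 - 3) %/ 2 = k by lia.
  have -> : (k.+1 + k.+1).+1 - 1 = k + k + 2 by lia.
  have -> : (k.+1 + k.+1).+1 - 2 = k + k + 1 by lia.
  have -> : (k.+1 + k.+1).+1 - 3 = k + k by lia.
  have -> : (k.+1 + k.+1).+1.-1 = k + k + 2 by lia.
  have -> : k.+1 - 1 = k by lia.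
  by move=> *; lia.
Qed.

End TwoPage.

(** * Uncrossing adjacent edges *)

Section Inversions.
Variables (R : realDomainType) (X : eqType).
Implicit Types (r : seq X) (h t : X -> R).

(** Ties do not count; this matters for edges ending at the same vertex, which are tied there. *)
Definition inversions r h t : nat :=
  (\sum_(a <- r) \sum_(b <- r) ((h a < h b)%R && (t b < t a)%R))%N.

Lemma eq_inversions r h t h' t' : {in r, h =1 h'} -> {in r, t =1 t'} ->
  inversions r h t = inversions r h' t'.
Proof.
move=> hE tE; apply: eq_big_seq => a ar; apply: eq_big_seq => b br.
by rewrite !hE // !tE.
Qed.

Lemma inversionsC r h t : inversions r h t = inversions r t h.
Proof.
rewrite /inversions exchange_big /=; apply: eq_bigr => a _; apply: eq_bigr => b _.
by rewrite andbC.
Qed.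

Definition swap (e f x : X) := if x == e then f else if x == f then e else x.

Lemma swapL e f : swap e f e = f. Proof. by rewrite /swap eqxx. Qed.

Lemma swapR e f : swap e f f = e.
Proof. by rewrite /swap eqxx; case: eqVneq. Qed.

Lemma swapK e f : involutive (swap e f).
Proof.
move=> x; have [->|xe] := eqVneq x e; first by rewrite swapL swapR.
have [->|xf] := eqVneq x f; first by rewrite swapR swapL.
by rewrite /swap (negbTE xe) (negbTE xf) (negbTE xe) (negbTE xf).
Qed.

Lemma inversions_swap_both r h t e f : uniq r -> e \in r -> f \in r ->
  inversions r (h \o swap e f) (t \o swap e f) = inversions r h t.
Proof.
move=> ur er fr; have sr : perm_eq (map (swap e f) r) r.
  apply: uniq_perm => //; first by rewrite map_inj_uniq //; exact: (inv_inj (swapK e f)).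
  have mem x : x \in r -> swap e f x \in r.
    by move=> xr; rewrite /swap; do 2 case: ifP => _ //.
  move=> x; apply/mapP/idP => [[y yr ->]|xr]; first exact: mem.
  by exists (swap e f x); rewrite ?swapK ?mem.
rewrite /inversions -[RHS](perm_big _ sr) big_map; apply: eq_bigr => a _.
by rewrite -[RHS](perm_big _ sr) big_map.
Qed.

Lemma sum_without_pair r (F : X -> X -> nat) e f :
  uniq r -> e \in r -> f \in r -> e != f ->
  (\sum_(a <- r) \sum_(b <- r) F a b =
   \sum_(a <- r | (a != e) && (a != f)) \sum_(b <- r | (b != e) && (b != f)) F a b +
   \sum_(a <- r | (a != e) && (a != f)) (F a e + F a f + F e a + F f a) +
   (F e e + F e f + F f e + F f f))%N.
Proof.
move=> ur er fr ef.
have S (G : X -> nat) : (\sum_(a <- r) G a = G e + (G f + \sum_(a <- r | (a != e) && (a != f)) G a))%N.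
  rewrite (bigD1_seq e) //= -[X in (_ + X)%N]big_filter (bigD1_seq f) ?filter_uniq //=.
    by rewrite big_filter_cond.
  by rewrite mem_filter eq_sym ef.
rewrite S !(S (F _)); under [X in (_ + (_ + X))%N]eq_bigr do rewrite S.
by rewrite !big_split /=; lia.
Qed.

(** The pair e, f stops being inverted, and no third label a forms more inversions with e and f
    together than before, by transitivity through h e < h f and t f < t e. *)
Lemma inversions_swap r h t e f : uniq r -> e \in r -> f \in r ->
  (h e < h f)%R -> (t f < t e)%R ->
  (inversions r (h \o swap e f) t < inversions r h t)%N.
Proof.
move=> ur er fr hef tfe.
have ef : e != f by apply: contraTneq hef => ->; rewrite ltxx.
rewrite /inversions (sum_without_pair _ ur er fr ef) [X in (_ < X)%N](sum_without_pair _ ur er fr ef).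
rewrite /= swapL swapR !ltxx hef tfe /= (lt_gtF hef) (lt_gtF tfe) /= !addn0 add0n addn1 ltnS.
apply: leq_add.
  apply: leq_sum => a /andP[ae af]; apply: leq_sum => b /andP[be bf].
  by rewrite /swap (negbTE ae) (negbTE af) (negbTE be) (negbTE bf).
apply: leq_sum => a /andP[ae af]; rewrite {1 2 3 4}/swap (negbTE ae) (negbTE af).
have := @lt_trans _ _ (h e) (h a) (h f).
have x12 : (h a < h e)%R -> (h a < h f)%R by move/lt_trans; apply.
have y12 : (h f < h a)%R -> (h e < h a)%R by apply: lt_trans.
have a12 : (t e < t a)%R -> (t f < t a)%R by apply: lt_trans.
have b12 : (t a < t f)%R -> (t a < t e)%R by move/lt_trans; apply.
move: x12 y12 a12 b12 => + + + + _.
case: (h a < h e)%R => [/(_ isT) ->|_]; case: (h f < h a)%R => [/(_ isT) ->|_];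
  case: (t e < t a)%R => [/(_ isT) ->|_]; case: (t a < t f)%R => [/(_ isT) ->|_];
  by rewrite ?andbT ?andbF /=; do ? case: (_ < _)%R.
Qed.

End Inversions.

Lemma lt_triple (R : realDomainType) (p q r : R) : p != q ->
  ((p < q)%R && (q < r)%R ==> (p < r)%R) && ((p < r)%R ==> (p < q)%R || (q < r)%R).
Proof.
move=> pq; apply/andP; split; apply/implyP; first by case/andP; exact: lt_trans.
by move=> pr; case: (ltgtP p q) pq => //= qp _; exact: lt_trans qp pr.
Qed.

(** * Vertical orders of the edges between consecutive vertices *)

Section Sweep.
Local Open Scope nat_scope.
Variables (R : realDomainType) (n : nat).
Notation edge := (nat * nat)%type.
Implicit Types (e f x : edge) (H : nat -> edge -> R).

(** An edge is [over] m if it spans the strip between vertices m and m.+1, possibly starting at m;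
    it [passes] m if it runs above or below vertex m. *)
Definition over m e := (e.1 <= m < e.2) && (e.2 < n).
Definition passes m e := (e.1 < m < e.2) && (e.2 < n).

Lemma overP m e : over m e -> [/\ e.1 <= m, m < e.2 & e.2 < n].
Proof. by move=> /andP[/andP[]]. Qed.

Lemma passes_over m e : passes m e -> over m e.
Proof. by move=> /andP[/andP[/ltnW em me] en]; rewrite /over em me. Qed.

Lemma over_passes m e : over m e -> m.+1 < e.2 -> passes m.+1 e.
Proof. by move=> /overP[em _ en] me; rewrite /passes ltnS em me. Qed.

Lemma over_end m e : over m e -> e.2 <= m.+1 -> e.2 = m.+1.
Proof. by move=> /overP[_ me _] em; apply/eqP; rewrite eqn_leq em. Qed.

Lemma passes_neq m e f : passes m e -> f.1 = m -> e != f.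
Proof. by move=> /andP[/andP[em _] _] fm; apply: contraTneq em => ->; rewrite fm ltnn. Qed.

Lemma starting_edge m e : passes m e -> over m (m, m.+1).
Proof.
by move=> /andP[/andP[_ me] en]; rewrite /over /= leqnn ltnSn (leq_ltn_trans me en).
Qed.

Definition edges_over m := [seq e <- allpairs pair (iota 0 n) (iota 0 n) | over m e].

Lemma mem_edges_over m e : (e \in edges_over m) = over m e.
Proof.
rewrite mem_filter; case o : (over m e) => //=; case: e o => i j /andP[/= im jn].
by apply/allpairsP; exists (i, j); rewrite !mem_iota /=; split => //; lia.
Qed.

Lemma uniq_edges_over m : uniq (edges_over m).
Proof.
apply: filter_uniq; apply: allpairs_uniq; rewrite ?iota_uniq //.
by move=> [? ?] [? ?].
Qed.

Variable c : nat -> R.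

(* [H m] orders the edges just to the right of vertex [m], and [c m] is the
   place of vertex [m] in that order. *)
Record sweep H : Prop := Sweep {
  sweep_inj : forall m e f, over m e -> over m f -> H m e = H m f -> e = f;
  sweep_lt : forall m e f, passes m e -> over m f -> f.1 = m ->
    (H m f < H m e)%R = (c m < H m e)%R;
  sweep_gt : forall m e f, passes m e -> over m f -> f.1 = m ->
    (H m e < H m f)%R = (H m e < c m)%R }.

(* The order just to the right of vertex [m.+1], in which the edges ending
   there are placed at that vertex. *)
Definition next H m e := if m.+1 < e.2 then H m.+1 e else c m.+1.

Definition sweep_cost H := \sum_(m < n) inversions (edges_over m) (H m) (next H m).

Definition inverted H m e f :=
  [&& over m e, over m f & (H m e < H m f)%R && (next H m f < next H m e)%R].

Definition adjacent e f := (e != f) && ((e.1 == f.1) || (e.2 == f.2)).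

Section Relabel.
Variables (H : nat -> edge -> R) (t : nat -> edge -> edge).
Hypothesis (Hs : sweep H) (tK : forall m, involutive (t m)).
Hypothesis t_over : forall m e, over m (t m e) = over m e.
Hypothesis t_start : forall m e, over m e -> ((t m e).1 == m) = (e.1 == m).

Lemma sweep_relabel : sweep (fun m => H m \o t m).
Proof.
have t_passes m e : passes m e -> passes m (t m e).
  move=> pe; have oe : over m e by move: pe; rewrite /passes /over; lia.
  have := t_over m e; have := t_start oe; rewrite oe.
  by move: pe; rewrite /over /passes; lia.
have t_eq m e : over m e -> e.1 = m -> (t m e).1 = m.
  by move=> oe em; apply/eqP; rewrite t_start // em.
split=> m e f /=.
- move=> oe of_ /(sweep_inj Hs) E; apply: (inv_inj (tK m)); apply: E;
  by rewrite t_over.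
- by move=> pe of_ fm; apply: sweep_lt => //; rewrite ?t_over ?t_passes ?t_eq.
- by move=> pe of_ fm; apply: sweep_gt => //; rewrite ?t_over ?t_passes ?t_eq.
Qed.

End Relabel.

Lemma swap_left_facts e f m : e.1 = f.1 -> over m e -> over m f ->
  forall m', m' <= m -> forall x, over m' (swap e f x) = over m' x /\
     (m'.+1 <= m -> (m'.+1 < (swap e f x : edge).2) = (m'.+1 < x.2)) /\ (swap e f x : edge).1 = x.1.
Proof.
move=> ef; rewrite /over => oe of_ m' mm x; rewrite /swap.
case: eqP => [->|_]; first by rewrite -ef; do !split; move=> *; lia.
by case: eqP => [->|_]; rewrite ?ef; do !split; move=> *; lia.
Qed.

(** The labels e and f are exchanged in all orders up to m, which removes the inversion after vertex
    m. In the earlier strips that contain the edges both orders are relabelled alike, which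
    preserves the number of inversions, and strips before the common left end contain neither
    edge. *)
Lemma uncross_left H m e f : sweep H -> e.1 = f.1 -> inverted H m e f -> m < n ->
  exists2 H', sweep H' & sweep_cost H' < sweep_cost H.
Proof.
move=> Hs ef /and3P[oe of_ /andP[lt gt]] mn.
have sf := swap_left_facts ef oe of_.
pose t m' := if m' <= m then swap e f else id.
exists (fun m' => H m' \o t m').
  apply: sweep_relabel => // m' x.
  - by rewrite /t; case: leqP => // _; rewrite swapK.
  - by rewrite /t; case: leqP => // mm; have [] := sf _ mm x.
  - by rewrite /t; case: leqP => // mm; have [_ [_ ->]] := sf _ mm x.
rewrite /sweep_cost (bigD1 (Ordinal mn)) //= [X in _ < X](bigD1 (Ordinal mn)) //= -addSn.
apply: leq_add.
  rewrite (@eq_inversions _ _ _ _ _ (H m \o swap e f) (next H m)).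
  - by apply: inversions_swap; rewrite ?uniq_edges_over ?mem_edges_over.
  - by move=> x _; rewrite /t /= leqnn.
  - by move=> x _; rewrite /next /= /t ltnn.
apply: leq_sum => m' /eqP/val_eqP /= mm'.
have [lm|lm] := ltnP m m'.
  rewrite (@eq_inversions _ _ _ _ _ (H m') (next H m')) //.
  - by move=> x _; rewrite /t /= leqNgt lm.
  - by move=> x _; rewrite /next /= /t [m' < m]ltnNge (ltnW lm).
have {mm'} lm' : m' < m by rewrite ltn_neqAle mm'.
have [im|im] := leqP e.1 m'.
  rewrite (@eq_inversions _ _ _ _ _ (H m' \o swap e f) (next H m' \o swap e f)).
  - rewrite inversions_swap_both ?uniq_edges_over // mem_edges_over.
      by move: oe; rewrite /over; lia.
    by move: of_; rewrite /over -ef; lia.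
  - by move=> x _; rewrite /t /= lm.
  - by move=> x _; rewrite /next /= /t lm'; have [_ [/(_ lm') -> _]] := sf _ lm x.
have noswap x : over m' x -> swap e f x = x.
  rewrite /swap => ox; case: eqP => [xe|_]; first by move: ox; rewrite xe /over; lia.
  by case: eqP => [xf|_] //; move: ox; rewrite xf /over; lia.
rewrite (@eq_inversions _ _ _ _ _ (H m') (next H m')) // => x; rewrite mem_edges_over => ox.
- by rewrite /t /= lm noswap.
- by rewrite /next /= /t lm' noswap.
Qed.

(** Mirror image of [uncross_left], with the orders after m relabelled. In the strip before the
    common right end, [next] places both edges at the vertex, so the exchange is consistent. *)
Lemma uncross_right H m e f : sweep H -> e.2 = f.2 -> inverted H m e f -> m < n ->
  exists2 H', sweep H' & sweep_cost H' < sweep_cost H.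
Proof.
move=> Hs ef /and3P[oe of_ /andP[lt gt]] mn.
(* Edges that both end at m.+1 are tied there, hence not inverted. *)
have me : m.+1 < e.2.
  by move: gt; rewrite /next -ef; case: ifP => //; rewrite ltxx.
have sf x : (swap e f x : edge).2 = x.2.
  by rewrite /swap; case: eqP => [->|_] //; case: eqP => [->|_].
have so m' x : m < m' -> over m' (swap e f x) = over m' x.
  move=> mm; move: oe of_; rewrite /over sf /swap.
  by case: (x =P e) => [->|_]; [|case: (x =P f) => [->|_] //]; lia.
have ss m' x : m < m' -> over m' x -> ((swap e f x : edge).1 == m') = (x.1 == m').
  move=> mm; move: oe of_; rewrite /over /swap.
  by case: (x =P e) => [->|_]; [|case: (x =P f) => [->|_] //]; lia.
have noswap m' x : e.2 <= m' -> over m' x -> swap e f x = x.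
  move=> le; rewrite /swap => ox; case: eqP => [xe|_]; first by move: ox; rewrite xe /over; lia.
  by case: eqP => [xf|_] //; move: ox; rewrite xf /over -ef; lia.
pose t m' := if m < m' then swap e f else id.
exists (fun m' => H m' \o t m').
  apply: sweep_relabel => // m' x.
  - by rewrite /t; case: ltnP => // _; rewrite swapK.
  - by rewrite /t; case: ltnP => // mm; rewrite so.
  - by rewrite /t; case: ltnP => // mm ox; rewrite ss.
rewrite /sweep_cost (bigD1 (Ordinal mn)) //= [X in _ < X](bigD1 (Ordinal mn)) //= -addSn.
apply: leq_add.
  rewrite (@eq_inversions _ _ _ _ _ (H m) (next H m \o swap e f)).
  - rewrite inversionsC [X in _ < X]inversionsC.
    rewrite (@eq_inversions _ _ _ _ _ (next H m \o swap f e) (H m)) //.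
      by apply: inversions_swap; rewrite ?uniq_edges_over ?mem_edges_over.
    move=> x _ /=; congr (next _ _ _); rewrite /swap.
    by case: eqP => [->|]; case: eqP => [->|].
  - by move=> x _; rewrite /t /= ltnn.
  - by move=> x _; rewrite /next /= /t ltnSn sf.
apply: leq_sum => m' /eqP/val_eqP /= mm'.
have [lm|lm] := leqP m' m.
  have {}lm : m' < m by rewrite ltn_neqAle mm'.
  rewrite (@eq_inversions _ _ _ _ _ (H m') (next H m')) //.
  - by move=> x _; rewrite /t /= ltnNge ltnW.
  - by move=> x _; rewrite /next /= /t [m < m'.+1]ltnNge lm.
have [im|im] := ltnP m' e.2.
  rewrite (@eq_inversions _ _ _ _ _ (H m' \o swap e f) (next H m' \o swap e f)).
  - rewrite inversions_swap_both ?uniq_edges_over // mem_edges_over.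
      by move: oe; rewrite /over; lia.
    by move: of_; rewrite /over -ef; lia.
  - by move=> x _; rewrite /t /= lm.
  - by move=> x _; rewrite /next /= /t [m < m'.+1]ltnS (ltnW lm) sf.
rewrite (@eq_inversions _ _ _ _ _ (H m') (next H m')) // => x; rewrite mem_edges_over => ox.
- by rewrite /t /= lm (noswap m').
- by rewrite /next /= /t [m < m'.+1]ltnS (ltnW lm) (noswap m').
Qed.

Lemma uncross H : sweep H -> exists H', [/\ sweep H', sweep_cost H' <= sweep_cost H &
  forall m e f, m < n -> adjacent e f -> ~~ inverted H' m e f].
Proof.
have [k kE] := ubnP (sweep_cost H); elim: k H kE => // k IH H kE Hs.
have [[m [e [f [mn /andP[_ ef] i]]]]|no] := pselect (exists m e f, [/\ m < n, adjacent e f & inverted H m e f]).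
  have [H' H's lt] : exists2 H', sweep H' & sweep_cost H' < sweep_cost H.
    by case/orP: ef => /eqP ef; [exact: uncross_left i mn|exact: uncross_right i mn].
  have [||H'' [? le ?]] := IH H' => //; first exact: leq_trans lt _.
  by exists H''; split=> //; exact: leq_trans le (ltnW lt).
exists H; split=> // m e f mn ad; apply/negP => i; apply: no; by exists m, e, f.
Qed.

Section Uncrossed.
Variables (H : nat -> edge -> R).
Hypothesis Hs : sweep H.

Definition sweep_signature i j k := (c j < H j (i, k))%R.

Lemma sweep_transport e f m0 m1 : e != f -> m0 <= m1 ->
  over m0 e -> over m0 f -> over m1 e -> over m1 f ->
  (forall m, m0 <= m -> m < m1 -> ~~ inverted H m e f && ~~ inverted H m f e) ->
  (H m0 e < H m0 f)%R = (H m1 e < H m1 f)%R.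
Proof.
move=> ef; elim: m1 => [|m1 IH].
  by rewrite leqn0 => /eqP->.
rewrite leq_eqVlt => /orP[/eqP->|] //; rewrite ltnS => le oe0 of0 oe1 of1 ni.
have oe : over m1 e by move: oe0 oe1; rewrite /over; lia.
have of_ : over m1 f by move: of0 of1; rewrite /over; lia.
rewrite IH // => [|m ? ?]; last by apply: ni => //; exact: ltnW.
have := ni m1 le (ltnSn _); rewrite /inverted oe of_ /next /=.
have -> : m1.+1 < e.2 by move: oe1; rewrite /over; lia.
have -> : m1.+1 < f.2 by move: of1; rewrite /over; lia.
have ne m : over m e -> over m f -> H m e != H m f.
  by move=> ? ?; apply: contraNN ef => /eqP/(sweep_inj Hs) ->.
have := ne _ oe of_; have := ne _ oe1 of1.
by case: (ltgtP (H m1 e)) => //; case: (ltgtP (H m1.+1 e)).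
Qed.

(** The order is carried to the strip before k, at whose right end [next] places f at the vertex. *)
Lemma sweep_end e f m0 k : f.2 = k -> passes k e -> over m0 e -> over m0 f ->
  (forall m, m0 <= m -> m < k -> ~~ inverted H m e f && ~~ inverted H m f e) ->
  (H m0 f < H m0 e)%R = (c k < H k e)%R.
Proof.
case: k => [|k] fk pe oe0 of0 ni; first by move: pe; rewrite /passes.
have fe : f != e by apply: contraTneq pe => <-; rewrite /passes fk; lia.
have oe : over k e by move: oe0 of0 pe; rewrite /over /passes; lia.
have of_ : over k f by move: of0; rewrite /over; lia.
have le : m0 <= k by move: of0; rewrite /over; lia.
rewrite (sweep_transport fe le) // => [|m ? ?]; last by rewrite andbC ni // ltnW.
have := ni k le (ltnSn _); rewrite /inverted oe of_ /next /=.
rewrite fk ltnn; have -> : k.+1 < e.2 by move: pe; rewrite /passes; lia.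
have ne : H k f != H k e by apply: contraNN fe => /eqP/(sweep_inj Hs) ->.
have nc : c k.+1 != H k.+1 e.
  (* The sweep relates c to passing edges only through an edge starting at the vertex; the one with
     the same right end as e is available. *)
  have se : over k.+1 (k.+1, e.2) by move: pe; rewrite /passes /over /=; lia.
  have oe1 : over k.+1 e by move: pe; rewrite /passes /over /=; lia.
  have := sweep_lt Hs pe se erefl; have := sweep_gt Hs pe se erefl.
  have : H k.+1 e != H k.+1 (k.+1, e.2).
    apply: contraTneq pe => /(sweep_inj Hs oe1 se) ->; rewrite /passes /=; lia.
  by case: (ltgtP (H k.+1 e)) => // _; case: (ltgtP (c k.+1)).
by move: ne nc; case: (ltgtP (H k f)) => //; case: (ltgtP (c k.+1)).
Qed.

End Uncrossed.

Lemma signature_uncrossed H : sweep H ->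
  (forall m e f, m < n -> adjacent e f -> ~~ inverted H m e f) ->
  signature (sweep_signature H) n.
Proof.
move=> Hs ni x y z w xy yz zw wn.
have ni2 e f k : adjacent e f -> k < n -> forall m, m < k -> ~~ inverted H m e f && ~~ inverted H m f e.
  move=> ad kn m mk; rewrite !ni // ?(ltn_trans mk kn) //.
  by move: ad; rewrite /adjacent eq_sym (eq_sym e.1) (eq_sym e.2).
(* Never inverted, ab and ad keep their order until ab ends at b; there it tells whether b is below
   ad. *)
have rs a b d : a < b -> b < d -> d < n -> (H a (a, b) < H a (a, d))%R = sweep_signature H a b d.
  move=> ab bd dn; apply: (sweep_end Hs); rewrite /over /passes /=; try lia.
  by move=> m _ mb; apply: (@ni2 _ _ b) => //; rewrite /adjacent /= ?eqxx ?xpair_eqE; lia.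
(* Similarly aw and bw keep their order from b to the last strip before w. *)
have ls a b : a < b -> b < w -> (H w.-1 (b, w) < H w.-1 (a, w))%R = sweep_signature H a b w.
  move=> ab bw; rewrite /sweep_signature -(sweep_lt Hs (f := (b, w))); rewrite /over /passes /=; try lia.
  apply/esym; apply: sweep_transport => //; rewrite /over /= ?xpair_eqE; try lia.
  by move=> m _ mb; apply: (@ni2 _ _ w.-1) => //; rewrite /adjacent /= ?eqxx ?xpair_eqE; lia.
have I m a b : over m a -> over m b -> a != b -> H m a != H m b.
  by move=> ? ? ab; apply: contraNN ab => /eqP/(sweep_inj Hs) ->.
have Ixyz : H x (x, y) != H x (x, z) by apply: I; rewrite /over ?xpair_eqE /=; lia.
have Jyz : H w.-1 (y, w) != H w.-1 (z, w) by apply: I; rewrite /over ?xpair_eqE /=; lia.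
have [yw xw] := (ltn_trans yz zw, ltn_trans xy (ltn_trans yz zw)).
have [xz zn] := (ltn_trans xy yz, ltn_trans zw wn).
have := lt_triple (H x (x, w)) Ixyz; rewrite (rs x y z) // (rs x y w) // (rs x z w) //.
rewrite eq_sym in Jyz; have := lt_triple (H w.-1 (x, w)) Jyz.
rewrite (ls x y) // (ls x z) // (ls y z) //.
by case: (sweep_signature H x y z); case: (sweep_signature H x y w);
  case: (sweep_signature H x z w); case: (sweep_signature H y z w).
Qed.

Lemma sweep_costE H : sweep_cost H =
  sum4 n (fun i k j l => \sum_(m < n) inverted H m (i, k) (j, l)).
Proof.
transitivity (\sum_(m < n) sum4 n (fun i k j l => inverted H m (i, k) (j, l))).
  apply: eq_bigr => m _.
  have S (F : edge -> nat) : \sum_(e <- edges_over m) F e =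
      \sum_(i < n) \sum_(k < n) over m (i : nat, k : nat) * F (i : nat, k : nat).
    rewrite big_filter big_mkcond big_allpairs_dep /= -{1}[n]subn0 big_mkord.
    apply: eq_bigr => i _; rewrite -{1}[n]subn0 big_mkord; apply: eq_bigr => k _.
    by case: over; rewrite ?mul1n.
  rewrite /inversions S; do 2 (apply: eq_bigr => ? _); rewrite S big_distrr /=.
  apply: eq_bigr => ? _; rewrite big_distrr /=; apply: eq_bigr => ? _.
  by rewrite !mulnb.
rewrite /sum4; do 3 (rewrite exchange_big; apply: eq_bigr => ? _ /=).
by rewrite exchange_big.
Qed.

(** Two edges that are never inverted have the same order at both ends of their common range, which
    makes the corresponding term of [cr] zero. *)
Lemma cr_le_inverted H : sweep H ->
  (forall m e f, m < n -> adjacent e f -> ~~ inverted H m e f) ->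
  forall w (x : nat) y z, w < x -> x < y -> y < z -> z < n ->
  cr (sweep_signature H) w x y z <=
  \sum_(m < n) inverted H m (w, y) (x, z) + \sum_(m < n) inverted H m (x, z) (w, y) +
  (\sum_(m < n) inverted H m (w, z) (x, y) + \sum_(m < n) inverted H m (x, y) (w, z)).
Proof.
move=> Hs ni w x y z wx xy yz zn.
have E e f m0 k : f.2 = k -> passes k e -> over m0 e -> over m0 f -> k < n ->
    \sum_(m < n) inverted H m e f + \sum_(m < n) inverted H m f e = 0 ->
    (H m0 f < H m0 e)%R = (c k < H k e)%R.
  move=> fk pe oe of_ kn /eqP; rewrite addn_eq0 !sum_nat_eq0 => /andP[/forallP /= e0 /forallP /= f0].
  apply: sweep_end => // m _ mk; have mn := ltn_trans mk kn.
  by move: (e0 (Ordinal mn)) (f0 (Ordinal mn)) => /=; do 2 case: inverted.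
have ne m e f : over m e -> over m f -> e != f -> H m e != H m f.
  by move=> ? ? ef; apply: contraNN ef => /eqP/(sweep_inj Hs) ->.
rewrite /cr; apply: leq_add.
  rewrite addnC; case: (posnP (\sum_(m < n) inverted H m (x, z) (w, y) + \sum_(m < n) inverted H m (w, y) (x, z))) => [E0|];
    last exact: leq_trans (leq_b1 _).
  have := E (x, z) (w, y) x y erefl; rewrite E0 /sweep_signature => <- //; rewrite /passes /over /=; try lia.
  rewrite -(sweep_lt Hs (f := (x, z))); rewrite /passes /over /=; try lia.
  have : H x (x, z) != H x (w, y) by apply: ne; rewrite /over ?xpair_eqE /=; lia.
  by case: ltgtP.
case: (posnP (\sum_(m < n) inverted H m (w, z) (x, y) + \sum_(m < n) inverted H m (x, y) (w, z))) => [E0|];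
  last exact: leq_trans (leq_b1 _).
have := E (w, z) (x, y) x y erefl; rewrite E0 /sweep_signature => <- //; rewrite /passes /over /=; try lia.
rewrite -(sweep_lt Hs (f := (x, y))); rewrite /passes /over /=; try lia.
Qed.

(** Interleaved and nested pairs of edges, in both orders, are the four terms; an ordered pair of
    edges arises from at most one quadruple and one term. *)
Lemma sum4_crossing_pairs (F : nat -> nat -> nat -> nat -> nat) :
  sum4 n (fun a b c d => ((a < b) && (b < c) && (c < d)) * (F a c b d + F b d a c + (F a d b c + F b c a d))) <=
  sum4 n F.
Proof.
pose o a b c d : nat := (a < b) && (b < c) && (c < d).
have -> : sum4 n (fun a b c d => ((a < b) && (b < c) && (c < d)) * (F a c b d + F b d a c + (F a d b c + F b c a d))) =
   sum4 n (fun a b c d => o a b c d * F a c b d) + sum4 n (fun a b c d => o a b c d * F b d a c) +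
   (sum4 n (fun a b c d => o a b c d * F a d b c) + sum4 n (fun a b c d => o a b c d * F b c a d)).
  by rewrite -!sum4D; apply: eq_sum4 => *; rewrite !mulnDr.
have -> : sum4 n (fun a b c d => o a b c d * F a c b d) =
          sum4 n (fun i k j l => o i j k l * F i k j l) by rewrite sum4_swap23.
have -> : sum4 n (fun a b c d => o a b c d * F b d a c) =
          sum4 n (fun i k j l => o j i l k * F i k j l).
  by rewrite sum4_swap34 sum4_swap12 sum4_swap23.
have -> : sum4 n (fun a b c d => o a b c d * F a d b c) =
          sum4 n (fun i k j l => o i j l k * F i k j l).
  by rewrite sum4_swap34 sum4_swap23.
have -> : sum4 n (fun a b c d => o a b c d * F b c a d) =
          sum4 n (fun i k j l => o j i k l * F i k j l).
  by rewrite sum4_swap12 sum4_swap23.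
rewrite -!sum4D; apply: leq_sum4 => i k j l _ _ _ _.
rewrite -!mulnDl -[X in _ <= X]mul1n leq_mul2r; apply/orP; right.
by rewrite /o; case: (ltngtP i j) => // _; case: (ltngtP k l) => // _;
  rewrite ?andbF ?andbT /= ?addn0 ?add0n ?leq_b1.
Qed.

Lemma sweep_cost_ge H : sweep H -> hill_number n <= sweep_cost H.
Proof.
move=> Hs; have [H' [H's le ni]] := uncross Hs.
apply: leq_trans le; apply: leq_trans (sum_cr_ge (signature_uncrossed H's ni)) _.
rewrite sweep_costE; apply: leq_trans (sum4_crossing_pairs _).
apply: leq_sum4 => a b x d _ _ _ dn.
case: (ltnP a b) => //= ab; case: (ltnP b x) => //= bx; case: (ltnP x d) => //= xd.
by rewrite !mul1n cr_le_inverted.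
Qed.

End Sweep.

Local Open Scope classical_set_scope.
Local Open Scope ring_scope.

(** * Crossings of graphs of functions *)

Section RealFunctions.
Variable R : realType.
Implicit Types (a b x y z : R) (d f : R -> R).

Lemma cvg_fst_snd (T : topologicalType) (F : set_system T) {FF : Filter F} (p : T -> R * R) (l : R * R) :
  p @ F --> l -> (fun t => (p t).1) @ F --> l.1 /\ (fun t => (p t).2) @ F --> l.2.
Proof.
move=> h; split; apply: (cvg_comp _ _ h); first exact: cvg_fst.
exact: cvg_snd.
Qed.

(** The first coordinate u of the arc is continuous and injective, hence has a continuous inverse h
    on the segment from a to b; the function is the second coordinate composed with h. *)
Lemma monotone_arc_graph (g : R -> R * R) a b : a < b ->
  ((g 0).1 = a /\ (g 1).1 = b) \/ ((g 0).1 = b /\ (g 1).1 = a) ->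
  {within `[0, 1], continuous g} -> {in `[0, 1] &, injective g} ->
  x_monotone (g @` `[0, 1]) ->
  exists f : R -> R, [/\ {within `[a, b], continuous f},
    forall p, (g @` `[0, 1]) p <-> a <= p.1 <= b /\ p.2 = f p.1 &
    forall p, (g @` `]0, 1[) p <-> a < p.1 < b /\ p.2 = f p.1].
Proof.
move=> ab ends gc gi gm.
pose u t := (g t).1; pose w t := (g t).2.
have uc : {within `[0, 1], continuous u}.
  by move=> t; have [] := cvg_fst_snd (gc t).
have wc : {within `[0, 1], continuous w}.
  by move=> t; have [] := cvg_fst_snd (gc t).
have ui : {in `[0, 1] &, injective u}.
  by move=> s t sI tI st; apply: (gi _ _ sI tI (gm _ _ (imageP g _) (imageP g _) st)).
pose h x := xget 0 [set t | t \in `[0, 1] /\ u t = x].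
have uK : {in `[0, 1], cancel u h}.
  move=> t tI; rewrite /h; case: xgetP => [s -> [sI st]|/(_ t)/= N]; first exact: ui.
  by exfalso; apply: N.
have range x : (u @` `[0, 1]) x <-> a <= x <= b.
  rewrite (continuous_inj_image_segment ler01 uc ui) /= in_itv /=.
  rewrite /u; case: ends => -[-> ->]; last rewrite minC maxC;
  by rewrite (min_idPl (ltW ab)) (max_idPr (ltW ab)).
have hc : {within `[a, b], continuous h}.
  case: ends => -[<- <-].
    exact: (segment_can_le_continuous ler01 uc uK).
  exact: (segment_can_ge_continuous ler01 uc uK).
have hI x : a <= x <= b -> h x \in `[0, 1].
  by move=> /range[t tI <-]; rewrite uK.
have uhK x : a <= x <= b -> u (h x) = x.
  by move=> /range[t tI <-]; rewrite uK.
have ghE p : a <= p.1 <= b -> p.2 = w (h p.1) -> g (h p.1) = p.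
  case: p => x y /= xI ->; rewrite [LHS]surjective_pairing; congr (_, _).
  exact: uhK.
exists (w \o h); split.
- apply/subspace_continuousP => x xI.
  have wx : w @ within `[0, 1] (nbhs (h x)) --> w (h x).
    move/subspace_continuousP : wc; apply; apply: hI.
    by move: xI; rewrite /= in_itv.
  apply: (cvg_comp _ _ _ wx) => /=.
  have hx : h @ within `[a, b] (nbhs x) --> h x by move/subspace_continuousP : hc; apply.
  move=> P nP.
  have {}nP : nbhs x [set t | t \in `[a, b] -> h t \in `[0, 1] -> P (h t)] := hx _ nP.
  change (nbhs x [set t | t \in `[a, b] -> P (h t)]).
  by apply: filterS nP => t H tI; apply: (H tI); apply: hI; move: tI; rewrite in_itv.
- move=> p; split=> [[t tI <-]|[pI pE]].
    by split; [apply/range; exists t|rewrite /= uK].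
  exists (h p.1); first exact: hI.
  exact: ghE.
- move=> p; split=> [[t tI <-]|[pI pE]].
    have tI' : t \in `[0, 1] by apply: subset_itv_oo_cc.
    split; last by rewrite /= uK.
    have /range : (u @` `[0, 1]) (u t) by exists t.
    have n0 : u t != u 0.
      apply/eqP => /ui; rewrite tI' in_itv /= lexx ler01 => /(_ isT isT) t0.
      by move: tI; rewrite /= in_itv /= t0 ltxx.
    have n1 : u t != u 1.
      apply/eqP => /ui; rewrite tI' in_itv /= lexx ler01 => /(_ isT isT) t0.
      by move: tI; rewrite /= in_itv /= t0 ltxx andbF.
    rewrite -/(u t) !lt_neqAle => /andP[-> ->]; rewrite !andbT.
    by move: n0 n1; rewrite {2 4}/u; case: ends => -[-> ->] n0 n1; rewrite eq_sym ?n0 ?n1 // eq_sym.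
  have pI' : a <= p.1 <= b by case/andP: pI => /ltW -> /ltW ->.
  exists (h p.1).
    have : h p.1 \in `[0, 1] by exact: hI.
    rewrite /= !in_itv /= !lt_neqAle => /andP[-> ->]; rewrite !andbT.
    have n (c : R) : u c != p.1 -> c != h p.1 by apply: contraNN => /eqP ->; rewrite uhK.
    have [u0 u1] : u 0 != p.1 /\ u 1 != p.1.
      by rewrite /u; case: ends => -[-> ->]; case/andP: pI => ? ?; split; apply/eqP; lra.
    by rewrite [h _ == 1]eq_sym !n.
  exact: ghE.
Qed.

Lemma same_sign d a b : a <= b -> {within `[a, b], continuous d} ->
  (forall x, a <= x <= b -> d x != 0) -> (0 < d a) = (0 < d b).
Proof.
move=> ab dc d0; have [da db] : d a != 0 /\ d b != 0 by split; apply: d0; rewrite lexx ab.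
apply/idP/idP => h; rewrite ltNge; apply/negP => h'.
- have [|x] := @IVT _ d a b 0 ab dc; first by rewrite ge_min h' orbT le_max (ltW h).
  by rewrite in_itv /= => /d0/eqP.
- have [|x] := @IVT _ d a b 0 ab dc; first by rewrite ge_min h' le_max (ltW h) orbT.
  by rewrite in_itv /= => /d0/eqP.
Qed.

Lemma lt_between (s : seq R) a z : a < z ->
  exists2 x, a < x < z & forall y, y \in s -> y < z -> y < x.
Proof.
move=> az; elim: s => [|y s [x /andP[ax xz] xs]].
  by exists ((a + z) / 2) => //; lra.
have [yz|zy] := ltP y z; last first.
  exists x; first by rewrite ax.
  by move=> t; rewrite inE => /orP[/eqP->|/xs//] /(le_lt_trans zy); rewrite ltxx.
exists (Num.max x ((y + z) / 2)).
  by rewrite lt_max ax /= gt_max xz /=; lra.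
move=> t; rewrite inE lt_max => /orP[/eqP-> _|/xs xt /xt -> //].
by apply/orP; right; lra.
Qed.

Lemma gt_between (s : seq R) z b : z < b ->
  exists2 x, z < x < b & forall y, y \in s -> z < y -> x < y.
Proof.
move=> zb; have [|x xI xs] := @lt_between [seq - y | y <- s] (- b) (- z); first by lra.
exists (- x); first by lra.
by move=> y ys zy; have := xs (- y) (map_f _ ys); lra.
Qed.

(* If [d] had the same sign on both sides of a zero, it would touch 0 there. *)
Lemma odd_zeros d a b (s : seq R) : a <= b -> {within `[a, b], continuous d} ->
  d a != 0 -> d b != 0 -> uniq s ->
  (forall x, x \in s <-> a < x < b /\ d x = 0) ->
  (forall z u v, z \in s -> a < u -> u < z -> z < v -> v < b ->
     ~ (forall x, u < x < v -> x != z -> 0 < d x) /\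
     ~ (forall x, u < x < v -> x != z -> d x < 0)) ->
  odd (size s) = (0 < d a) (+) (0 < d b).
Proof.
have [k sk] := ubnP (size s); elim: k s a b sk => // k IH s a b sk ab dc da db us sP nt.
have [s0|] := boolP (nilp s).
  rewrite (nilP s0) (same_sign ab dc) ?addbb // => x /andP[ax xb].
  apply: contraT => /negPn/eqP x0; have : x \in s.
    apply/sP; split=> //; rewrite !lt_neqAle ax xb !andbT.
    apply/andP; split; first by apply: contraNneq da => ->; rewrite x0.
    by apply: contraNneq db => <-; rewrite x0.
  by rewrite (nilP s0).
rewrite /nilp -lt0n -has_predT => /hasP[z zs _].
have [/andP[az zb] dz] := (sP z).1 zs.
(* The points x and y isolate z, so that the remaining zeros split into those before x and those
   after y. *)
have [x /andP[ax xz] xs] := lt_between s az.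
have [y /andP[zy yb] ys] := gt_between s zb.
have nz t : x <= t <= y -> t != z -> d t != 0.
  move=> /andP[xt ty] tz; apply/eqP => t0.
  have ts : t \in s by apply/sP; split=> //; lra.
  by case: (ltgtP t z) tz => // [/(xs _ ts)|/(ys _ ts)]; lra.
have wI u v : a <= u -> v <= b -> {within `[u, v], continuous d}.
  move=> au vb; apply: continuous_subspaceW dc => t /=; rewrite !in_itv /=; lra.
have dx : d x != 0 by apply: nz; rewrite ?lexx ?lt_eqF //=; lra.
have dy : d y != 0 by apply: nz; rewrite ?lexx ?gt_eqF //=; lra.
have sE : size s = (size [seq t <- s | t < z]%R + (size [seq t <- s | z < t]%R).+1)%N.
  rewrite (perm_size (perm_to_rem zs)) /= addnS; congr _.+1.
  rewrite -(count_predC (fun t => t < z)) !size_filter; congr (_ + _)%N.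
    by rewrite [RHS](permP (perm_to_rem zs)) /= ltxx.
  rewrite [RHS](permP (perm_to_rem zs)) /= ltxx; apply: eq_in_count => t.
  by rewrite mem_rem_uniq // inE => /andP[tz _] /=; rewrite -leNgt lt_neqAle eq_sym tz.
have [k1 k2] : (size [seq t <- s | (t < z)%R] < k)%N /\ (size [seq t <- s | (z < t)%R] < k)%N.
  move: sk; rewrite sE ltnS => sk; split; apply: leq_trans sk.
    by rewrite addnS ltnS leq_addr.
  exact: leq_addl.
have L : odd (size [seq t <- s | t < z]) = (0 < d a) (+) (0 < d x).
  apply: IH k1 (ltW ax) _ da dx (filter_uniq _ us) _ _; first by apply: wI; lra.
    move=> t; rewrite mem_filter; split=> [/andP[tz ts]|[/andP[at_ tx] t0]].
      by have [/andP[-> _] ->] := (sP t).1 ts; rewrite (xs t).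
    by rewrite (lt_trans tx xz); apply/sP; split=> //; lra.
  by move=> t u v; rewrite mem_filter => /andP[_ ts] ? ? ? ?; apply: nt => //; lra.
have M : odd (size [seq t <- s | z < t]) = (0 < d y) (+) (0 < d b).
  apply: IH k2 (ltW yb) _ dy db (filter_uniq _ us) _ _; first by apply: wI; lra.
    move=> t; rewrite mem_filter; split=> [/andP[tz ts]|[/andP[at_ tx] t0]].
      by have [/andP[_ ->] ->] := (sP t).1 ts; rewrite (ys t).
    by rewrite (lt_trans zy at_); apply/sP; split=> //; lra.
  by move=> t u v; rewrite mem_filter => /andP[_ ts] ? ? ? ?; apply: nt => //; lra.
rewrite sE oddD /= L M.
(* As z itself adds one to the size, the sign has to change between x and y. *)
suff : (0 < d x) != (0 < d y).
  by case: (0 < d x); case: (0 < d y); case: (0 < d a); case: (0 < d b).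
have xl t : x < t -> t < z -> (0 < d x) = (0 < d t).
  by move=> xt tz; apply: same_sign; [lra|apply: wI; lra|move=> r rI; apply: nz; lra].
have yl t : z < t -> t < y -> (0 < d t) = (0 < d y).
  by move=> xt tz; apply: same_sign; [lra|apply: wI; lra|move=> r rI; apply: nz; lra].
apply/negP => /eqP xy; have [np nn] := nt z x y zs ax xz zy yb.
have tl t : x < t < y -> t != z -> (0 < d t) = (0 < d x).
  by move=> /andP[xt ty]; case: (ltgtP t z) => // [tz|zt] _; [rewrite (xl t)|rewrite xy (yl t)].
have [dx0|dx0] := boolP (0 < d x).
  by apply: np => t tI tz; rewrite (tl t).
apply: nn => t /[dup] /andP[xt ty] tI tz; have := tl t tI tz; rewrite (negbTE dx0) => /negbT.
by rewrite -leNgt le_eqVlt (negbTE (nz t _ tz)) // (ltW xt) (ltW ty).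
Qed.

End RealFunctions.

(** * Proper crossings are not one-sided touchings *)

Section Touching.
Variable R : realType.
Implicit Types (f g : R -> R) (A B : set (R * R)).

Lemma continuous_pair (T S1 S2 : topologicalType) (f : T -> S1) (g : T -> S2) x :
  {for x, continuous f} -> {for x, continuous g} ->
  {for x, continuous (fun t => (f t, g t))}.
Proof. by move=> fc gc; exact: (cvg_pair fc gc). Qed.

Lemma same_sign_itv (k : R -> R) u v :
  (forall x, Num.min u v <= x <= Num.max u v -> {for x, continuous k} /\ k x != 0) ->
  (0 < k u) = (0 < k v).
Proof.
wlog uv : u v / u <= v.
  move=> H h; have [uv|/ltW vu] := leP u v; first exact: H.
  by apply/esym; apply: H => // x; rewrite minC maxC; exact: h.
rewrite (min_idPl uv) (max_idPr uv) => h; apply: same_sign => // [|x /h[]//].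
by apply: continuous_in_subspaceT => x; rewrite inE /= in_itv => /h[].
Qed.

(* The region below the graph is connected near a point of the graph: two of
   its points are joined by two vertical segments and a horizontal one. *)
Lemma same_sign_below f x0 (k : R * R -> R) : {for x0, continuous f} ->
  (\forall q \near (x0, f x0), {for q, continuous k} /\ (q.2 < f q.1 -> k q != 0)) ->
  exists2 V, nbhs (x0, f x0) V &
    forall q1 q2, V q1 -> V q2 -> q1.2 < f q1.1 -> q2.2 < f q2.1 -> (0 < k q1) = (0 < k q2).
Proof.
move=> fc /nbhs_ballP[e /= e0 eU].
have {}fc : \forall x \near x0, `|f x0 - f x| < e / 2.
  by move/cvgrPdist_lt : fc; apply; lra.
have /nbhs_ballP[d0 /= d00 dU] := fc.
pose d := Num.min e d0.
have dgt0 : 0 < d by rewrite lt_min e0.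
have [de dd0] : d <= e /\ d <= d0 by rewrite !ge_min !lexx orbT.
exists (ball (x0, f x0) d); first exact: nbhsx_ballx.
have kP x y : `|x0 - x| < d -> `|f x0 - y| < e ->
    {for (x, y), continuous k} /\ (y < f x -> k (x, y) != 0).
  by move=> xd ye; apply: (eU (x, y)); split => //=; exact: lt_le_trans xd de.
have fP x : `|x0 - x| < d -> f x0 - e / 2 < f x.
  move=> xd; have /= := dU x (lt_le_trans xd dd0).
  by rewrite ltr_norml => /andP[]; lra.
have vert x y : `|x0 - x| < d -> `|f x0 - y| < e -> y < f x ->
    (0 < k (x, y)) = (0 < k (x, f x0 - e / 2)).
  move=> xd ye yf; have bf := fP x xd.
  apply: (@same_sign_itv (fun y => k (x, y))) => t.
  rewrite ge_min le_max => tI.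
  have te : `|f x0 - t| < e.
    move: ye tI; rewrite !ltr_norml => /andP[y1 y2] /andP[/orP[] t1 /orP[] t2]; lra.
  have tf : t < f x by move: tI => /andP[_ /orP[]]; lra.
  have [kc k0] := kP x t xd te; split; last exact: k0.
  apply: (@continuous_comp _ _ _ (fun y => (x, y)) k) => //.
  by apply: continuous_pair; [exact: cvg_cst|exact: cvg_id].
move=> [x1 y1] [x2 y2] [/= x1d y1d] [/= x2d y2d] yf1 yf2.
rewrite (vert x1 y1) //; last exact: lt_le_trans y1d de.
rewrite (vert x2 y2) //; last exact: lt_le_trans y2d de.
apply: (@same_sign_itv (fun x => k (x, f x0 - e / 2))) => t.
rewrite ge_min le_max => tI.
have td : `|x0 - t| < d.
  move: x1d x2d tI; rewrite /ball /= !ltr_norml => /andP[? ?] /andP[? ?] /andP[/orP[] t1 /orP[] t2]; lra.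
have be : `|f x0 - (f x0 - e / 2)| < e.
  have -> : f x0 - (f x0 - e / 2) = e / 2 by lra.
  by rewrite ger0_norm; lra.
have [kc k0] := kP t _ td be; split; last by apply: k0; exact: fP.
apply: (@continuous_comp _ _ _ (fun x => (x, f x0 - e / 2)) k) => //.
by apply: continuous_pair; [exact: cvg_id|exact: cvg_cst].
Qed.

Lemma properly_crossC A B p : properly_cross A B p -> properly_cross B A p.
Proof.
pose sw (q : R * R) := (q.2, q.1).
have swc : continuous sw.
  by move=> q; apply: continuous_pair; [exact: cvg_snd|exact: cvg_fst].
move=> [U [h [g [[Uo Up hp] [[hc ho gh gc] AB]]]]].
exists U, (sw \o h), (g \o sw); split; [split=> //=|split; [split|]].
- by rewrite hp.
- by move=> q Uq; apply: continuous_comp; [exact: hc|exact: swc].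
- have -> : (sw \o h) @` U = sw @^-1` (h @` U).
    rewrite eqEsubset; split=> [_ [q Uq <-]|q [r Ur rE]].
      by exists q => //=; rewrite /sw /= -surjective_pairing.
    by exists r => //=; rewrite rE /sw /= -surjective_pairing.
  by apply: open_comp => // q _; exact: swc.
- by move=> q Uq /=; rewrite /sw /= -surjective_pairing gh.
- move=> _ [q Uq <-]; apply: continuous_comp; first exact: swc.
  by apply: gc; exists q => //=; rewrite /sw /= -surjective_pairing.
- by move=> q Uq; have [Aq Bq] := AB q Uq; split.
Qed.

(** In the chart, points of the vertical axis near the origin come from B, and would all but the
    origin lie strictly below A. The second coordinate of the chart vanishes only on A, so it has
    constant sign below A near the point; yet it takes both signs on the axis. *)
Lemma properly_cross_not_below A B f g x0 u v : {for x0, continuous f} ->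
  (forall q, A q -> q.2 = f q.1) -> (forall q, B q -> q.2 = g q.1) ->
  u < x0 < v -> g x0 = f x0 -> properly_cross A B (x0, f x0) ->
  ~ (forall x, u < x < v -> x != x0 -> g x < f x).
Proof.
move=> fc Af Bg /andP[ux xv] gf [U [h [g' [[Uo Up hp] [[hc ho gh gc] AB]]]]] below.
have Un : nbhs (x0, f x0) U by exact: open_nbhs_nbhs.
have [|V Vn Vs] := @same_sign_below f x0 (fun q => (h q).2) fc.
  apply: filterS Un => q Uq; split.
    by apply: (continuous_comp (hc q Uq)); exact: cvg_snd.
  by move=> qf; apply/eqP => /(AB q Uq).1/Af qE; move: qf; rewrite qE ltxx.
have gn : nbhs (0, 0) [set z | [/\ (h @` U) z, V (g' z) & u < (g' z).1 < v]].
  have h0 : (h @` U) (0, 0) by exists (x0, f x0).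
  have g0 : g' (0, 0) = (x0, f x0) by rewrite -hp gh.
  have gc0 : g' z @[z --> (0, 0)] --> g' (0, 0) := gc _ h0; rewrite g0 in gc0.
  have n1 : nbhs (0, 0) (h @` U) by exact: open_nbhs_nbhs.
  have n2 : nbhs (0, 0) (g' @^-1` V) := gc0 _ Vn.
  have n3 : nbhs (x0, f x0) [set q : R * R | u < q.1 < v].
    apply: (@cvg_fst _ _ (nbhs x0) (nbhs (f x0)) _ [set x | u < x < v]).
    have : x0 \in `]u, v[ by rewrite in_itv /= ux.
    by move/near_in_itvoo; apply: filterS => x; rewrite in_itv.
  have n4 : nbhs (0, 0) (g' @^-1` [set q : R * R | u < q.1 < v]) := gc0 _ n3.
  by apply: filterS (filterI n1 (filterI n2 n4)) => z [? [? ?]]; split.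
have /nbhs_ballP[r /= r0 rP] := gn.
have key s : `|s| < r -> s != 0 -> exists q, [/\ V q, q.2 < f q.1 & (h q).2 = s].
  move=> sr s0; have [|[q Uq qE] Vq qI] := rP (0, s).
    by split; rewrite /ball /= ?subrr ?normr0 // sub0r normrN.
  have gE : g' (0, s) = q by rewrite -qE gh.
  rewrite gE in Vq qI; exists q; split => //; last by rewrite qE.
  have Bq : B q by apply/(AB q Uq).2; rewrite qE.
  rewrite (Bg q Bq); apply: below => //.
  apply/eqP => q1; have : q = (x0, f x0).
    by rewrite [q]surjective_pairing (Bg q Bq) q1 gf.
  by move=> qp; move: qE; rewrite qp hp => -[] /esym/eqP; rewrite (negbTE s0).
have [||q1 [V1 b1 e1]] := key (r / 2); [by rewrite ger0_norm; lra|by rewrite gt_eqF; lra|].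
have [||q2 [V2 b2 e2]] := key (- (r / 2)); [by rewrite normrN ger0_norm; lra|by rewrite lt_eqF; lra|].
have := Vs q1 q2 V1 V2 b1 b2; rewrite e1 e2.
have -> : 0 < r / 2 by lra.
by move/esym; lra.
Qed.

End Touching.

(** * Lower bounds for monotone drawings *)

Section Charts.
Variables (R : realType) (n : nat) (D : predrawing R (complete_graph n)).
Notation edge := (nat * nat)%type.
Implicit Types (e f : edge).

Definition edge_of (v : nat -> 'I_n) e : {set complete_graph n} := [set v e.1; v e.2]%SET.

Definition proper_pair e := (e.1 < e.2 < n)%N.

Lemma ordered_vertices (X : 'I_n -> R) : injective X -> (0 < n)%N ->
  exists v : nat -> 'I_n, forall i j, (i < j)%N -> (j < n)%N -> X (v i) < X (v j).
Proof.
move=> Xi n0; pose r (a b : 'I_n) := X a <= X b.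
pose s := sort r (enum 'I_n); exists (nth (Ordinal n0) s) => i j ij jn.
have ss : size s = n by rewrite size_sort size_enum_ord.
have tr : transitive r by move=> a b c; exact: le_trans.
have so : sorted r s by apply: sort_sorted => a b; exact: le_total.
have us : uniq s by rewrite sort_uniq enum_uniq.
have := sorted_leq_nth tr (fun a => lexx _) (Ordinal n0) so i j.
rewrite !inE ss (ltn_trans ij jn) jn => /(_ isT isT (ltnW ij)).
rewrite /r le_eqVlt => /orP[/eqP/Xi/eqP|//].
by rewrite nth_uniq ?ss // ?(ltn_trans ij jn) // (ltn_eqF ij).
Qed.

(* Vertices are numbered from left to right, and the edge joining vertices
   [e.1] and [e.2] is the graph of [F e]. *)
Record charts (v : nat -> 'I_n) (F : edge -> R -> R) : Prop := Charts {
  charts_lt : forall i j, (i < j)%N -> (j < n)%N ->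
    (vertex_pos D (v i)).1 < (vertex_pos D (v j)).1;
  charts_continuous : forall e, proper_pair e ->
    {within `[(vertex_pos D (v e.1)).1, (vertex_pos D (v e.2)).1], continuous (F e)};
  charts_curve : forall e, proper_pair e -> forall p, curve D (edge_of v e) p <->
    (vertex_pos D (v e.1)).1 <= p.1 <= (vertex_pos D (v e.2)).1 /\ p.2 = F e p.1;
  charts_interior : forall e, proper_pair e -> forall p, curve_interior D (edge_of v e) p <->
    (vertex_pos D (v e.1)).1 < p.1 < (vertex_pos D (v e.2)).1 /\ p.2 = F e p.1 }.

Lemma edge_of_in (v : nat -> 'I_n) e : v e.1 != v e.2 -> edge_of v e \in edges (complete_graph n).
Proof. by move=> ve; rewrite inE cards2 ve. Qed.

Lemma exists_charts : is_monotone_drawing D -> (0 < n)%N -> exists v F, charts v F.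
Proof.
move=> M n0; have dr := monotone_is_drawing M.
have [v vlt] := ordered_vertices (monotone_pos M) n0.
exists v; suff /choice[F FP] : forall e, exists f : R -> R, proper_pair e ->
  [/\ {within `[(vertex_pos D (v e.1)).1, (vertex_pos D (v e.2)).1], continuous f},
   forall p, curve D (edge_of v e) p <->
    (vertex_pos D (v e.1)).1 <= p.1 <= (vertex_pos D (v e.2)).1 /\ p.2 = f p.1 &
   forall p, curve_interior D (edge_of v e) p <->
    (vertex_pos D (v e.1)).1 < p.1 < (vertex_pos D (v e.2)).1 /\ p.2 = f p.1].
  by exists F; split=> // e pe; have [] := FP e pe.
move=> e; have [pe|npe] := pselect (proper_pair e); last by exists id.
have lt : (vertex_pos D (v e.1)).1 < (vertex_pos D (v e.2)).1.
  by apply: vlt; case/andP: pe.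
have ein : edge_of v e \in edges (complete_graph n).
  by apply: edge_of_in; apply: contraTneq lt => ->; rewrite ltxx.
have [//|f fP] := monotone_arc_graph lt _ (arc_continuous dr ein) (arc_simple dr ein) (monotone_curve M ein).
  have E := arc_ends dr ein.
  have e1 : [set edge_arc D (edge_of v e) 0; edge_arc D (edge_of v e) 1] (vertex_pos D (v e.1)).
    by rewrite E; exists (v e.1) => //=; rewrite !inE eqxx.
  have e2 : [set edge_arc D (edge_of v e) 0; edge_arc D (edge_of v e) 1] (vertex_pos D (v e.2)).
    by rewrite E; exists (v e.2) => //=; rewrite !inE eqxx orbT.
  case: e1 e2 lt => -> [] ->; rewrite ?ltxx // => _; [by left|by right].
by exists f.
Qed.

Section FromCharts.
Variables (v : nat -> 'I_n) (F : edge -> R -> R).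
Hypotheses (M : is_monotone_drawing D) (C : charts v F).

Notation X i := (vertex_pos D (v i)).1.
Notation Y i := (vertex_pos D (v i)).2.
Notation E := (edge_of v).

Let dr := monotone_is_drawing M.

Lemma charts_ltn i j : (i < n)%N -> (j < n)%N -> (X i < X j) = (i < j)%N.
Proof.
move=> in_ jn; case: (ltngtP i j) => [ij|ji|->]; last by rewrite ltxx.
- by rewrite (charts_lt C).
- by rewrite lt_gtF // (charts_lt C).
Qed.

Lemma charts_leq i j : (i <= j)%N -> (j < n)%N -> X i <= X j.
Proof. by rewrite leq_eqVlt => /orP[/eqP->//|ij jn]; apply/ltW/(charts_lt C). Qed.

Lemma vertex_inj i j : (i < n)%N -> (j < n)%N -> v i = v j -> i = j.
Proof.
move=> in_ jn vij; have := charts_ltn in_ jn; have := charts_ltn jn in_.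
by rewrite vij ltxx; lia.
Qed.

Lemma proper_edge_in e : proper_pair e -> E e \in edges (complete_graph n).
Proof.
move=> /andP[e12 e2n]; apply: edge_of_in; apply/eqP => /(vertex_inj (ltn_trans e12 e2n) e2n).
by lia.
Qed.

Lemma edge_of_inj e f : proper_pair e -> proper_pair f -> E e = E f -> e = f.
Proof.
move=> /andP[e12 e2n] /andP[f12 f2n] EE.
have e1n := ltn_trans e12 e2n; have f1n := ltn_trans f12 f2n.
have [e1 e2] : (e.1 = f.1 \/ e.1 = f.2) /\ (e.2 = f.1 \/ e.2 = f.2).
  have : v e.1 \in E f /\ v e.2 \in E f by rewrite -EE !inE !eqxx orbT.
  rewrite !inE => -[/orP[] /eqP h1 /orP[] /eqP h2]; split;
  do [by left; exact: vertex_inj h1|by right; exact: vertex_inj h1|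
      by left; exact: vertex_inj h2|by right; exact: vertex_inj h2].
rewrite [e]surjective_pairing [f]surjective_pairing; congr (_, _); lia.
Qed.

Lemma charts_start e : proper_pair e -> F e (X e.1) = Y e.1.
Proof.
move=> pe; have : curve D (E e) (vertex_pos D (v e.1)).
  have : (vertex_pos D @` [set` E e]) (vertex_pos D (v e.1)).
    by exists (v e.1) => //=; rewrite !inE eqxx.
  rewrite -(arc_ends dr (proper_edge_in pe)) => -[] ->.
    by exists 0 => //=; rewrite in_itv /= lexx ler01.
  by exists 1 => //=; rewrite in_itv /= lexx ler01.
by move/(charts_curve C pe) => -[_ ->].
Qed.

Lemma charts_end e : proper_pair e -> F e (X e.2) = Y e.2.
Proof.
move=> pe; have : curve D (E e) (vertex_pos D (v e.2)).
  have : (vertex_pos D @` [set` E e]) (vertex_pos D (v e.2)).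
    by exists (v e.2) => //=; rewrite !inE eqxx orbT.
  rewrite -(arc_ends dr (proper_edge_in pe)) => -[] ->.
    by exists 0 => //=; rewrite in_itv /= lexx ler01.
  by exists 1 => //=; rewrite in_itv /= lexx ler01.
by move/(charts_curve C pe) => -[_ ->].
Qed.

Lemma charts_vertex e k : proper_pair e -> (e.1 < k < e.2)%N -> F e (X k) != Y k.
Proof.
move=> pe /andP[ek ke]; have /andP[e12 e2n] := pe; have kn := ltn_trans ke e2n.
apply/eqP => FE; have : v k \in E e.
  apply: (curve_vertex dr (proper_edge_in pe)); apply/(charts_curve C pe).
  by rewrite FE !charts_leq // ltnW.
rewrite !inE => /orP[] /eqP /vertex_inj h.
  by have := h kn (ltn_trans e12 e2n); lia.
by have := h kn e2n; lia.
Qed.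

(** A single list for all pairs of edges allows abscissae close to a vertex to be chosen so that no
    two edges meet between. *)
Lemma finite_meetings : exists s : seq R, forall e f x,
  proper_pair e -> proper_pair f -> e != f ->
  X e.1 <= x <= X e.2 -> X f.1 <= x <= X f.2 -> F e x = F f x -> x \in s.
Proof.
pose I := [set ef : {set complete_graph n} * {set complete_graph n} |
  [/\ ef.1 \in edges (complete_graph n), ef.2 \in edges (complete_graph n) & ef.1 != ef.2]].
have [|s sE] := (finite_seqP (\bigcup_(ef in I) fst @` (curve D ef.1 `&` curve D ef.2))).1.
  apply: bigcup_finite; first exact: finite_finset.
  by move=> ef [e1 e2 ef12]; apply: finite_image; exact: (curve_finite dr).
exists s => e f x pe pf ef xe xf FE.
have : (\bigcup_(ef in I) fst @` (curve D ef.1 `&` curve D ef.2)) x.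
  exists (E e, E f).
    split; [exact: proper_edge_in|exact: proper_edge_in|].
    by apply: contraNN ef => /eqP/(edge_of_inj pe pf) ->.
  exists (x, F e x) => //; split; first by apply/(charts_curve C pe).
  by apply/(charts_curve C pf); rewrite /= FE.
by rewrite sE.
Qed.

Lemma charts_continuousB e f a b : proper_pair e -> proper_pair f ->
  X e.1 <= a -> X f.1 <= a -> b <= X e.2 -> b <= X f.2 ->
  {within `[a, b], continuous (fun x => F e x - F f x)}.
Proof.
move=> pe pf ea fa be bf.
have ec : {within `[a, b], continuous (F e)}.
  by apply: continuous_subspaceW (charts_continuous C pe) => x /=; rewrite !in_itv /=; lra.
have fc : {within `[a, b], continuous (F f)}.
  by apply: continuous_subspaceW (charts_continuous C pf) => x /=; rewrite !in_itv /=; lra.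
by move=> x; apply: cvgB; [exact: ec|exact: fc].
Qed.

Lemma charts_same_order e f a b : proper_pair e -> proper_pair f ->
  X e.1 <= a -> X f.1 <= a -> b <= X e.2 -> b <= X f.2 -> a <= b ->
  (forall x, a <= x <= b -> F e x != F f x) -> (F f a < F e a) = (F f b < F e b).
Proof.
move=> pe pf ea fa be bf ab ne.
rewrite -[LHS]subr_gt0 -[RHS]subr_gt0.
apply: (@same_sign _ (fun x => F e x - F f x) a b ab); first exact: charts_continuousB.
by move=> x /ne; rewrite subr_eq0.
Qed.

Lemma meeting_crossing e f x : proper_pair e -> proper_pair f -> e != f ->
  X e.1 < x < X e.2 -> X f.1 < x < X f.2 -> F e x = F f x ->
  crossings D (E e) (E f) (x, F e x).
Proof.
move=> pe pf ef xe xf FE; apply: (no_touching dr); try exact: proper_edge_in.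
  by apply: contraNN ef => /eqP/(edge_of_inj pe pf) ->.
split; first by apply/(charts_interior C pe).
by apply/(charts_interior C pf); rewrite /= FE.
Qed.

Lemma crossing_between e f a b : proper_pair e -> proper_pair f -> e != f ->
  X e.1 <= a -> X f.1 <= a -> b <= X e.2 -> b <= X f.2 -> a <= b ->
  F e a < F f a -> F f b < F e b ->
  exists2 x, a < x < b & crossings D (E e) (E f) (x, F e x).
Proof.
move=> pe pf ef ea fa be bf ab lta ltb.
have [|x] := @IVT _ _ a b 0 ab (charts_continuousB pe pf ea fa be bf).
  by rewrite ge_min le_max !subr_ge0 !subr_le0 (ltW lta) (ltW ltb) orbT.
rewrite in_itv /= => /andP[ax xb] /eqP; rewrite subr_eq0 => /eqP FE.
have ax' : a < x by rewrite lt_neqAle ax andbT; apply: contraTneq lta => ->; rewrite FE ltxx.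
have xb' : x < b by rewrite lt_neqAle xb andbT; apply: contraTneq ltb => <-; rewrite FE ltxx.
by exists x; [rewrite ax'|apply: meeting_crossing => //; lra].
Qed.

Lemma finite_crossings e f : proper_pair e -> proper_pair f -> e != f ->
  finite_set (crossings D (E e) (E f)).
Proof.
move=> pe pf ef; have ne : E e != E f.
  by apply: contraNN ef => /eqP/(edge_of_inj pe pf) ->.
apply: sub_finite_set (curve_finite dr (proper_edge_in pe) (proper_edge_in pf) ne).
move=> p [[t /subset_itv_oo_cc tI <-] [u /subset_itv_oo_cc uI uE] _].
by split; [exists t|exists u].
Qed.

(** The abscissae of the crossings are the zeros of F e - F f. The interval need not be the whole
    common range: adjacent edges agree at their common vertex and must be compared beside it. *)
Lemma odd_pair_crossing e f a b : proper_pair e -> proper_pair f -> e != f ->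
  X e.1 <= a -> X f.1 <= a -> b <= X e.2 -> b <= X f.2 -> a <= b ->
  F e a != F f a -> F e b != F f b ->
  (forall x, X e.1 < x < X e.2 -> X f.1 < x < X f.2 -> F e x = F f x -> a < x < b) ->
  odd (pair_crossing_count D (E e) (E f)) = (F f a < F e a) (+) (F f b < F e b).
Proof.
move=> pe pf ef ea fa be bf ab na nb outside.
have fin := finite_crossings pe pf ef.
pose s := [seq p.1 | p <- fset_set (crossings D (E e) (E f))].
have crE p : crossings D (E e) (E f) p -> [/\ X e.1 < p.1 < X e.2, X f.1 < p.1 < X f.2,
    p.2 = F e p.1 & p.2 = F f p.1].
  by move=> [/(charts_interior C pe)[? ?] /(charts_interior C pf)[? ?] _].
have mem p : p \in fset_set (crossings D (E e) (E f)) -> crossings D (E e) (E f) p.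
  by rewrite in_fset_set // inE.
have <- : size s = pair_crossing_count D (E e) (E f) by rewrite size_map.
have inP x : x \in s -> crossings D (E e) (E f) (x, F e x).
  move=> /mapP[p /mem cp ->]; have [_ _ pE _] := crE p cp.
  by rewrite -pE -surjective_pairing.
have sP x : x \in s <-> a < x < b /\ F e x - F f x = 0.
  split=> [/inP cx|[/andP[ax xb] /eqP]].
    have [/= xe xf _ FE] := crE _ cx; rewrite FE subrr; split=> //.
    by apply: outside.
  rewrite subr_eq0 => /eqP FE; apply/mapP; exists (x, F e x) => //.
  by rewrite in_fset_set // inE; apply: meeting_crossing => //; lra.
rewrite -(subr_gt0 (F f a)) -(subr_gt0 (F f b)).
apply: (@odd_zeros _ (fun x => F e x - F f x) a b s ab); rewrite ?subr_eq0 //.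
- exact: charts_continuousB.
- rewrite map_inj_in_uniq ?fset_uniq // => p q /mem cp /mem cq pq.
  have [_ _ pE _] := crE p cp; have [_ _ qE _] := crE q cq.
  by rewrite [p]surjective_pairing [q]surjective_pairing pE qE pq.
- move=> z u w zs au uz zw wb.
  have cz := inP z zs; have [/= ze zf _ FE] := crE _ cz; have [_ _ pc] := cz.
  have contAt g : proper_pair g -> X g.1 < z < X g.2 -> {for z, continuous (F g)}.
    move=> pg /andP[gz zg]; apply: (within_continuous_continuous (lt_trans gz zg) (charts_continuous C pg)).
    by rewrite in_itv /= gz.
  have graph g : proper_pair g -> forall p, curve D (E g) p -> p.2 = F g p.1.
    by move=> pg p /(charts_curve C pg)[].
  split=> h.
    apply: (properly_cross_not_below (u := u) (v := w) (contAt e pe ze) (graph e pe) (graph f pf)) => //.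
      by rewrite uz.
    by move=> x xI xz; rewrite -subr_gt0; exact: h.
  have pc' := properly_crossC pc; rewrite FE in pc'.
  apply: (properly_cross_not_below (u := u) (v := w) (contAt f pf zf) (graph f pf) (graph e pe)) => //.
    by rewrite uz.
  by move=> x xI xz; rewrite -subr_lt0; exact: h.
Qed.

End FromCharts.
End Charts.

(** * Parities of crossings read from the positions of the vertices *)

Section LowerBounds.
Variables (R : realType) (n : nat) (D : predrawing R (complete_graph n)).
Notation edge := (nat * nat)%type.
Implicit Types (e f : edge).

Variables (v : nat -> 'I_n) (F : edge -> R -> R).
Hypotheses (M : is_monotone_drawing D) (C : charts D v F).

Notation X i := (vertex_pos D (v i)).1.
Notation Y i := (vertex_pos D (v i)).2.
Notation E := (edge_of v).

Definition chart_signature i j k := Y j < F (i, k) (X j).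

Lemma right_generic m : (m < n)%N -> exists t, [/\ X m < t, (m.+1 < n)%N -> t < X m.+1 &
  forall e f x, proper_pair n e -> proper_pair n f -> e != f -> X m < x <= t ->
  X e.1 <= x <= X e.2 -> X f.1 <= x <= X f.2 -> F e x != F f x].
Proof.
move=> mn; have [s sP] := finite_meetings M C.
pose b := if (m.+1 < n)%N then X m.+1 else X m + 1.
have mb : X m < b by rewrite /b; case: ifP => [|_]; [exact: (charts_lt C)|rewrite ltrDl].
have [t /andP[mt tb] ts] := gt_between s mb.
exists t; split=> //; first by move=> m1; move: tb; rewrite /b m1.
move=> e f x pe pf ef /andP[mx xt] xe xf; apply/eqP => /(sP _ _ _ pe pf ef xe xf) /ts.
by move=> /(_ mx); rewrite ltNge xt.
Qed.

Lemma left_generic m : (m < n)%N -> exists t, [/\ t < X m, (0 < m)%N -> X m.-1 < t &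
  forall e f x, proper_pair n e -> proper_pair n f -> e != f -> t <= x < X m ->
  X e.1 <= x <= X e.2 -> X f.1 <= x <= X f.2 -> F e x != F f x].
Proof.
move=> mn; have [s sP] := finite_meetings M C.
pose b := if (0 < m)%N then X m.-1 else X m - 1.
have mb : b < X m by rewrite /b; case: ifP => [m0|_]; [apply: (charts_lt C); lia|rewrite ltrBlDr ltrDl].
have [t /andP[mt tb] ts] := lt_between s mb.
exists t; split=> //; first by move=> m1; move: mt; rewrite /b m1.
move=> e f x pe pf ef /andP[mx xt] xe xf; apply/eqP => /(sP _ _ _ pe pf ef xe xf) /ts.
by move=> /(_ xt); rewrite ltNge mx.
Qed.

Lemma adjacent_edge_of e f u : proper_pair n e -> proper_pair n f -> e != f ->
  u \in E e -> u \in E f -> adjacent_edges (E e) (E f).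
Proof.
move=> pe pf ef ue uf; apply/andP; split.
  by apply: contraNN ef => /eqP/(edge_of_inj C pe pf) ->.
by apply/pred0Pn; exists u; rewrite /= ue.
Qed.

Lemma same_order_of_even e f a b : proper_pair n e -> proper_pair n f -> e != f ->
  X e.1 <= a -> X f.1 <= a -> b <= X e.2 -> b <= X f.2 -> a <= b ->
  F e a != F f a -> F e b != F f b ->
  (forall x, X e.1 < x < X e.2 -> X f.1 < x < X f.2 -> F e x = F f x -> a < x < b) ->
  ~~ odd (pair_crossing_count D (E e) (E f)) -> (F f a < F e a) = (F f b < F e b).
Proof.
move=> pe pf ef ea fa be bf ab na nb out.
rewrite (odd_pair_crossing M C pe pf ef ea fa be bf ab na nb out).
by case: (F f a < F e a); case: (F f b < F e b).
Qed.

Section Weak.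
Hypothesis weak : weakly_semisimple D.

(** Apart from their common vertex, ab and ac meet only between t and b, and evenly often, so their
    order at t is the one at b, where ab ends. *)
Lemma weak_left_order a b c t : (a < b)%N -> (b < c)%N -> (c < n)%N ->
  X a < t -> t < X b -> (forall e f x, proper_pair n e -> proper_pair n f -> e != f -> X a < x <= t ->
  X e.1 <= x <= X e.2 -> X f.1 <= x <= X f.2 -> F e x != F f x) ->
  (F (a, b) t < F (a, c) t) = chart_signature a b c.
Proof.
move=> ab bc cn at_ tb gen.
have pe : proper_pair n (a, c) by rewrite /proper_pair /=; lia.
have pf : proper_pair n (a, b) by rewrite /proper_pair /=; lia.
have ef : (a, c) != (a, b) by rewrite xpair_eqE eqxx /=; lia.
have Xbc : X b < X c by exact: (charts_lt C).
have fe : F (a, b) (X b) = Y b := charts_end M C pf.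
rewrite /chart_signature -fe; apply: (same_order_of_even pe pf ef) => //=; rewrite ?(ltW at_) ?(ltW Xbc) ?(ltW tb) //.
- by apply: gen => //; rewrite /= ?at_ ?lexx ?(ltW at_) ?(ltW tb) ?(ltW (lt_trans tb Xbc)).
- by rewrite fe; apply: (charts_vertex M C pe) => /=; rewrite ab.
- move=> x xe /andP[ax xb] /eqP FE; rewrite xb andbT ltNge; apply: contraTN FE => xt.
  by apply: gen => //; rewrite /= ?ax ?xt //= ?(ltW ax) ?(ltW xb) // ltW // (lt_trans xb).
- apply: weak; try exact: (proper_edge_in C).
  by apply: (@adjacent_edge_of _ _ (v a)) => //; rewrite !inE eqxx.
Qed.

Lemma weak_right_order a b c t : (a < b)%N -> (b < c)%N -> (c < n)%N ->
  X b < t -> t < X c -> (forall e f x, proper_pair n e -> proper_pair n f -> e != f -> t <= x < X c ->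
  X e.1 <= x <= X e.2 -> X f.1 <= x <= X f.2 -> F e x != F f x) ->
  (F (b, c) t < F (a, c) t) = chart_signature a b c.
Proof.
move=> ab bc cn bt tc gen.
have pe : proper_pair n (a, c) by rewrite /proper_pair /=; lia.
have pf : proper_pair n (b, c) by rewrite /proper_pair /=; lia.
have ef : (a, c) != (b, c) by rewrite xpair_eqE eqxx andbT /=; lia.
have Xab : X a < X b by apply: (charts_lt C) => //; lia.
have fe : F (b, c) (X b) = Y b := charts_start M C pf.
rewrite /chart_signature -fe; apply/esym.
apply: (same_order_of_even pe pf ef) => //=; rewrite ?(ltW bt) ?(ltW Xab) ?(ltW tc) //.
- by rewrite fe; apply: (charts_vertex M C pe) => /=; rewrite ab.
- by apply: gen => //; rewrite /= ?tc ?lexx ?(ltW bt) ?(ltW tc) ?(ltW (lt_trans Xab bt)).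
- move=> x xe /andP[bx xc] /eqP FE; rewrite bx /= ltNge; apply: contraTN FE => xt.
  by apply: gen => //; rewrite /= ?xc ?xt //= ?(ltW bx) ?(ltW xc) // ltW // (lt_trans Xab).
- apply: weak; try exact: (proper_edge_in C).
  by apply: (@adjacent_edge_of _ _ (v c)) => //; rewrite !inE eqxx orbT.
Qed.

Lemma chart_signatureP : signature chart_signature n.
Proof.
move=> a b c d ab bc cd dn.
have [cn bn an] : [/\ (c < n)%N, (b < n)%N & (a < n)%N] by split; lia.
have [ac bd] := (ltn_trans ab bc, ltn_trans bc cd).
have Xlt i j : (i < j)%N -> (j < n)%N -> X i < X j by exact: (charts_lt C).
have Xle i j : (i <= j)%N -> (j < n)%N -> X i <= X j by exact: (charts_leq C).
have pr i j : (i < j)%N -> (j < n)%N -> proper_pair n (i, j) by move=> ij jn; apply/andP.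
have [d0 cd1 d1n] : [/\ (0 < d)%N, (c <= d.-1)%N & (d.-1 < n)%N] by split; lia.
have nE : ((a, b) != (a, c)) && ((c, d) != (b, d)) by rewrite !xpair_eqE !eqxx; lia.
have [abc cdb] := andP nE.
have [t [at_ tS gt]] := right_generic an.
have tb : t < X b by apply: lt_le_trans (tS _) (Xle _ _ _ bn) => //; exact: leq_ltn_trans bn.
have tc := lt_trans tb (Xlt _ _ bc cn).
have nbc : F (a, b) t != F (a, c) t.
  apply: gt => //; try exact: pr; rewrite /= ?at_ ?lexx ?(ltW at_) ?(ltW tb) ?(ltW tc) //.
have := lt_triple (F (a, d) t) nbc.
rewrite (weak_left_order ab bc cn at_ tb gt) (weak_left_order ab bd dn at_ tb gt).
rewrite (weak_left_order ac cd dn at_ tc gt).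
have [u [ud uS gu]] := left_generic dn.
have cu : X c < u by exact: le_lt_trans (Xle c d.-1 cd1 d1n) (uS d0).
have bu := lt_trans (Xlt _ _ bc cn) cu.
have ncb : F (c, d) u != F (b, d) u.
  apply: gu => //; try exact: pr; rewrite /= ?ud ?lexx ?(ltW ud) ?(ltW bu) ?(ltW cu) //.
have := lt_triple (F (a, d) u) ncb.
rewrite (weak_right_order bc cd dn cu ud gu) (weak_right_order ab bd dn bu ud gu).
rewrite (weak_right_order ac cd dn cu ud gu).
by case: (chart_signature a b c); case: (chart_signature a b d);
  case: (chart_signature a c d); case: (chart_signature b c d).
Qed.

End Weak.

(** The common range of ac and bd runs from b to c. At its ends one of the edges is at the vertex
    itself, first bd and then ac, so equal values of the signature mean a change of order. *)
Lemma odd_interleaved a b c d : (a < b)%N -> (b < c)%N -> (c < d)%N -> (d < n)%N ->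
  odd (pair_crossing_count D (E (a, c)) (E (b, d))) =
  (chart_signature a b c == chart_signature b c d).
Proof.
move=> ab bc cd dn.
have [cn bn an] : [/\ (c < n)%N, (b < n)%N & (a < n)%N] by split; lia.
have Xab : X a < X b by exact: (charts_lt C).
have Xbc : X b < X c by exact: (charts_lt C).
have Xcd : X c < X d by exact: (charts_lt C).
have pe : proper_pair n (a, c) by rewrite /proper_pair /=; lia.
have pf : proper_pair n (b, d) by rewrite /proper_pair /=; lia.
have ef : (a, c) != (b, d) by rewrite xpair_eqE; lia.
have fe : F (b, d) (X b) = Y b := charts_start M C pf.
have ee : F (a, c) (X c) = Y c := charts_end M C pe.
have eb : F (a, c) (X b) != Y b by apply: (charts_vertex M C pe) => /=; rewrite ab.
have fc : F (b, d) (X c) != Y c by apply: (charts_vertex M C pf) => /=; rewrite bc.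
rewrite (odd_pair_crossing M C pe pf ef (a := X b) (b := X c)) ?fe ?ee ?(ltW Xab) ?(ltW Xbc) ?(ltW Xcd) //.
- by rewrite /chart_signature; case: (ltgtP (F (b, d) (X c)) (Y c)) fc => // _ _; case: (_ < _).
- by rewrite eq_sym.
- by move=> x /= /andP[_ ->] /andP[-> _].
Qed.

Lemma odd_nested a b c d : (a < b)%N -> (b < c)%N -> (c < d)%N -> (d < n)%N ->
  odd (pair_crossing_count D (E (a, d)) (E (b, c))) =
  (chart_signature a b d != chart_signature a c d).
Proof.
move=> ab bc cd dn.
have [cn bn an] : [/\ (c < n)%N, (b < n)%N & (a < n)%N] by split; lia.
have Xab : X a < X b by exact: (charts_lt C).
have Xbc : X b < X c by exact: (charts_lt C).
have Xcd : X c < X d by exact: (charts_lt C).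
have pe : proper_pair n (a, d) by rewrite /proper_pair /=; lia.
have pf : proper_pair n (b, c) by rewrite /proper_pair /=; lia.
have ef : (a, d) != (b, c) by rewrite xpair_eqE; lia.
have fb : F (b, c) (X b) = Y b := charts_start M C pf.
have fc : F (b, c) (X c) = Y c := charts_end M C pf.
have eb : F (a, d) (X b) != Y b by apply: (charts_vertex M C pe) => /=; rewrite ab; lia.
have ec : F (a, d) (X c) != Y c by apply: (charts_vertex M C pe) => /=; rewrite cd; lia.
rewrite (odd_pair_crossing M C pe pf ef (a := X b) (b := X c)) ?fb ?fc ?(ltW Xab) ?(ltW Xbc) ?(ltW Xcd) //.
by rewrite /chart_signature; case: (_ < _); case: (_ < _).
Qed.

Lemma odd_pair_count_chart : weakly_semisimple D -> (hill_number n <= odd_pair_count D)%N.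
Proof.
move=> weak; apply: leq_trans (sum_cr_ge (chart_signatureP weak)) _.
(* The condition i < j selects one of the two orders of a pair of edges, which makes the map g below
   injective. *)
pose P (i k j l : nat) := [&& (i < k)%N, (j < l)%N, (i < j)%N &
   odd (pair_crossing_count D (E (i, k)) (E (j, l)))].
apply: (@leq_trans (sum4 n P)).
  apply: leq_trans (sum4_crossing_pairs n P); apply: leq_sum4 => a b c d _ _ _ dn.
  case: (ltnP a b) => //= ab; case: (ltnP b c) => //= bc; case: (ltnP c d) => //= cd.
  rewrite !mul1n /cr -odd_interleaved // -odd_nested //.
  have -> : P a c b d = odd (pair_crossing_count D (E (a, c)) (E (b, d))).
    by rewrite /P ab (ltn_trans ab bc) (ltn_trans bc cd).
  have -> : P a d b c = odd (pair_crossing_count D (E (a, d)) (E (b, c))).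
    by rewrite /P ab bc (ltn_trans (ltn_trans ab bc) cd).
  by apply: leq_add; exact: leq_addr.
pose Q := [set q : ('I_n * 'I_n) * ('I_n * 'I_n) | P q.1.1 q.1.2 q.2.1 q.2.2]%SET.
have -> : sum4 n P = #|Q|.
  rewrite -sum1_card big_mkcond /= /sum4 pair_bigA pair_bigA pair_bigA /=.
  rewrite (reindex (fun q : ('I_n * 'I_n) * ('I_n * 'I_n) => (q.1.1, q.1.2, q.2.1, q.2.2))) /=.
    by apply: eq_bigr => q _; rewrite inE; case: (P _ _ _ _).
  by exists (fun q => ((q.1.1.1, q.1.1.2), (q.1.2, q.2))) => [[[? ?] [? ?]]|[[[? ?] ?] ?]].
pose g (q : ('I_n * 'I_n) * ('I_n * 'I_n)) : {set {set complete_graph n}} :=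
  [set E (q.1.1 : nat, q.1.2 : nat); E (q.2.1 : nat, q.2.2 : nat)]%SET.
have pr (i k : 'I_n) : (i < k)%N -> proper_pair n (i : nat, k : nat).
  by move=> ik; rewrite /proper_pair /= ik ltn_ord.
have gi : {in Q &, injective g}.
  move=> [[i k] [j l]] [[i' k'] [j' l']]; rewrite !inE /P /= => /and4P[ik jl ij _] /and4P[ik' jl' ij' _].
  rewrite /g /= => gE.
  have inj x y : proper_pair n x -> proper_pair n y -> E x = E y -> x = y by exact: (edge_of_inj C).
  have [p1 p2 p3 p4] := And4 (pr _ _ ik) (pr _ _ jl) (pr _ _ ik') (pr _ _ jl').
  have : E (i : nat, k : nat) \in [set E (i' : nat, k' : nat); E (j' : nat, l' : nat)]%SET.
    by rewrite -gE !inE eqxx.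
  have : E (j : nat, l : nat) \in [set E (i' : nat, k' : nat); E (j' : nat, l' : nat)]%SET.
    by rewrite -gE !inE eqxx orbT.
  rewrite !inE => /orP[] /eqP/inj => /(_ p2) h1 /orP[] /eqP/inj => /(_ p1) h2.
  - by move: (h1 p3) (h2 p3) => [jE _] [iE _]; move: ij; rewrite jE iE ltnn.
  - by move: (h1 p3) (h2 p4) => [jE _] [iE _]; move: ij ij'; rewrite jE iE => /ltnW; rewrite leqNgt => /negbTE ->.
  - move: (h1 p4) (h2 p3) => [jE lE] [iE kE].
    by congr ((_, _), (_, _)); exact: val_inj.
  - by move: (h1 p4) (h2 p4) => [jE _] [iE _]; move: ij; rewrite jE iE ltnn.
rewrite -(card_in_imset gi) /odd_pair_count; apply/subset_leq_card/fintype.subsetP => _ /imsetP[q + ->].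
case: q => -[i k] [j l]; rewrite !inE /P /= => /and4P[ik jl ij od].
apply/existsP; exists (E (i : nat, k : nat)); apply/andP; split; first exact: (proper_edge_in C (pr _ _ ik)).
apply/existsP; exists (E (j : nat, l : nat)); apply/andP; split; first exact: (proper_edge_in C (pr _ _ jl)).
rewrite /g /= eqxx od !andbT; apply/eqP => /(edge_of_inj C (pr _ _ ik) (pr _ _ jl)) [iE _].
by move: ij; rewrite iE ltnn.
Qed.

End LowerBounds.

(** * Crossings of a monotone drawing bounded below by inversions *)

Section CrossingLowerBound.
Variables (R : realType) (n : nat) (D : predrawing R (complete_graph n)).
Notation edge := (nat * nat)%type.
Implicit Types (e f : edge).

Variables (v : nat -> 'I_n) (F : edge -> R -> R).
Hypotheses (M : is_monotone_drawing D) (C : charts D v F).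

Notation X i := (vertex_pos D (v i)).1.
Notation Y i := (vertex_pos D (v i)).2.
Notation E := (edge_of v).

Section SweepOfDrawing.
Variable t : nat -> R.
Hypothesis tX : forall m, (m < n)%N -> X m < t m.
Hypothesis tXS : forall m, (m.+1 < n)%N -> t m < X m.+1.
Hypothesis t_generic : forall m, (m < n)%N -> forall e f x,
  proper_pair n e -> proper_pair n f -> e != f -> X m < x <= t m ->
  X e.1 <= x <= X e.2 -> X f.1 <= x <= X f.2 -> F e x != F f x.

Let H m e := F e (t m).
(** The edge to the next vertex stands for vertex m itself: it exists whenever some edge passes m,
    and just to the right of m no passing edge separates the edges starting there. *)
Let c m := H m (m, m.+1).

Lemma over_proper m e : over n m e -> proper_pair n e.
Proof. by rewrite /over /proper_pair; lia. Qed.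

Lemma over_range m e : over n m e -> X e.1 < t m < X e.2.
Proof.
move=> /andP[/andP[em me] en]; have mn := ltn_trans me en.
rewrite (le_lt_trans (charts_leq C em mn) (tX mn)) /=.
exact: lt_le_trans (tXS (leq_ltn_trans me en)) (charts_leq C me en).
Qed.

Lemma sweep_heights_neq m e f : over n m e -> over n m f -> e != f -> H m e != H m f.
Proof.
move=> oe of_ ef; have [_ me en] := overP oe; have mn := ltn_trans me en.
have /andP[/ltW e1 /ltW e2] := over_range oe; have /andP[/ltW f1 /ltW f2] := over_range of_.
apply: (t_generic mn) => //; rewrite ?tX ?lexx ?e1 ?e2 ?f1 ?f2 //;
  do [exact: over_proper oe|exact: over_proper of_].
Qed.

Lemma start_order m e f : passes n m e -> over n m f -> f.1 = m ->
  (H m f < H m e) = (Y m < F e (X m)).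
Proof.
move=> pe of_ fm; have pf := over_proper of_; have oe := passes_over pe.
have [el me en] := overP oe; have mn := ltn_trans me en.
have pe' := over_proper oe; have /andP[e1 e2] := over_range oe.
have /andP[f1 f2] := over_range of_.
have em : X e.1 <= X m by exact: (charts_leq C).
have ef := passes_neq pe fm.
have FY : F f (X m) = Y m by rewrite -fm (charts_start M C pf).
have FE : F e (X m) != Y m.
  by apply: (charts_vertex M C pe'); move: pe; rewrite /passes => /andP[].
rewrite /H -FY; apply/esym; apply: (charts_same_order C) => //; rewrite ?fm ?(ltW e2) ?(ltW f2) ?(ltW (tX mn)) //.
move=> x /andP[mx xt]; have [<-|xm] := eqVneq (X m) x; first by rewrite FY.
apply: (t_generic mn) => //; rewrite ?fm ?xt ?mx ?(le_trans em mx) ?(ltW (le_lt_trans xt e2)) ?(ltW (le_lt_trans xt f2)) //.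
by rewrite lt_neqAle xm mx.
Qed.

Lemma sweep_of_drawing : sweep n c H.
Proof.
have lt_case m e f : passes n m e -> over n m f -> f.1 = m -> (H m f < H m e) = (c m < H m e).
  by move=> pe of_ fm; rewrite !(start_order pe) // (starting_edge pe).
split=> //.
- by move=> m e f oe of_ HE; apply/eqP; apply: contraTT (eqxx (H m e)) => /(sweep_heights_neq oe of_); rewrite HE.
- move=> m e f pe of_ fm; have := lt_case m e f pe of_ fm.
  have := sweep_heights_neq (passes_over pe) of_ (passes_neq pe fm).
  have := sweep_heights_neq (passes_over pe) (starting_edge pe) (passes_neq (f := (m, m.+1)) pe erefl).
  rewrite -/(c m).
  by case: (ltgtP (H m f)) => //; case: (ltgtP (c m)).
Qed.

(** The intermediate value theorem applies between t m and t m.+1 if both edges continue, and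
    between t m and vertex m.+1 if one ends there. *)
Lemma inverted_crossing m e f : inverted n c H m e f ->
  exists2 x, t m < x & ((m.+1 < n)%N -> x < t m.+1) /\ crossings D (E e) (E f) (x, F e x).
Proof.
move=> /and3P[oe of_ /andP[lt gt]].
have ef : e != f by apply: contraTneq lt => ->; rewrite ltxx.
have [pe pf] := (over_proper oe, over_proper of_).
have /andP[/ltW e1 e2] := over_range oe; have /andP[/ltW f1 f2] := over_range of_.
have mn : (m.+1 < n)%N by have [_ me en] := overP oe; exact: leq_ltn_trans en.
have Xe g : over n m g -> X m.+1 <= X g.2.
  by move=> /overP[_ mg gn]; exact: (charts_leq C).
have passR g : over n m g -> (m.+1 < g.2)%N -> t m.+1 < X g.2.
  move=> /overP[_ _ gn] mg.
  by apply: lt_le_trans (tXS (leq_ltn_trans mg gn)) _; exact: (charts_leq C).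
have tt : t m < t m.+1 by apply: lt_trans (tXS mn) (tX mn).
move: gt; rewrite /next; case: (ltnP m.+1 e.2) => me; case: (ltnP m.+1 f.2) => mf gt.
- have [x /andP[x1 x2] cr] := crossing_between M C pe pf ef e1 f1 (ltW (passR _ oe me)) (ltW (passR _ of_ mf)) (ltW tt) lt gt.
  by exists x.
- have f2E := over_end of_ mf; have pe1 := over_passes oe me.
  have Yf : F f (X m.+1) = Y m.+1 by rewrite -f2E (charts_end M C pf).
  move: gt; rewrite (start_order pe1 (starting_edge pe1)) // -Yf => gt.
  have Xf : X m.+1 <= X f.2 by rewrite f2E.
  have [x /andP[x1 x2] cr] := crossing_between M C pe pf ef e1 f1 (Xe _ oe) Xf (ltW (tXS mn)) lt gt.
  by exists x => //; split=> // _; apply: lt_trans x2 (tX mn).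
- have e2E := over_end oe me; have pf1 := over_passes of_ mf.
  have Ye : F e (X m.+1) = Y m.+1 by rewrite -e2E (charts_end M C pe).
  have gt' : F f (X m.+1) < F e (X m.+1).
    have := start_order pf1 (starting_edge pf1) erefl.
    have := charts_vertex M C pf (k := m.+1) (proj1 (andP pf1)).
    by rewrite -Ye; move: gt; rewrite -/(c m.+1); case: (ltgtP (F f (X m.+1))) => // _; case: ltgtP.
  have Xe2 : X m.+1 <= X e.2 by rewrite e2E.
  have [x /andP[x1 x2] cr] := crossing_between M C pe pf ef e1 f1 Xe2 (Xe _ of_) (ltW (tXS mn)) lt gt'.
  by exists x => //; split=> // _; apply: lt_trans x2 (tX mn).
- by move: gt; rewrite ltxx.
Qed.

End SweepOfDrawing.

Definition all_crossings : set (R * R) :=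
  [set p | exists a b, [/\ a \in edges (complete_graph n), b \in edges (complete_graph n),
     a != b & crossings D a b p]].

Lemma finite_all_crossings : finite_set all_crossings.
Proof.
pose I := [set ef : {set complete_graph n} * {set complete_graph n} |
  [/\ ef.1 \in edges (complete_graph n), ef.2 \in edges (complete_graph n) & ef.1 != ef.2]].
apply: (@sub_finite_set _ _ (\bigcup_(ef in I) (curve D ef.1 `&` curve D ef.2))).
  move=> p [e [f [ein fin ef [[t /subset_itv_oo_cc tI <-] [u /subset_itv_oo_cc uI uE] _]]]].
  by exists (e, f) => //; split; [exists t|exists u].
apply: bigcup_finite; first exact: finite_finset.
by move=> ef [e1 e2 ef12]; exact: (curve_finite (monotone_is_drawing M)).
Qed.

(** Inversions map injectively to crossings: the point determines its strip, then its two edges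
    because no three edges share an interior point, and their order at the start of the strip tells
    them apart. *)
Lemma crossing_count_chart : (hill_number n <= crossing_count D)%N.
Proof.
have /choice[t tP] : forall m, exists t, (m < n)%N -> [/\ X m < t, (m.+1 < n)%N -> t < X m.+1 &
  forall e f x, proper_pair n e -> proper_pair n f -> e != f -> X m < x <= t ->
  X e.1 <= x <= X e.2 -> X f.1 <= x <= X f.2 -> F e x != F f x].
  move=> m; have [mn|nm] := ltnP m n; last by exists 0.
  by have [t tP] := right_generic M C mn; exists t.
have tX m : (m < n)%N -> X m < t m by case/tP.
have tXS m : (m.+1 < n)%N -> t m < X m.+1 by move=> mn; case: (tP m (ltnW mn)) => _ ->.
have tG m : (m < n)%N -> forall e f x,
  proper_pair n e -> proper_pair n f -> e != f -> X m < x <= t m ->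
  X e.1 <= x <= X e.2 -> X f.1 <= x <= X f.2 -> F e x != F f x by case/tP.
apply: leq_trans (sweep_cost_ge (sweep_of_drawing tX tXS tG)) _.
set c := fun m => _; set H := fun m e => _.
rewrite sweep_costE.
pose T := ('I_n * 'I_n * 'I_n * 'I_n * 'I_n)%type.
pose P (q : T) := inverted n c H q.2 (q.1.1.1.1 : nat, q.1.1.1.2 : nat) (q.1.1.2 : nat, q.1.2 : nat).
have -> : sum4 n (fun i k j l => \sum_(m < n) inverted n c H m (i, k) (j, l))%N = #|[set q | P q]%SET|.
  rewrite -sum1_card big_mkcond /= /sum4 !pair_bigA /=; apply: eq_bigr => q _.
  by rewrite inE /P; case: inverted.
have /choice[g gP] : forall q : T, exists p : R * R, P q ->
   [/\ t q.2 < p.1, (q.2.+1 < n)%N -> p.1 < t q.2.+1 &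
     crossings D (E (q.1.1.1.1 : nat, q.1.1.1.2 : nat)) (E (q.1.1.2 : nat, q.1.2 : nat)) p].
  move=> q; have [Pq|nPq] := boolP (P q); last by exists (0, 0).
  have [x x1 [x2 xc]] := inverted_crossing tX tXS tG Pq.
  by exists (x, F (q.1.1.1.1 : nat, q.1.1.1.2 : nat) x).
have tmono a b : (a < b)%N -> (b < n)%N -> t a.+1 <= t b.
  rewrite leq_eqVlt => /orP[/eqP-> //|ab bn]; apply/ltW.
  have := tXS a.+1 (leq_ltn_trans ab bn); move/lt_trans; apply.
  by apply: le_lt_trans (tX b bn); exact: (charts_leq C).
have gi : {in [set q | P q]%SET &, injective g}.
  move=> [[[[i k] j] l] m] [[[[i' k'] j'] l'] m']; rewrite !inE => Pq Pq' gE.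
  have [/= t1 t2 c1] := gP _ Pq; have [/= t1' t2' c1'] := gP _ Pq'.
  rewrite -gE in t1' t2' c1'.
  have mE : m = m' :> nat.
    case: (ltngtP m m') => // mm.
      have := t2 (leq_ltn_trans mm (ltn_ord m')); move/lt_le_trans => /(_ _ (tmono _ _ mm (ltn_ord m'))).
      by move/lt_trans => /(_ _ t1'); rewrite ltxx.
    have := t2' (leq_ltn_trans mm (ltn_ord m)); move/lt_le_trans => /(_ _ (tmono _ _ mm (ltn_ord m))).
    by move/lt_trans => /(_ _ t1); rewrite ltxx.
  move: Pq Pq'; rewrite /P /= -mE => /and3P[oe of_ /andP[lt _]] /and3P[oe' of' /andP[lt' _]].
  have pr x : over n m x -> proper_pair n x by exact: over_proper.
  have ne x y : over n m x -> over n m y -> x != y -> E x != E y.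
    by move=> ox oy; apply: contraNN => /eqP/(edge_of_inj C (pr _ ox) (pr _ oy)) ->.
  have trip x y z : over n m x -> over n m y -> over n m z -> x != y ->
     crossings D (E x) (E y) (g (i, k, j, l, m)) ->
     curve_interior D (E z) (g (i, k, j, l, m)) -> z = x \/ z = y.
    move=> ox oy oz xy [cx cy _] cz; have [->|zx] := eqVneq z x; first by left.
    have [->|zy] := eqVneq z y; first by right.
    have xz : E x != E z by apply: ne; rewrite 1?eq_sym.
    have yz : E y != E z by apply: ne; rewrite 1?eq_sym.
    have E0 := no_triple_point (monotone_is_drawing M) (proper_edge_in C (pr _ ox))
      (proper_edge_in C (pr _ oy)) (proper_edge_in C (pr _ oz)) (ne _ _ ox oy xy) xz yz.
    by suff : set0 (g (i, k, j, l, m)) by []; rewrite -E0.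
  have ef : (i : nat, k : nat) != (j : nat, l : nat) by apply: contraTneq lt => ->; rewrite ltxx.
  have [ci' cj' _] := c1'.
  have fin (e f e' f' : edge) : H m e < H m f -> H m e' < H m f' ->
      e' = e \/ e' = f -> f' = e \/ f' = f -> e' = e /\ f' = f.
    move=> h h' [?|?] [?|?]; subst e' f' => //; first by move: h'; rewrite ltxx.
      by move: (lt_trans h h'); rewrite ltxx.
    by move: h'; rewrite ltxx.
  have [[iE kE] [jE lE]] := fin _ _ _ _ lt lt' (trip _ _ _ oe of_ oe' ef c1 ci') (trip _ _ _ oe of_ of' ef c1 cj').
  have -> : m' = m by exact: val_inj.
  by rewrite (val_inj iE) (val_inj kE) (val_inj jE) (val_inj lE).
rewrite /crossing_count -/all_crossings cardE -(size_map g).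
apply: uniq_leq_size.
  by rewrite map_inj_in_uniq ?enum_uniq // => x y; rewrite !mem_enum; exact: gi.
move=> _ /mapP[q + ->]; rewrite mem_enum inE => Pq; have [_ _ cq] := gP q Pq.
rewrite in_fset_set ?inE; last exact: finite_all_crossings.
move: Pq => /and3P[oe of_ /andP[lt _]].
eexists; eexists; split; [..|exact: cq].
- exact: (proper_edge_in C (over_proper oe)).
- exact: (proper_edge_in C (over_proper of_)).
- apply: contraTneq lt => /(edge_of_inj C (over_proper oe) (over_proper of_)) ->.
  by rewrite ltxx.
Qed.

End CrossingLowerBound.

(** * An optimal drawing *)

Section Positions.

(* Grows so fast that no three chords of the parabola at these abscissae are
   concurrent. *)
Fixpoint abscissa (i : nat) : nat :=
  if i is i'.+1 then (abscissa i' ^ 3 + abscissa i').+1 else 0.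

Lemma abscissa_lt i j : (i < j)%N -> (abscissa i ^ 3 + abscissa i < abscissa j)%N.
Proof.
elim: j => // j IH; rewrite ltnS leq_eqVlt => /orP[/eqP->|/IH h]; first exact: ltnSn.
by rewrite /= ltnS (leq_trans (ltnW h)) // leq_addl.
Qed.

Variable R : realType.

Definition xpos i : R := (abscissa i)%:R.

Lemma xpos_lt i j : (i < j)%N -> xpos i < xpos j.
Proof. by move=> /abscissa_lt h; rewrite ltr_nat (leq_ltn_trans _ h) // leq_addl. Qed.

Lemma xpos_ltE i j : (xpos i < xpos j) = (i < j)%N.
Proof.
case: (ltngtP i j) => [/xpos_lt//|/xpos_lt ji|->]; last by rewrite ltxx.
exact: lt_gtF.
Qed.

Lemma xpos_inj : injective xpos.
Proof.
by move=> i j E; have := xpos_ltE i j; have := xpos_ltE j i; rewrite E ltxx; lia.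
Qed.

Definition parabola a b x : R := (x - a) * (b - x).

(** Of two nested intervals, even with a common end, the outer one has the strictly higher parabola
    inside the inner one. *)
Lemma parabolas_interleave a b c d x : a < x < b -> c < x < d ->
  parabola a b x = parabola c d x -> (a, b) != (c, d) ->
  (a < c /\ c < b /\ b < d) \/ (c < a /\ a < d /\ d < b).
Proof.
rewrite /parabola xpair_eqE => /andP[ax xb] /andP[cx xd] E ne.
case: (ltgtP a c) => [ac|ca|ac]; [left|right|exfalso].
- by split=> //; split; [lra|nra].
- by split=> //; split; [lra|nra].
- move: ne; rewrite ac eqxx /=; case/negP; apply/eqP.
  have : x - c != 0 by rewrite subr_eq0 gt_eqF.
  by move/mulfI => /(_ (b - x) (d - x)); rewrite -{1}ac => /(_ E); lra.
Qed.

Lemma parabolas_meet a b c d x : parabola a b x = parabola c d x ->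
  (a + b - c - d) * x = a * b - c * d.
Proof. by rewrite /parabola => E; apply/eqP; rewrite -subr_eq0; apply/eqP; move: E; lra. Qed.

(** Let a < ... < f be the six abscissae, k = b + e - a - d and m = c + f - a - d. The first
    equation gives x * k = b * e - a * d, an integer, so x - c is at least 1 / k; the second gives
    (x - c) * m = (c - a) * (d - c). Hence m <= (c - a) * (d - c) * k <= e ^ 3, while f > e ^ 3 + e
    forces m > e ^ 3. *)
Lemma no_concurrent_parabolas i1 i2 i3 i4 i5 i6 x :
  (i1 < i2)%N -> (i2 < i3)%N -> (i3 < i4)%N -> (i4 < i5)%N -> (i5 < i6)%N ->
  xpos i3 < x ->
  parabola (xpos i1) (xpos i4) x = parabola (xpos i2) (xpos i5) x ->
  parabola (xpos i1) (xpos i4) x = parabola (xpos i3) (xpos i6) x -> False.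
Proof.
move=> /abscissa_lt h1 /abscissa_lt h2 /abscissa_lt h3 /abscissa_lt h4 /abscissa_lt h5.
rewrite /xpos.
move: (abscissa i1) (abscissa i2) (abscissa i3) (abscissa i4) (abscissa i5) (abscissa i6) h1 h2 h3 h4 h5.
move=> a b c d e f ab bc cd de ef cx E1 E2.
have {}ab : (a < b)%N by lia. have {}bc : (b < c)%N by lia.
have {}cd : (c < d)%N by lia. have {}de : (d < e)%N by lia.
have [k kE] : exists k, (b + e = a + d + k)%N by exists (b + e - a - d)%N; lia.
have [m mE] : exists m, (c + f = a + d + m)%N by exists (c + f - a - d)%N; lia.
have k0 : (0 < k)%N by lia.
have ke : (k <= e)%N by lia.
have em : (e ^ 3 < m)%N by lia.
have kR : (b%:R + e%:R = a%:R + d%:R + k%:R :> R) by rewrite -!natrD kE.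
have mR : (c%:R + f%:R = a%:R + d%:R + m%:R :> R) by rewrite -!natrD mE.
have xk : x * k%:R = b%:R * e%:R - a%:R * d%:R.
  have -> : k%:R = b%:R + e%:R - a%:R - d%:R :> R by lra.
  by move: E1; rewrite /parabola; lra.
have xm : (x - c%:R) * m%:R = (c%:R - a%:R) * (d%:R - c%:R).
  have -> : m%:R = c%:R + f%:R - a%:R - d%:R :> R by lra.
  by move: E2; rewrite /parabola; lra.
have kp : 0 < k%:R :> R by rewrite ltr0n.
have xk0 : 0 < (x - c%:R) * k%:R by rewrite mulr_gt0 // subr_gt0.
have xk1 : 1 <= (x - c%:R) * k%:R.
  have : a%:R * d%:R + c%:R * k%:R < b%:R * e%:R :> R by lra.
  rewrite -!natrM -natrD ltr_nat => lt; have : (a * d + c * k + 1 <= b * e)%N by lia.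
  by rewrite -(ler_nat R) !natrD !natrM; lra.
have mp : 0 <= m%:R :> R by exact: ler0n.
have : m%:R <= (c%:R - a%:R) * (d%:R - c%:R) * k%:R :> R.
  by rewrite -xm mulrAC -{1}[m%:R]mul1r; exact: ler_wpM2r.
have [u uE] : exists u, (c = a + u)%N by exists (c - a)%N; lia.
have [w wE] : exists w, (d = c + w)%N by exists (d - c)%N; lia.
have -> : c%:R - a%:R = u%:R :> R by rewrite uE natrD; lra.
have -> : d%:R - c%:R = w%:R :> R by rewrite wE natrD; lra.
rewrite -!natrM ler_nat => le; have : (u * w * k <= e * e * e)%N.
  by rewrite !leq_mul //; lia.
by move: em; rewrite !expnS expn0 muln1 mulnA; lia.
Qed.

End Positions.

(** * Charts at the crossing of two parabolas *)

Section ParabolicCrossing.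
Variable R : realType.
Implicit Types (a b c d x s : R).

Lemma parabola_continuous (T : topologicalType) a b (f : T -> R) q :
  {for q, continuous f} -> {for q, continuous (fun z => parabola a b (f z))}.
Proof.
move=> fc; apply: cvgM; first by apply: cvgB => //; exact: cvg_cst.
by apply: cvgB => //; exact: cvg_cst.
Qed.

(** The coordinates of h vanish on the two parabolas, and their difference is affine in the abscissa
    with slope a + b - c - d, so h is invertible on the whole plane. U is the vertical strip where
    both range conditions hold. *)
Lemma properly_cross_parabolas s a b c d (A B : set (R * R)) p : s * s = 1 ->
  (forall q, A q <-> a <= q.1 <= b /\ q.2 = s * parabola a b q.1) ->
  (forall q, B q <-> c <= q.1 <= d /\ q.2 = s * parabola c d q.1) ->
  a < p.1 < b -> c < p.1 < d -> A p -> B p -> a + b != c + d -> properly_cross A B p.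
Proof.
move=> ss AP BP pab pcd Ap Bp sl.
have sI (y z : R) : (y = s * z) <-> (s * y = z).
  by split=> [->|<-]; rewrite mulrA ss mul1r.
have k0 : a + b - c - d != 0 by rewrite -addrA -opprD subr_eq0.
pose U : set (R * R) := fst @^-1` (`]a, b[ `&` `]c, d[).
pose h (q : R * R) := (s * q.2 - parabola c d q.1, s * q.2 - parabola a b q.1).
pose xg (q : R * R) := (q.1 - q.2 + (a * b - c * d)) / (a + b - c - d).
pose g (q : R * R) := (xg q, s * (q.1 + parabola c d (xg q))).
have gh q : g (h q) = q.
  have E : xg (h q) = q.1.
    rewrite /xg /h /=; apply: (mulIf k0); rewrite mulfVK // /parabola; ring.
  rewrite /g E /h /= subrK mulrA ss mul1r -surjective_pairing //.
have hg q : h (g q) = q.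
  have E : (a + b - c - d) * xg q = q.1 - q.2 + (a * b - c * d).
    by rewrite /xg mulrC mulfVK.
  rewrite /h /g /= mulrA ss mul1r [RHS]surjective_pairing; congr (_, _); first by lra.
  by move: E; rewrite /parabola; move: (xg q) => x E; lra.
have fc (q : R * R) : {for q, continuous fst} by exact: cvg_fst.
have sc (q : R * R) : {for q, continuous snd} by exact: cvg_snd.
have hc q : {for q, continuous h}.
  by apply: continuous_pair; apply: cvgB; try (apply: cvgM; [exact: cvg_cst|exact: sc]);
    exact: parabola_continuous.
have xgc q : {for q, continuous xg}.
  by apply: cvgM; [apply: cvgD; [apply: cvgB; [exact: fc|exact: sc]|exact: cvg_cst]|exact: cvg_cst].
have gc q : {for q, continuous g}.
  apply: continuous_pair; first exact: xgc.
  by apply: cvgM; [exact: cvg_cst|apply: cvgD; [exact: fc|exact: parabola_continuous]].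
have Uo : open U.
  apply: open_comp; first by move=> q _; exact: fc.
  by apply: openI; exact: interval_open.
have [_ /sI pA] := (AP p).1 Ap; have [_ /sI pB] := (BP p).1 Bp.
exists U, h, g; split; [split|split; [split|]] => //.
- by rewrite /h {1}pB pA !subrr.
- have -> : h @` U = g @^-1` U.
    rewrite eqEsubset; split=> [_ [q Uq <-]|q Uq]; first by rewrite /= gh.
    by exists (g q).
  by apply: open_comp => // q _; exact: gc.
- move=> q []; rewrite /= !in_itv /= => /andP[aq qb] /andP[cq qd]; split.
    rewrite AP /h /= (ltW aq) (ltW qb); split=> [[_ /sI ->]|/eqP]; first by rewrite subrr.
    by rewrite subr_eq0 => /eqP /sI.
  rewrite BP /h /= (ltW cq) (ltW qd); split=> [[_ /sI ->]|/eqP]; first by rewrite subrr.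
  by rewrite subr_eq0 => /eqP /sI.
Qed.

End ParabolicCrossing.

Section TwoPageDrawing.
Variables (R : realType) (n : nat).
Implicit Types (e f : {set complete_graph n}).

(** The default value is reached only at sets that are not edges. *)
Definition ends e : nat * nat :=
  if [pick ij : 'I_n * 'I_n | (ij.1 < ij.2)%N && (e == [set ij.1; ij.2]%SET)] is Some ij
  then (ij.1 : nat, ij.2 : nat) else (0, 1)%N.

Lemma endsP e : e \in edges (complete_graph n) -> exists i j : 'I_n,
  [/\ (i < j)%N, e = [set i; j]%SET & ends e = (i : nat, j : nat)].
Proof.
rewrite inE => /cards2P[x [y [xy ->]]]; rewrite /ends; case: pickP => [[i j] /= /andP[ij /eqP eE]|no].
  by exists i, j; rewrite eE.
have xyn : x != y :> nat by [].
case: (ltngtP x y) => [lt|lt|eq].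
- by have := no (x, y); rewrite /= lt eqxx.
- by have := no (y, x); rewrite /= lt finset.setUC eqxx.
- by rewrite eq eqxx in xyn.
Qed.

Definition page e : R := if top_page n (ends e).1 (ends e).2 then 1 else -1.

Definition leftx e := xpos R (ends e).1.
Definition rightx e := xpos R (ends e).2.
Definition height e x := page e * parabola (leftx e) (rightx e) x.

Definition two_page_drawing : predrawing R (complete_graph n) :=
  @Predrawing R (complete_graph n) (fun i : 'I_n => (xpos R i, 0))
    (fun e t => let x := leftx e + t * (rightx e - leftx e) in (x, height e x)).

Notation D := two_page_drawing.

Lemma page_sqr e : page e * page e = 1.
Proof. by rewrite /page; case: ifP => _; rewrite ?mulrNN mulr1. Qed.

Lemma ends_lt e : e \in edges (complete_graph n) -> leftx e < rightx e.
Proof. by move=> /endsP[i [j [ij _ E]]]; rewrite /leftx /rightx E xpos_ltE. Qed.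

Lemma ends_inj e f : e \in edges (complete_graph n) -> f \in edges (complete_graph n) ->
  (leftx e, rightx e) = (leftx f, rightx f) -> e = f.
Proof.
move=> /endsP[i [j [_ -> E]]] /endsP[k [l [_ -> E']]]; rewrite /leftx /rightx E E' /=.
by move=> [/xpos_inj/val_inj -> /xpos_inj/val_inj ->].
Qed.

Lemma curve_two_page e q : e \in edges (complete_graph n) ->
  curve D e q <-> leftx e <= q.1 <= rightx e /\ q.2 = height e q.1.
Proof.
move=> /ends_lt lt; split=> [[t + <-]|[/andP[lq qr] qE]].
  rewrite /= in_itv /= => /andP[t0 t1]; split=> //.
  by apply/andP; split; nra.
exists ((q.1 - leftx e) / (rightx e - leftx e)).
  rewrite /= in_itv /= divr_ge0 ?subr_ge0 ?(ltW lt) //= ler_pdivrMr ?subr_gt0 //; lra.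
by rewrite /= divfK ?subr_eq0 ?gt_eqF // addrC subrK -qE -surjective_pairing.
Qed.

Lemma curve_interior_two_page e q : e \in edges (complete_graph n) ->
  curve_interior D e q <-> leftx e < q.1 < rightx e /\ q.2 = height e q.1.
Proof.
move=> /ends_lt lt; split=> [[t + <-]|[/andP[lq qr] qE]].
  rewrite /= in_itv /= => /andP[t0 t1]; split=> //.
  by apply/andP; split; nra.
exists ((q.1 - leftx e) / (rightx e - leftx e)).
  rewrite /= in_itv /= divr_gt0 ?subr_gt0 //= ltr_pdivrMr ?subr_gt0 //; lra.
by rewrite /= divfK ?subr_eq0 ?gt_eqF // addrC subrK -qE -surjective_pairing.
Qed.

(** The parabolas are positive between their ends, so the horizontal axis separates the two
    pages. *)
Lemma height_meet e f x : leftx e < x < rightx e -> leftx f < x < rightx f ->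
  height e x = height f x -> page e = page f /\
  parabola (leftx e) (rightx e) x = parabola (leftx f) (rightx f) x.
Proof.
move=> /andP[e1 e2] /andP[f1 f2]; rewrite /height /page.
have pe : 0 < parabola (leftx e) (rightx e) x by rewrite mulr_gt0 ?subr_gt0.
have pf : 0 < parabola (leftx f) (rightx f) x by rewrite mulr_gt0 ?subr_gt0.
by do 2 case: ifP => _; rewrite ?mul1r ?mulN1r => E; split=> //; lra.
Qed.

Lemma interiors_meet e f p : e \in edges (complete_graph n) -> f \in edges (complete_graph n) ->
  e != f -> curve_interior D e p -> curve_interior D f p ->
  [/\ page e = page f,
   parabola (leftx e) (rightx e) p.1 = parabola (leftx f) (rightx f) p.1 &
   (leftx e < leftx f /\ leftx f < rightx e /\ rightx e < rightx f) \/
   (leftx f < leftx e /\ leftx e < rightx f /\ rightx f < rightx e)].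
Proof.
move=> ein fin ef /(curve_interior_two_page _ ein)[pe pE] /(curve_interior_two_page _ fin)[pf pF].
have [|pg par] := height_meet pe pf; first by rewrite -pE -pF.
split=> //; apply: parabolas_interleave pe pf par _.
by apply: contraNN ef => /eqP/(ends_inj ein fin) ->.
Qed.

Lemma drawing_no_touching e f : e \in edges (complete_graph n) -> f \in edges (complete_graph n) ->
  e != f -> curve_interior D e `&` curve_interior D f `<=` crossings D e f.
Proof.
move=> ein fin ef p [pe pf]; have [pg _ il] := interiors_meet ein fin ef pe pf.
split=> //; have [pe1 pe2] := (curve_interior_two_page p ein).1 pe.
have [pf1 pf2] := (curve_interior_two_page p fin).1 pf.
have wk (a b x : R) : a < x < b -> a <= x <= b by move=> /andP[/ltW -> /ltW ->].
apply: (properly_cross_parabolas (page_sqr e) _ _ pe1 pf1).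
- by move=> q; exact: curve_two_page.
- by move=> q; rewrite pg; exact: curve_two_page.
- by apply/(curve_two_page p ein); rewrite wk.
- by apply/(curve_two_page p fin); rewrite wk.
- by apply/eqP; case: il => -[h1 [_ h2]]; lra.
Qed.

(** Edges through p interleave pairwise, so once sorted by left ends their six ends are ordered as
    [no_concurrent_parabolas] requires. *)
Lemma drawing_no_triple e1 e2 e3 p :
  e1 \in edges (complete_graph n) -> e2 \in edges (complete_graph n) -> e3 \in edges (complete_graph n) ->
  e1 != e2 -> e1 != e3 -> e2 != e3 ->
  curve_interior D e1 p -> curve_interior D e2 p -> curve_interior D e3 p -> False.
Proof.
move=> in1 in2 in3 n12 n13 n23 c1 c2 c3.
have key f1 f2 f3 : f1 \in edges (complete_graph n) -> f2 \in edges (complete_graph n) ->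
   f3 \in edges (complete_graph n) -> f1 != f2 -> f1 != f3 -> f2 != f3 ->
   curve_interior D f1 p -> curve_interior D f2 p -> curve_interior D f3 p ->
   leftx f1 < leftx f2 -> leftx f2 < leftx f3 -> False.
  move=> fin1 fin2 fin3 f12 f13 f23 d1 d2 d3 l12 l23.
  have [_ q12 i12] := interiors_meet fin1 fin2 f12 d1 d2.
  have [_ q13 i13] := interiors_meet fin1 fin3 f13 d1 d3.
  have [_ _ i23] := interiors_meet fin2 fin3 f23 d2 d3.
  have [/andP[x3 _] _] := (curve_interior_two_page p fin3).1 d3.
  have [r12 r23 m] : [/\ rightx f1 < rightx f2, rightx f2 < rightx f3 & leftx f3 < rightx f1].
    by split; [case: i12|case: i23|case: i13] => -[? [? ?]]; lra.
  move: l12 l23 m r12 r23 x3 q12 q13; rewrite /leftx /rightx !xpos_ltE.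
  exact: no_concurrent_parabolas.
have [_ _ i12] := interiors_meet in1 in2 n12 c1 c2.
have [_ _ i13] := interiors_meet in1 in3 n13 c1 c3.
have [_ _ i23] := interiors_meet in2 in3 n23 c2 c3.
have sy (a b : {set complete_graph n}) : a != b -> b != a by rewrite eq_sym.
case: i12 => -[l12 _]; case: i13 => -[l13 _]; case: i23 => -[l23 _].
- exact: (key e1 e2 e3).
- by apply: (key e1 e3 e2) => //; exact: sy.
- by lra.
- by apply: (key e3 e1 e2) => //; exact: sy.
- by apply: (key e2 e1 e3) => //; exact: sy.
- by lra.
- by apply: (key e2 e3 e1) => //; exact: sy.
- by apply: (key e3 e2 e1) => //; exact: sy.
Qed.

Lemma finite_curves e f : e \in edges (complete_graph n) -> f \in edges (complete_graph n) ->
  e != f -> finite_set (curve D e `&` curve D f).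
Proof.
move=> ein fin ef.
pose x0 := (leftx e * rightx e - leftx f * rightx f) / (leftx e + rightx e - leftx f - rightx f).
pose s := [:: leftx e; rightx e; leftx f; rightx f; x0].
apply: (@sub_finite_set _ _ ((fun x => (x, height e x)) @` [set` s])); last exact: finite_image.
move=> p [pe pf]; have [/andP[e1 e2] eE] := (curve_two_page p ein).1 pe.
have [/andP[f1 f2] fE] := (curve_two_page p fin).1 pf.
exists p.1; last by rewrite -eE -surjective_pairing.
rewrite /= /s !inE.
have [//|n1] := eqVneq p.1 (leftx e); have [//|n2] := eqVneq p.1 (rightx e).
have [//|n3] := eqVneq p.1 (leftx f); have [//|n4] := eqVneq p.1 (rightx f).
have i1 : curve_interior D e p.
  by apply/(curve_interior_two_page p ein); rewrite !lt_neqAle e1 e2 eq_sym n1 n2.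
have i2 : curve_interior D f p.
  by apply/(curve_interior_two_page p fin); rewrite !lt_neqAle f1 f2 eq_sym n3 n4.
have [_ par il] := interiors_meet ein fin ef i1 i2.
apply/eqP; rewrite /x0 -(parabolas_meet par) mulrAC divff ?mul1r //.
by apply/eqP; case: il => -[h1 [_ h2]]; lra.
Qed.

Lemma two_page_is_drawing : is_drawing D.
Proof.
split.
- by move=> i j [] /xpos_inj /val_inj.
- move=> e ein; apply: continuous_subspaceT => t.
  have xc : {for t, continuous (fun u : R => leftx e + u * (rightx e - leftx e) : R)}.
    by apply: cvgD; [exact: cvg_cst|apply: cvgM; [exact: cvg_id|exact: cvg_cst]].
  apply: (continuous_pair xc); apply: (cvgM (cvg_cst (page e))).
  exact: (parabola_continuous xc).
- move=> e /ends_lt lt t u _ _ [/addrI E _]; move: E.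
  by apply: mulIf; rewrite subr_eq0 gt_eqF.
- move=> e /[dup] ein /endsP[i [j [ij eE E]]].
  have h0 x : x = leftx e \/ x = rightx e -> height e x = 0.
    by rewrite /height /parabola => -[]->; rewrite subrr ?mul0r ?mulr0.
  have -> : edge_arc D e 0 = (xpos R i, 0).
    by rewrite /= mul0r addr0 h0; [rewrite /leftx E|left].
  have -> : edge_arc D e 1 = (xpos R j, 0).
    by rewrite /= mul1r addrC subrK h0; [rewrite /rightx E|right].
  rewrite eqEsubset; split=> [q []->|q [w + <-]].
  + by exists i => //=; rewrite eE !inE eqxx.
  + by exists j => //=; rewrite eE !inE eqxx orbT.
  + by rewrite /= eE !inE => /orP[]/eqP->; [left|right].
- move=> e w /[dup] ein /endsP[i [j [ij eE E]]] /(curve_two_page _ ein)[/= _ /esym/eqP].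
  have pn0 : page e != 0 by rewrite /page; case: ifP => _; rewrite ?oppr_eq0 oner_eq0.
  rewrite /height mulf_eq0 (negbTE pn0) /= /parabola mulf_eq0 !subr_eq0 /leftx /rightx E /= eE !inE.
  by case/orP => /eqP /xpos_inj /val_inj ->; rewrite eqxx ?orbT.
- exact: finite_curves.
- exact: drawing_no_touching.
- move=> e1 e2 e3 in1 in2 in3 n12 n13 n23; apply/seteqP; split=> // p [[c1 c2] c3].
  exact: (drawing_no_triple in1 in2 in3 n12 n13 n23 c1 c2 c3).
Qed.

Lemma two_page_is_monotone : is_monotone_drawing D.
Proof.
split; first exact: two_page_is_drawing.
- move=> e ein p q /(curve_two_page _ ein)[_ pE] /(curve_two_page _ ein)[_ qE] pq.
  by rewrite [p]surjective_pairing [q]surjective_pairing pE qE pq.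
- by move=> i j /xpos_inj /val_inj.
Qed.

Lemma two_page_semisimple : semisimple D.
Proof.
move=> e f ein fin /andP[ef adj]; apply/seteqP; split=> // p [pe pf _].
have [_ _ il] := interiors_meet ein fin ef pe pf; case/pred0Pn: adj => w /= /andP[].
move: il; have [i [j [ij -> E]]] := endsP ein; have [k [l [kl -> E']]] := endsP fin.
rewrite /leftx /rightx E E' /= !xpos_ltE !inE => il.
by move=> /orP[]/eqP-> /orP[]/eqP wE; move: il; rewrite ?wE; lia.
Qed.

(** Nested edges do not appear, since the second term of [cr] vanishes for [page_signature]. *)
Definition crossing_quadruples :=
  [set q : 'I_n * 'I_n * 'I_n * 'I_n |
    [&& (q.1.1.1 < q.1.1.2)%N, (q.1.1.2 < q.1.2)%N, (q.1.2 < q.2)%N &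
        top_page n q.1.1.1 q.1.2 == top_page n q.1.1.2 q.2]]%SET.

Lemma card_crossing_quadruples : #|crossing_quadruples| = hill_number n.
Proof.
rewrite -sum_cr_two_page -sum1_card big_mkcond /= /sum4 !pair_bigA /=.
apply: eq_bigr => q _; rewrite inE /cr /page_signature eqxx addn0.
by do 3 case: (_ < _)%N; case: (_ == _).
Qed.

Lemma crossing_quadruple e f p : e \in edges (complete_graph n) -> f \in edges (complete_graph n) ->
  e != f -> crossings D e f p -> exists2 q, q \in crossing_quadruples &
  [set e; f]%SET = [set [set q.1.1.1; q.1.2]; [set q.1.1.2; q.2]]%SET.
Proof.
wlog lt : e f / leftx e < leftx f.
  move=> H ein fin ef [pe pf pc].
  have [_ _ [[lt _]|[lt _]]] := interiors_meet ein fin ef pe pf.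
    exact: (H e f lt).
  rewrite finset.setUC; apply: (H f e lt) => //; first by rewrite eq_sym.
  by split=> //; exact: properly_crossC.
move=> ein fin ef [pe pf _]; have [pg _ il] := interiors_meet ein fin ef pe pf.
have [lr rr] : leftx f < rightx e /\ rightx e < rightx f by case: il => -[? [? ?]]; split; lra.
move: pg lt lr rr; have [i [j [ij eE E]]] := endsP ein; have [k [l [kl fE E']]] := endsP fin.
rewrite /page /leftx /rightx E E' !xpos_ltE /= => pg ik kj jl.
exists (i, k, j, l); last by rewrite eE fE.
rewrite inE /= ik kj jl /=; move: pg; do 2 case: ifP => _ //; lra.
Qed.

Lemma two_page_odd_pair_count : (odd_pair_count D <= hill_number n)%N.
Proof.
rewrite -card_crossing_quadruples.
pose g (q : 'I_n * 'I_n * 'I_n * 'I_n) : {set {set complete_graph n}} :=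
  [set [set q.1.1.1; q.1.2]; [set q.1.1.2; q.2]]%SET.
apply: leq_trans (leq_imset_card g _); apply/subset_leq_card/fintype.subsetP => P.
rewrite inE => /existsP[e /andP[ein /existsP[f /andP[fin /and3P[ef /eqP PE od]]]]].
have [p pI] : exists p, p \in fset_set (crossings D e f).
  apply/fset0Pn; apply: contraTneq od => E; by rewrite /pair_crossing_count E cardfs0.
have cp : crossings D e f p.
  move: pI; rewrite in_fset_set ?inE //.
  apply: sub_finite_set (finite_curves ein fin ef) => q.
  move=> [/(curve_interior_two_page _ ein)[qe qE] /(curve_interior_two_page _ fin)[qf qF] _].
  have wk (a b x : R) : a < x < b -> a <= x <= b by move=> /andP[/ltW -> /ltW ->].
  by split; [apply/(curve_two_page _ ein)|apply/(curve_two_page _ fin)]; rewrite wk.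
by have [q qI qE] := crossing_quadruple ein fin ef cp; apply/imsetP; exists q; rewrite // PE.
Qed.

Lemma crossing_unique e f p p' : e \in edges (complete_graph n) -> f \in edges (complete_graph n) ->
  e != f -> crossings D e f p -> crossings D e f p' -> p = p'.
Proof.
move=> ein fin ef [pe pf _] [pe' pf' _].
have [_ par il] := interiors_meet ein fin ef pe pf.
have [_ par' _] := interiors_meet ein fin ef pe' pf'.
have [_ pE] := (curve_interior_two_page p ein).1 pe.
have [_ pE'] := (curve_interior_two_page p' ein).1 pe'.
have x1 : p.1 = p'.1.
  have k0 : leftx e + rightx e - leftx f - rightx f != 0.
    by apply/eqP; case: il => -[h1 [_ h2]]; lra.
  by apply: (mulfI k0); rewrite (parabolas_meet par) (parabolas_meet par').
by rewrite [p]surjective_pairing [p']surjective_pairing pE pE' x1.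
Qed.

Lemma two_page_crossing_count : (crossing_count D <= hill_number n)%N.
Proof.
rewrite -card_crossing_quadruples /crossing_count.
set A := (X in fset_set X).
(* The point g q is the only crossing of the two edges given by q, or arbitrary if they do not
   cross; hence g maps the quadruples onto a set containing all crossings. *)
have /choice[g gP] : forall q : 'I_n * 'I_n * 'I_n * 'I_n, exists p : R * R, forall e f p',
    e \in edges (complete_graph n) -> f \in edges (complete_graph n) -> e != f ->
    [set e; f]%SET = [set [set q.1.1.1; q.1.2]; [set q.1.1.2; q.2]]%SET -> crossings D e f p' -> p' = p.
  move=> q; have [[e [f [p [ein fin ef qE cp]]]]|no] := pselect (exists e f p,
    [/\ e \in edges (complete_graph n), f \in edges (complete_graph n), e != f,
    [set e; f]%SET = [set [set q.1.1.1; q.1.2]; [set q.1.1.2; q.2]]%SET & crossings D e f p]).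
    exists p => e' f' p' ein' fin' ef' qE' cp'.
    have : e' \in [set e; f]%SET /\ f' \in [set e; f]%SET by rewrite qE -qE' !inE !eqxx orbT.
    rewrite !inE => -[/orP[]/eqP eE /orP[]/eqP fE]; subst e' f'; rewrite ?eqxx // in ef' cp' *.
      exact: (crossing_unique ein fin ef).
    apply: (crossing_unique ein fin ef) => //; case: cp' => ? ? ?; split=> //.
    exact: properly_crossC.
  by exists (0, 0) => e f p' ein fin ef qE cp; exfalso; apply: no; exists e, f, p'.
have sub p : A p -> p \in [seq g q | q in crossing_quadruples].
  move=> [e [f [ein fin ef cp]]]; have [q qI qE] := crossing_quadruple ein fin ef cp.
  by rewrite (gP q e f p ein fin ef qE cp); exact: fintype.image_f.
have finA : finite_set A by apply: sub_finite_set (finite_seq [seq g q | q in crossing_quadruples]).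
rewrite -(size_image g); apply: uniq_leq_size; first exact: fset_uniq.
by move=> p; rewrite in_fset_set // inE => /sub.
Qed.

End TwoPageDrawing.

(** * Evaluation of the three minima *)

Lemma minimum_eq (A : set nat) k : A k -> (forall m, A m -> (k <= m)%N) -> minimum A = Some k.
Proof.
move=> Ak min; rewrite /minimum; case: pselect => [ex|no]; last first.
  by exfalso; apply: no; exists k; apply/asboolP.
case: ex_minnP => m /asboolP Am mP; congr Some; apply/eqP.
by rewrite eqn_leq min // mP //; apply/asboolP.
Qed.

Section LowerBounds.
Variables (R : realType) (n : nat) (D : predrawing R (complete_graph n)).
Hypothesis M : is_monotone_drawing D.

Lemma crossing_count_ge : (hill_number n <= crossing_count D)%N.
Proof.
(* Numbering the vertices by all natural numbers requires at least one vertex. *)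
have [n0|n0] := posnP n; first by rewrite [X in hill_number X]n0.
by have [v [F C]] := exists_charts M n0; exact: crossing_count_chart M C.
Qed.

Lemma odd_pair_count_ge : weakly_semisimple D -> (hill_number n <= odd_pair_count D)%N.
Proof.
move=> weak; have [n0|n0] := posnP n; first by rewrite [X in hill_number X]n0.
by have [v [F C]] := exists_charts M n0; exact: odd_pair_count_chart M C weak.
Qed.

Lemma semisimple_weakly : semisimple D -> weakly_semisimple D.
Proof.
by move=> ss e f ein fin adj; rewrite /pair_crossing_count ss // fset_set0 cardfs0.
Qed.

End LowerBounds.

Theorem theorem1 (R : realType) (n : nat) :
  [/\ mon_ocr_pm R (complete_graph n) = mon_ocr_plus R (complete_graph n),
      mon_ocr_plus R (complete_graph n) = mon_cr R (complete_graph n) &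
      mon_cr R (complete_graph n) = Some (hill_number n)].
Proof.
have M := two_page_is_monotone R n; have ss := @two_page_semisimple R n.
have ws := semisimple_weakly ss.
have oc : odd_pair_count (two_page_drawing R n) = hill_number n.
  by apply/eqP; rewrite eqn_leq two_page_odd_pair_count odd_pair_count_ge.
have cc : crossing_count (two_page_drawing R n) = hill_number n.
  by apply/eqP; rewrite eqn_leq two_page_crossing_count crossing_count_ge.
have -> : mon_cr R (complete_graph n) = Some (hill_number n).
  apply: minimum_eq => [|_ [D' M' <-]]; last exact: crossing_count_ge.
  by exists (two_page_drawing R n).
have -> : mon_ocr_plus R (complete_graph n) = Some (hill_number n).
  apply: minimum_eq => [|_ [D' [M' /semisimple_weakly ss'] <-]].
    by exists (two_page_drawing R n).
  exact: odd_pair_count_ge.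
have -> : mon_ocr_pm R (complete_graph n) = Some (hill_number n).
  apply: minimum_eq => [|_ [D' [M' ws'] <-]]; last exact: odd_pair_count_ge.
  by exists (two_page_drawing R n).
by [].
Qed.
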